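(* Let $M$ be a one-holed torus, let $l_\delta>0$, and let $\mathcal{T}_1(l_\delta)$ be the Teichmüller space of $M$ with boundary length $l_\delta$. Let $\alpha,\beta$ be a pair of oriented simple closed geodesics on $M$ which meet in exactly one point and whose signed angle $\alpha\vee\beta$ is positive. Let $\mu$ be a simple closed geodesic on $M$ and $t(\mu)$ the associated Fenchel-Nielsen vector field on $\mathcal{T}_1(l_\delta)$. Then at every point of $\mathcal{T}_1(l_\delta)$ the series $$\sum_{g\in \mathcal{MCG}} d\bigl(g(\alpha)\vee g(\beta)\bigr)\cdot t(\mu)$$ converges absolutely and its sum is $0$.
   Context: $\mathcal{T}_1(l_\delta)$ is the space of marked hyperbolic structures on the one-holed torus $M$ with geodesic boundary $\delta$ of fixed length $l_\delta$. $\mathcal{MCG}=\pi_0(\mathrm{Diffeo}^+(M))\cong \mathrm{SL}_2(\mathbf{Z})$ is the group of orientation-preserving diffeomorphisms of $M$ up to isotopy. For $g\in\mathcal{MCG}$ and an (oriented) closed geodesic $\gamma$, $g(\gamma)$ denotes the (oriented) closed geodesic homotopic to the image of $\gamma$ under $g$. Signed angle: for two distinct oriented geodesics $\alpha,\beta$ in the hyperbolic plane $\mathbf{H}^2$ meeting at a point $x$, work in the disc model and conjugate by an orientation-preserving isometry so that $x=0$, $\alpha=(-1,1)$ oriented from $-1$ to $1$, and $\beta=(-e^{i\theta},e^{i\theta})$ oriented from $-e^{i\theta}$ to $e^{i\theta}$, with $\theta\in(-\pi,\pi)$; the signed angle is $\alpha\vee_x\beta=\theta$. For oriented geodesics on a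 surface meeting at $x$, the signed angle at $x$ is defined by lifting to $\mathbf{H}^2$. If they meet in a single point, it is written $\alpha\vee\beta$. For a pair of oriented simple closed geodesics on $M$ meeting in exactly one point, $\alpha\vee\beta$ is viewed as a function on $\mathcal{T}_1(l_\delta)$ (taking at each hyperbolic structure the geodesic representatives of the homotopy classes). This function is differentiable, and $d$ denotes its differential. The Fenchel-Nielsen vector field $t(\mu)$ is the vector field on $\mathcal{T}_1(l_\delta)$ generating the unit-speed Fenchel-Nielsen twist deformation along $\mu$; $d(\cdot)\cdot t(\mu)$ denotes the pairing of a 1-form with this vector field. *)

(* Defs.v *)
From HB Require Import structures.
From mathcomp Require Import all_boot all_order all_algebra generic_quotient.
From mathcomp Require Import all_classical all_reals all_analysis.
From mathcomp Require Import complex.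

Set Implicit Arguments.
Unset Strict Implicit.
Unset Printing Implicit Defensive.

Import Order.TTheory GRing.Theory Num.Theory numFieldNormedType.Exports.

(* The one-holed torus M is represented by its fundamental group, the free    *)
(* group F2 on the classes of two oriented simple loops a, b meeting once,    *)
(* positively; its boundary curve is freely homotopic to the commutator       *)
(* [~ a, b].  An oriented closed curve up to homotopy is a conjugacy class of *)
(* F2, handled through a representative; every notion below that is used for  *)
(* closed curves is invariant under conjugation.                              *)

Section FreeGroup.

(* (x, false) is the generator x and (x, true) its inverse. *)
Definition letter := (bool * bool)%type.
Definition linv (x : letter) : letter := (x.1, ~~ x.2).

Definition reduced (w : seq letter) := sorted (fun x y => y != linv x) w.

Definition push (x : letter) (w : seq letter) :=
  if w is y :: w' then if y == linv x then w' else x :: w else [:: x].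

Definition mulw (u v : seq letter) := foldr push v u.

Definition invw (u : seq letter) := rev (map linv u).

Lemma linvK : involutive linv.
Proof. by case=> x e; rewrite /linv /= negbK. Qed.

Lemma push_reduced x w : reduced w -> reduced (push x w).
Proof.
case: w => [//|y w] /=; case: ifP => [_|/negbT xy]; first exact: path_sorted.
by move=> /= ->; rewrite xy.
Qed.

Lemma mulw_reduced u v : reduced v -> reduced (mulw u v).
Proof. by move=> rv; elim: u => //= x u; apply: push_reduced. Qed.

Lemma pushK x w : reduced w -> push (linv x) (push x w) = w.
Proof.
case: w => [_|y w]; first by rewrite /= linvK eqxx.
rewrite /reduced /=; case: ifP => [/eqP ->|_ _]; last by rewrite /= linvK eqxx.
by case: w => [//|z w] /= /andP[/negPf ->].
Qed.

Lemma pushVK x w : reduced w -> push x (push (linv x) w) = w.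
Proof. by move=> rw; rewrite -{1}(linvK x) pushK. Qed.

Lemma mulw_push x v w : reduced w -> mulw (push x v) w = push x (mulw v w).
Proof.
move=> rw; case: v => [//|y v] /=; case: ifP => [/eqP ->|//].
by rewrite pushVK //; apply: mulw_reduced.
Qed.

Lemma mulwA u v w : reduced w -> mulw u (mulw v w) = mulw (mulw u v) w.
Proof. by move=> rw; elim: u => //= x u ->; rewrite mulw_push. Qed.

Lemma mulw0 u : reduced u -> mulw u [::] = u.
Proof.
elim: u => [//|x u IHu] /= pu; rewrite IHu; last exact: path_sorted pu.
by case: u pu {IHu} => [//|y u] /= /andP[/negPf ->].
Qed.

Lemma invw_reduced u : reduced u -> reduced (invw u).
Proof.
rewrite /reduced /invw rev_sorted sorted_map; apply: sub_sorted => x y /=.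
by rewrite linvK eq_sym.
Qed.

Lemma mulVw u : reduced u -> mulw (invw u) u = [::].
Proof.
rewrite /invw /mulw; elim: u => [//|x u IHu] ru.
rewrite /= rev_cons foldr_rcons /= linvK eqxx; apply: IHu.
exact: path_sorted ru.
Qed.

Record F2 := MkF2 { word : seq letter; word_reduced : reduced word }.

HB.instance Definition _ := [isSub for word].
HB.instance Definition _ := [Countable of F2 by <:].

Definition F2_one := @MkF2 [::] isT.
Definition F2_mul (u v : F2) := MkF2 (mulw_reduced (word u) (word_reduced v)).
Definition F2_inv (u : F2) := MkF2 (invw_reduced (word_reduced u)).

Lemma F2_mulA : associative F2_mul.
Proof. by move=> u v w; apply/val_inj/mulwA/word_reduced. Qed.
Lemma F2_mul1 : left_id F2_one F2_mul.
Proof. by move=> u; apply/val_inj. Qed.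
Lemma F2_1mul : right_id F2_one F2_mul.
Proof. by move=> u; apply/val_inj/mulw0/word_reduced. Qed.
Lemma F2_mulV : left_inverse F2_one F2_inv F2_mul.
Proof. by move=> u; apply/val_inj/mulVw/word_reduced. Qed.
Lemma F2_invK : involutive F2_inv.
Proof.
move=> u; apply/val_inj; rewrite /= /invw map_rev revK -map_comp.
by rewrite (eq_map (g := id)) ?map_id // => x; apply: linvK.
Qed.
Lemma F2_Vmul : right_inverse F2_one F2_inv F2_mul.
Proof. by move=> u; rewrite -{1}(F2_invK u) F2_mulV. Qed.

HB.instance Definition _ :=
  isGroup.Build F2 F2_mulA F2_mul1 F2_1mul F2_mulV F2_Vmul.

Definition gen_a : F2 := @MkF2 [:: (true, false)] isT.
Definition gen_b : F2 := @MkF2 [:: (false, false)] isT.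

Definition bdry : F2 := [~ gen_a, gen_b]%g.

End FreeGroup.

Section MappingClassGroup.

Local Open Scope group_scope.

(* By the Dehn-Nielsen-Baer theorem, the group of orientation-preserving      *)
(* diffeomorphisms of M up to isotopy is the group of automorphisms of F2     *)
(* preserving the conjugacy class of the oriented boundary curve, modulo      *)
(* inner automorphisms.                                                       *)
Definition mcg_aut (f : F2 -> F2) : Prop :=
  [/\ {morph f : x y / x * y}, bijective f & exists c, f bdry = bdry ^ c].

Definition autP := {f : F2 -> F2 | `[< mcg_aut f >]}.

Definition outer_eq (f g : autP) : bool :=
  `[< exists c, forall x, val g x = val f x ^ c >].

Lemma outer_eq_refl : reflexive outer_eq.
Proof. by move=> f; apply/asboolP; exists 1 => x; rewrite conjg1. Qed.

Lemma outer_eq_sym : symmetric outer_eq.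
Proof.
suff S f g : outer_eq f g -> outer_eq g f by move=> f g; apply/idP/idP; apply: S.
move=> /asboolP[c fg]; apply/asboolP; exists c^-1 => x.
by rewrite fg conjgK.
Qed.

Lemma outer_eq_trans : transitive outer_eq.
Proof.
move=> g f h /asboolP[c fg] /asboolP[d gh]; apply/asboolP; exists (c * d) => x.
by rewrite gh fg conjgM.
Qed.

Definition outer_equiv :=
  EquivRel outer_eq outer_eq_refl outer_eq_sym outer_eq_trans.

Definition MCG := {eq_quot outer_equiv}%qT.
HB.instance Definition _ := Choice.on MCG.

(* The class of g(gamma) does not depend on the representative of g. *)
Definition mcg_act (g : MCG) (gamma : F2) : F2 := val (repr g) gamma.

End MappingClassGroup.

Local Open Scope ring_scope.
Local Open Scope classical_set_scope.
Local Open Scope complex_scope.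

Section HyperbolicPlane.

Variable R : realType.
Implicit Types (g X Y : 'M[R]_2) (l th s : R) (z : R[i]).

Definition mx2 (a b c d : R) : 'M[R]_2 :=
  \matrix_(i < 2, j < 2)
    if i == 0 then (if j == 0 then a else b) else (if j == 0 then c else d).

(* The action of SL_2(R) on the upper half-plane; X and - X act alike. *)
Definition mobius g z : R[i] :=
  ((g 0 0)%:C * z + (g 0 1)%:C) / ((g 1 0)%:C * z + (g 1 1)%:C).

(* Translation by l along the geodesic oriented from 0 to oo. *)
Definition trans l := mx2 (expR (l / 2)) 0 0 (expR (- (l / 2))).

(* Rotation by the angle th (counterclockwise) about 'i. *)
Definition rot th :=
  mx2 (cos (th / 2)) (sin (th / 2)) (- sin (th / 2)) (cos (th / 2)).

(* X is the translation of length l along the oriented geodesic g(0 -> oo). *)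
Definition translation_along X g l : Prop :=
  [/\ \det g = 1, 0 < l &
      X = g *m trans l *m invmx g \/ X = - (g *m trans l *m invmx g)].

Definition axis X : set R[i] :=
  [set z | exists g l s, translation_along X g l /\
                         z = mobius (g *m trans s) 'i].

(* The Cayley map z |-> (z - i) / (z + i) sends 'i to 0 and the oriented      *)
(* geodesic 0 -> oo to (-1, 1), and conjugates rot th to the multiplication   *)
(* by e^(i th), so that rot th (0 -> oo) corresponds to the diameter from     *)
(* - e^(i th) to e^(i th).                                                    *)
Definition signed_angle X Y th : Prop :=
  [/\ - pi < th < pi, th != 0 &
      exists g l m, translation_along X g l /\
                    translation_along Y (g *m rot th) m].

End HyperbolicPlane.

Section Teichmueller.

Variable R : realType.

(* A marked hyperbolic structure on M with geodesic boundary of length l is   *)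
(* given by its holonomy, a discrete faithful representation of F2 in         *)
(* PSL_2(R), defined up to conjugation, and lifted here to SL_2(R) (possible  *)
(* since F2 is free).  M is the convex core of the quotient.  That the        *)
(* quotient is a one-holed torus marked by an orientation-preserving map (and *)
(* not a pair of pants, the other surface with free fundamental group of rank *)
(* 2) is expressed by the positive crossing of the axes of a and b.           *)
Record teich (l : R) := Teich {
  hol :> F2 -> 'M[R]_2;
  hol_det : forall u, \det (hol u) = 1;
  holM : forall u v, hol (u * v)%g = hol u *m hol v;
  hol_faithful : forall u, hol u = 1%:M \/ hol u = - 1%:M -> u = 1%g;
  hol_discrete : exists2 e : R, 0 < e &
    forall u, (forall i j, `|hol u i j - (1%:M : 'M[R]_2) i j| < e) ->
      hol u = 1%:M;
  hol_marking : exists2 th, 0 < th & signed_angle (hol gen_a) (hol gen_b) th;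
  hol_bdry : exists g, translation_along (hol bdry) g l
}.

Variable l : R.
Implicit Types (X : teich l) (u v : F2).

(* All lifts to the upper half-plane of the closed geodesic u. *)
Definition lifts X u : set R[i] := \bigcup_h axis (X (u ^ h)%g).

(* The closed geodesic, axis (X u) modulo u, injects in the quotient surface; *)
(* in particular u is not a proper power.                                     *)
Definition simple_geodesic X u : Prop :=
  axis (X u) !=set0 /\
  forall h z, axis (X u) z -> axis (X u) (mobius (X h) z) ->
    exists n : nat, (h = u ^+ n \/ h = u ^- n)%g.

(* The common points of u and v on the quotient surface are the orbits        *)
(* contained in the following intersection.                                   *)
Definition meet_once X u v : Prop :=
  exists z, lifts X u `&` lifts X v = [set mobius (X h) z | h in [set: F2]].

(* The signed angle of u and v at their intersection point, up to the action  *)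
(* of F2 on pairs of lifts; a junk value if they do not meet exactly once.    *)
Definition vee u v X : R :=
  xget 0 [set th | exists h, signed_angle (X u) (X (v ^ h)%g) th].

(* The unit speed (left) Fenchel-Nielsen twist along mu starting at X.  If mu *)
(* is not the boundary, let nu be a simple closed geodesic crossing mu once,  *)
(* from right to left.  Cutting M along mu presents F2 as an HNN extension    *)
(* with stable letter nu, and gluing back after a shift to the left by a      *)
(* length t multiplies nu by the translation of length - t along the axis of  *)
(* mu, leaving mu unchanged.  Twisting along the boundary does nothing.       *)
Definition twist_path X (mu : F2) (sigma : R -> teich l) : Prop :=
  (forall u, sigma 0 u = X u) /\
  ((exists c, mu = (bdry ^ c)%g \/ mu = (bdry^-1 ^ c)%g) /\
     (forall t u, sigma t u = X u)
   \/
   exists nu g m,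
     [/\ simple_geodesic X nu, meet_once X mu nu,
         exists2 th, 0 < th & signed_angle (X mu) (X nu) th,
         translation_along (X mu) g m &
         forall t, sigma t mu = X mu /\
           sigma t nu = X nu *m (g *m trans (- t) *m invmx g)]).

End Teichmueller.

(* Main.v *)
Require Import Defs.
From mathcomp Require Import all_boot all_order all_algebra generic_quotient.
From mathcomp Require Import all_classical all_reals all_analysis.
From mathcomp Require Import complex ring lra zify.
Import Order.TTheory GRing.Theory Num.Theory numFieldNormedType.Exports.
Local Open Scope ring_scope.
Local Open Scope classical_set_scope.

Set Implicit Arguments.
Unset Strict Implicit.
Unset Printing Implicit Defensive.

(** The sum vanishes because of a symmetry.  Rotating the torus by a quarter
  turn about the intersection point gives a mapping class s that maps the pair
  (alpha, beta) to (beta, alpha^-1).  Replacing g by g s replaces the angle of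
  g(alpha) and g(beta) by pi minus it, or by - pi minus it, so the derivative
  changes its sign ([dangle_swap]), and the translation g -> g s is a bijection
  of the mapping class group.  As soon as the series converges absolutely, its
  sum is therefore equal to its opposite ([antisymmetric_sum]).  The rest is
  about absolute convergence.

  The derivative in terms of traces.  A structure is a representation of the
  free group for which D = 2 - tr [A, B], with A and B the images of the generators, is a
  constant larger than 4, fixed by the boundary length.  If u and v meet once,
  and x, y, z are the traces of u, v and u v, then the cotangent of the angle is
  (2 z - x y) / (2 sqrt D) up to sign ([angle_theta]), and its derivative is
  2 sqrt D (2 z' - x' y - x y') / ((x^2 - 4) (y^2 - 4)) up to sign
  ([theta_derive]).  Along a twist deformation all traces are differentiable
  ([twist_mder]).

  Exponential decay.  In the basis spanned by two fixed points of conjugates of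
  the boundary, the generators have positive entries up to sign
  ([positive_basis]).  On positive words of lengths p and q the traces then grow
  exponentially ([wm_off]), whereas their logarithmic derivatives grow at most
  linearly ([wmd_mle]); so the derivative of the angle is at most C r^p r^q with
  r < 1 ([dangle_decay]).

  Enumeration.  In the outer automorphism group every mapping class is, up to
  rotations of order four on both sides, a product of the positive twists
  (a, b) -> (a, a b) and (a, b) -> (a b, b) ([moves_normalizable]), and this
  product is determined by the lengths p and q of the images of a and b
  ([pwords_inj]).  Hence finitely many double geometric series bound the sum
  ([decay_sum]).

  The curves.  The argument needs that every pair of simple curves meeting once
  is the image of (a, b) or (a, b^-1) under a product of twists and rotations:
  for alpha and beta, for mu and the curve that defines the twist along it, and
  for the images of a and b under an arbitrary automorphism preserving the
  boundary.  This topological fact is proved by looking at the circle at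
  infinity.  The generators are in ping-pong position with respect to four arcs
  ([schottky_exists]), so the fixed points of an element, hence the crossings of
  axes, are read off its cyclic word ([attract_arc], [dt4_through]).  A word of
  minimal length under the twists whose translates do not cross must be a letter
  or turn always to the same side ([flanked_balanced], [flanked_rigid]); in the
  second case it is peripheral and crosses nothing ([peripheral_noncross]).
  This classifies the simple curves ([simple_classification]), and the same
  reduction by the twists along a alone classifies the curves that meet a once
  ([meets_a_basis], [basis_of_pair]). *)


(** * Two-by-two matrices *)

Section Plane.
Variable R : realType.
Implicit Types (M X Y : 'M[R]_2) (u v w p q r : R * R).

Lemma sum_ord2 (V : nmodType) (F : 'I_2 -> V) : \sum_(i < 2) F i = F 0 + F 1.
Proof. by rewrite !big_ord_recl big_ord0 addr0; congr (_ + F _); apply: val_inj. Qed.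

Lemma ord2P (i : 'I_2) : i = 0 \/ i = 1.
Proof.
by case: i => [[|[|//]] ?]; [left | right]; apply: val_inj.
Qed.

Lemma mx2P X Y :
  X 0 0 = Y 0 0 -> X 0 1 = Y 0 1 -> X 1 0 = Y 1 0 -> X 1 1 = Y 1 1 -> X = Y.
Proof.
move=> h1 h2 h3 h4; apply/matrixP => i j.
by case: (ord2P i) => ->; case: (ord2P j) => ->.
Qed.

Lemma mul2E X Y i j : (X *m Y) i j = X i 0 * Y 0 j + X i 1 * Y 1 j.
Proof. by rewrite mxE sum_ord2. Qed.

Lemma tr2E X : \tr X = X 0 0 + X 1 1.
Proof. by rewrite /mxtrace sum_ord2. Qed.

Lemma det2E X : \det X = X 0 0 * X 1 1 - X 0 1 * X 1 0.
Proof.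
rewrite (expand_det_row _ 0) sum_ord2 /cofactor !det_mx11 !mxE /=.
have -> : lift 0 0 = 1 :> 'I_2 by apply: val_inj.
have -> : lift 1 0 = 0 :> 'I_2 by apply: val_inj.
by rewrite /= expr0 mul1r expr1 mulN1r mulrN.
Qed.

Lemma mx2E (a b c d : R) :
  [/\ mx2 a b c d 0 0 = a, mx2 a b c d 0 1 = b,
      mx2 a b c d 1 0 = c & mx2 a b c d 1 1 = d].
Proof. by rewrite /mx2 !mxE. Qed.

Lemma mx2_00 (a b c d : R) : mx2 a b c d 0 0 = a. Proof. by case: (mx2E a b c d). Qed.
Lemma mx2_01 (a b c d : R) : mx2 a b c d 0 1 = b. Proof. by case: (mx2E a b c d). Qed.
Lemma mx2_10 (a b c d : R) : mx2 a b c d 1 0 = c. Proof. by case: (mx2E a b c d). Qed.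
Lemma mx2_11 (a b c d : R) : mx2 a b c d 1 1 = d. Proof. by case: (mx2E a b c d). Qed.
Definition mx2s := (mx2_00, mx2_01, mx2_10, mx2_11).

Lemma add2E X Y i j : (X + Y) i j = X i j + Y i j. Proof. by rewrite mxE. Qed.
Lemma opp2E X i j : (- X) i j = - X i j. Proof. by rewrite mxE. Qed.
Lemma scale2E (a : R) X i j : (a *: X) i j = a * X i j. Proof. by rewrite mxE. Qed.
Lemma one2_00 : (1%:M : 'M[R]_2) 0 0 = 1. Proof. by rewrite mxE. Qed.
Lemma one2_01 : (1%:M : 'M[R]_2) 0 1 = 0. Proof. by rewrite mxE. Qed.
Lemma one2_10 : (1%:M : 'M[R]_2) 1 0 = 0. Proof. by rewrite mxE. Qed.
Lemma one2_11 : (1%:M : 'M[R]_2) 1 1 = 1. Proof. by rewrite mxE. Qed.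
Definition en2 := (mul2E, add2E, opp2E, scale2E, mx2s,
                   (one2_00, one2_01, one2_10, one2_11)).

Definition adj2 X : 'M[R]_2 := mx2 (X 1 1) (- X 0 1) (- X 1 0) (X 0 0).

Lemma det_adj2 X : \det (adj2 X) = \det X.
Proof. by rewrite !det2E !en2; ring. Qed.

Lemma mul_adj2 X : \det X = 1 -> X *m adj2 X = 1%:M.
Proof.
by rewrite det2E => dX; apply: mx2P; rewrite !en2 -?dX; ring.
Qed.

Lemma adj2_mul X : \det X = 1 -> adj2 X *m X = 1%:M.
Proof.
by rewrite det2E => dX; apply: mx2P; rewrite !en2 -?dX; ring.
Qed.

Lemma invmx2 X : \det X = 1 -> invmx X = adj2 X.
Proof.
move=> dX; have uX : X \in unitmx by rewrite unitmxE dX unitr1.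
by rewrite -[RHS]mul1mx -(mulVmx uX) -mulmxA mul_adj2 // mulmx1.
Qed.

(** Vectors are pairs, and points of the boundary circle are vectors up to a
nonzero factor. *)
Definition act X v : R * R := (X 0 0 * v.1 + X 0 1 * v.2, X 1 0 * v.1 + X 1 1 * v.2).
Definition dt u v : R := u.1 * v.2 - u.2 * v.1.
Definition scv (c : R) v : R * R := (c * v.1, c * v.2).

Lemma actM X Y v : act (X *m Y) v = act X (act Y v).
Proof. by rewrite /act !en2 /=; congr pair; ring. Qed.

Lemma act1 v : act 1%:M v = v.
Proof. by case: v => x y; rewrite /act !en2 /=; congr pair; ring. Qed.

Lemma act_scv X c v : act X (scv c v) = scv c (act X v).
Proof. by rewrite /act /scv /=; congr pair; ring. Qed.

Lemma dt_act X u v : dt (act X u) (act X v) = \det X * dt u v.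
Proof. by rewrite /dt /act det2E /=; ring. Qed.

Lemma dtC u v : dt v u = - dt u v. Proof. by rewrite /dt; ring. Qed.
Lemma dt_scl c u v : dt (scv c u) v = c * dt u v.
Proof. by rewrite /dt /scv /=; ring. Qed.
Lemma dt_scr c u v : dt u (scv c v) = c * dt u v.
Proof. by rewrite /dt /scv /=; ring. Qed.
Lemma dtvv u : dt u u = 0. Proof. by rewrite /dt; ring. Qed.
Lemma scvA c d u : scv c (scv d u) = scv (c * d) u.
Proof. by rewrite /scv /=; congr pair; ring. Qed.
Lemma scv1 u : scv 1 u = u.
Proof. by case: u => a b; rewrite /scv /= !mul1r. Qed.
Lemma scv_neq0 c u : c != 0 -> u != 0 -> scv c u != 0.
Proof.
case: u => a b c0; apply: contraNneq => -[/eqP].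
by rewrite !mulf_eq0 (negPf c0) /= => /eqP -> /eqP; rewrite mulf_eq0 (negPf c0) => /eqP ->.
Qed.

Lemma dt_neq0l u v : dt u v != 0 -> u != 0.
Proof. by apply: contraNneq => ->; rewrite /dt /= !mul0r subrr. Qed.
Lemma dt_neq0r u v : dt u v != 0 -> v != 0.
Proof. by rewrite dtC oppr_eq0; apply: dt_neq0l. Qed.

Lemma dt_eq0 u v : u != 0 -> dt u v = 0 -> exists c, v = scv c u.
Proof.
case: u v => [a b] [c d]; rewrite /dt /scv /= => u0 h.
have [a0|a0] := eqVneq a 0.
  have b0 : b != 0 by apply: contraNneq u0 => ->; rewrite a0.
  exists (d / b); move: h; rewrite a0 mul0r sub0r => /eqP.
  rewrite oppr_eq0 mulf_eq0 (negPf b0) /= => /eqP ->.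
  by rewrite mulr0 divfK.
exists (c / a); rewrite divfK //; congr pair.
by apply: (mulfI a0); rewrite mulrA mulrCA divff // mulr1 mulrC; lra.
Qed.

Lemma act_neq0 X v : \det X = 1 -> v != 0 -> act X v != 0.
Proof.
move=> dX; apply: contraNneq => h.
rewrite -[v]act1 -(adj2_mul dX) actM h /act /=.
by rewrite !mulr0 addr0.
Qed.

(** For X and Y of determinant 1 the determinant of [comm2 X Y] is 2 - tr [X,
  Y]; it is positive when the axes of X and Y cross, see [cross_eig]. *)
Definition comm2 X Y := X *m Y - Y *m X.
Definition cross X Y := 0 < \det (comm2 X Y).

Lemma det_comm2 X Y : \det X = 1 -> \det Y = 1 ->
  \det (comm2 X Y) = 4 - (\tr X) ^+ 2 - (\tr Y) ^+ 2 - (\tr (X *m Y)) ^+ 2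
     + \tr X * \tr Y * \tr (X *m Y).
Proof.
rewrite /comm2 !det2E !tr2E !en2 => dX dY.
move: (X 0 0) (X 0 1) (X 1 0) (X 1 1) (Y 0 0) (Y 0 1) (Y 1 0) (Y 1 1) dX dY.
move=> a b c d a' b' c' d' dX dY.
have -> : 4 = 2 * (a * d - b * c) + 2 * (a' * d' - b' * c') by rewrite dX dY; ring.
have -> : (a + d) ^+ 2 = (a + d) ^+ 2 * (a' * d' - b' * c') by rewrite dY mulr1.
have -> : (a' + d') ^+ 2 = (a' + d') ^+ 2 * (a * d - b * c) by rewrite dX mulr1.
have -> : 2 * (a * d - b * c) + 2 * (a' * d' - b' * c') =
   4 * (a * d - b * c) * (a' * d' - b' * c') by rewrite dX dY; ring.
by ring.
Qed.

Lemma tr_comm X Y : \det X = 1 -> \det Y = 1 ->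
  \tr (adj2 X *m (adj2 Y *m (X *m Y))) = 2 - \det (comm2 X Y).
Proof.
move=> dX dY; rewrite det_comm2 // /adj2.
move: dX dY; rewrite !det2E !tr2E !en2.
move: (X 0 0) (X 0 1) (X 1 0) (X 1 1) (Y 0 0) (Y 0 1) (Y 1 0) (Y 1 1).
move=> a b c d a' b' c' d' dX dY.
have -> : 2 - (4 - (a + d) ^+ 2 - (a' + d') ^+ 2 - (a * a' + b * c' + (c * b' + d * d')) ^+ 2
  + (a + d) * (a' + d') * (a * a' + b * c' + (c * b' + d * d'))) =
  - 2 * (a * d - b * c) * (a' * d' - b' * c') +
  (a + d) ^+ 2 * (a' * d' - b' * c') + (a' + d') ^+ 2 * (a * d - b * c) +
  (a * a' + b * c' + (c * b' + d * d')) ^+ 2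
  - (a + d) * (a' + d') * (a * a' + b * c' + (c * b' + d * d')).
  by rewrite dX dY; ring.
by ring.
Qed.

Lemma crossC X Y : cross X Y -> cross Y X.
Proof. by rewrite /cross /comm2 !det2E !en2 => h; apply: le_lt_trans h _ || (move: h; congr (_ < _)); ring. Qed.

End Plane.

(** * Fixed points of hyperbolic elements *)

Section Eigenlines.
Variable R : realType.
Implicit Types (X Y : 'M[R]_2) (e f p q r v : R * R) (m n : R).

Definition hyp X := 4 < (\tr X) ^+ 2.

(** e spans the attracting and f the repelling fixed point of X on the circle
  at infinity. *)
Definition eig X m e f :=
  [/\ 1 < m ^+ 2, act X e = scv m e, act X f = scv m^-1 f & dt e f != 0].

Lemma eig_exists X : \det X = 1 -> hyp X -> exists m e f, eig X m e f.
Proof.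
rewrite /hyp => dX hX.
pose t := \tr X; pose D := t ^+ 2 - 4; pose s := Num.sqrt D.
have D0 : 0 < D by rewrite subr_gt0.
have s0 : 0 < s by rewrite sqrtr_gt0.
have ss : s ^+ 2 = D by rewrite sqr_sqrtr // ltW.
have [m [m' [m1 mm' mt]]] : exists m m', [/\ 1 < m ^+ 2, m * m' = 1 & m + m' = t].
  have [t0|t0] := ltP 0 t.
    exists ((t + s) / 2), ((t - s) / 2); split.
    - have : 0 < t * s by rewrite mulr_gt0.
      by move: ss; rewrite /D; nra.
    - by rewrite /D in ss; nra.
    - by field.
  exists ((t - s) / 2), ((t + s) / 2); split.
  - have : t * s <= 0 by rewrite mulr_le0_ge0 // ltW.
    by move: ss; rewrite /D; nra.
  - by rewrite /D in ss; nra.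
  - by field.
have m0 : m != 0 by apply: contraTneq m1 => ->; rewrite expr0n /= ltr10.
have m'E : m' = m^-1 by apply: (mulfI m0); rewrite mm' divff.
have mm0 : m - m' != 0.
  by apply: contraTneq m1 => /eqP; rewrite subr_eq0 => /eqP h; rewrite expr2 {2}h mm' ltxx.
exists m; rewrite /eig -m'E.
move: dX mt; rewrite /t /act /scv /dt det2E tr2E.
move: (X 0 0) (X 0 1) (X 1 0) (X 1 1) => a b c d dX mt.
have [b0|b0] := eqVneq b 0; last first.
  exists (b, m - a), (b, m' - a); split => //=.
  - by congr pair; nra.
  - by congr pair; nra.
  - have -> : b * (m' - a) - (m - a) * b = - (b * (m - m')) by ring.
    by rewrite oppr_eq0 mulf_neq0.
have [c0|c0] := eqVneq c 0; last first.
  exists (m - d, c), (m' - d, c); split => //=.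
  - by congr pair; nra.
  - by congr pair; nra.
  - have -> : (m - d) * c - c * (m' - d) = c * (m - m') by ring.
    by rewrite mulf_neq0.
have : (a - m) * (a - m') = 0 by nra.
move/eqP; rewrite mulf_eq0 !subr_eq0 => /orP[] /eqP aE.
  have dE : d = m' by lra.
  exists (1, 0), (0, 1); split => //=.
  - by congr pair; rewrite ?b0 ?c0 ?aE; ring.
  - by congr pair; rewrite ?b0 ?c0 ?dE; ring.
have dE : d = m by lra.
exists (0, 1), (1, 0); split => //=.
- by congr pair; rewrite ?b0 ?c0 ?dE; ring.
- by congr pair; rewrite ?b0 ?c0 ?aE; ring.
Qed.

Lemma eig_neq0 X m e f : eig X m e f -> m != 0.
Proof. by case=> h _ _ _; apply: contraTneq h => ->; rewrite expr0n /= ltr10. Qed.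

Lemma eig_entries X m e f : eig X m e f ->
  let d := dt e f in let s := m - m^-1 in
  [/\ d * (X 0 0 - X 1 1) = s * (e.1 * f.2 + f.1 * e.2),
      d * X 0 1 = - s * e.1 * f.1 & d * X 1 0 = s * e.2 * f.2].
Proof.
case: e f => [e1 e2] [f1 f2] [_ [h1 h2] [h3 h4] _] /=; rewrite /dt /=.
move: (m^-1) h1 h2 h3 h4 => m' h1 h2 h3 h4.
move: h1 h2 h3 h4; move: (X 0 0) (X 0 1) (X 1 0) (X 1 1) => a b c d h1 h2 h3 h4.
split.
- have -> : (e1 * f2 - e2 * f1) * (a - d) = (a * e1 + b * e2) * f2 - e2 * (a * f1 + b * f2)
    - e1 * (c * f1 + d * f2) + (c * e1 + d * e2) * f1 by ring.
  by rewrite h1 h2 h3 h4; ring.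
- have -> : (e1 * f2 - e2 * f1) * b = e1 * (a * f1 + b * f2) - f1 * (a * e1 + b * e2) by ring.
  by rewrite h1 h3; ring.
- have -> : (e1 * f2 - e2 * f1) * c = f2 * (c * e1 + d * e2) - e2 * (c * f1 + d * f2) by ring.
  by rewrite h2 h4; ring.
Qed.

(** In an eigenbasis of X only the off-diagonal entries of Y contribute to the
  commutator, and they are products of two of the four determinants. *)
Lemma det_comm2_eig X Y m n e f e' f' : eig X m e f -> eig Y n e' f' ->
  \det (comm2 X Y) * ((dt e f) ^+ 2 * (dt e' f') ^+ 2) =
  - ((m - m^-1) ^+ 2 * (n - n^-1) ^+ 2) *
    (dt e e' * dt e f' * (dt f e' * dt f f')).
Proof.
move=> hX hY; have [/= p1 q1 r1] := eig_entries hX; have [/= p2 q2 r2] := eig_entries hY.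
rewrite /comm2 det2E !en2.
move: p1 q1 r1 p2 q2 r2.
move: (X 0 0) (X 0 1) (X 1 0) (X 1 1) (Y 0 0) (Y 0 1) (Y 1 0) (Y 1 1).
move=> a b c d a' b' c' d' p1 q1 r1 p2 q2 r2.
set D := dt e f in p1 q1 r1 *; set D' := dt e' f' in p2 q2 r2 *.
set s := m - m^-1 in p1 q1 r1 *; set s' := n - n^-1 in p2 q2 r2 *.
transitivity (((D * b) * (D' * c') - (D' * b') * (D * c)) * - ((D * b) * (D' * c') - (D' * b') * (D * c))
  - ((D * (a - d)) * (D' * b') - (D' * (a' - d')) * (D * b)) *
    ((D' * (a' - d')) * (D * c) - (D * (a - d)) * (D' * c'))); first by ring.
by rewrite p1 q1 r1 p2 q2 r2 /dt; ring.
Qed.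

Lemma eig_sub_neq0 X m e f : eig X m e f -> 0 < (m - m^-1) ^+ 2.
Proof.
move=> hX; have m0 := eig_neq0 hX; case: hX => m1 _ _ _.
rewrite exprn_even_gt0 //= subr_eq0.
by apply: contraTneq m1 => h; rewrite expr2 {2}h divff // ltxx.
Qed.

Lemma cross_eig X Y m n e f e' f' : eig X m e f -> eig Y n e' f' ->
  cross X Y <-> dt e e' * dt e f' * (dt f e' * dt f f') < 0.
Proof.
move=> hX hY; have E := det_comm2_eig hX hY.
have s1 := eig_sub_neq0 hX; have s2 := eig_sub_neq0 hY.
have d1 : 0 < dt e f ^+ 2 by case: hX => _ _ _; rewrite exprn_even_gt0.
have d2 : 0 < dt e' f' ^+ 2 by case: hY => _ _ _; rewrite exprn_even_gt0.
have d0 := mulr_gt0 d1 d2; have s0 := mulr_gt0 s1 s2.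
rewrite /cross -(pmulr_lgt0 _ d0) E mulNr oppr_gt0.
by rewrite pmulr_rlt0.
Qed.

Lemma comm_eig X Y m e f : \det X = 1 -> \det Y = 1 ->
  X *m Y = Y *m X -> eig X m e f -> dt e (act Y e) = 0 /\ dt f (act Y f) = 0.
Proof.
move=> dX dY XY hX; have m0 := eig_neq0 hX.
case: hX => m1 he hf _; split.
  have h : act X (act Y e) = scv m (act Y e) by rewrite -actM XY actM he act_scv.
  have := dt_act X e (act Y e); rewrite dX mul1r h he dt_scl dt_scr.
  by move: m1; nra.
have h : act X (act Y f) = scv m^-1 (act Y f) by rewrite -actM XY actM hf act_scv.
have := dt_act X f (act Y f); rewrite dX mul1r h hf dt_scl dt_scr => h2.
have : m ^+ 2 * (m^-1 * (m^-1 * dt f (act Y f))) = m ^+ 2 * dt f (act Y f) by rewrite h2.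
have -> : m ^+ 2 * (m^-1 * (m^-1 * dt f (act Y f))) = dt f (act Y f) by field.
by move: m1; nra.
Qed.

Lemma eig_line Y m e f p : eig Y m e f -> dt p (act Y p) = 0 -> dt p e = 0 \/ dt p f = 0.
Proof.
move=> hY h; have := eig_sub_neq0 hY => /lt0r_neq0; rewrite expf_eq0 /= => mm.
have [/= h1 h2 h3] := eig_entries hY.
have : (m - m^-1) * (dt p e * dt p f) = 0.
  transitivity (dt e f * dt p (act Y p)); last by rewrite h mulr0.
  transitivity ((dt e f * Y 1 0) * p.1 ^+ 2 - (dt e f * (Y 0 0 - Y 1 1)) * (p.1 * p.2)
     - (dt e f * Y 0 1) * p.2 ^+ 2); last by rewrite /dt /act /=; ring.
  by rewrite h1 h2 h3 /dt; ring.
move/eqP; rewrite !mulf_eq0 (negPf mm) /= => /orP[] /eqP ->; by [left | right].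
Qed.

End Eigenlines.

(** * Arcs in ping-pong position *)

Section Schottky.
Variable R : realType.
Implicit Types (p q r v k l : R * R) (x : letter).

(** The counterclockwise order a, b, a^-1, b^-1 of the edges at a vertex of
  the Cayley tree drawn in the plane. *)
Definition nxt x : letter := if x.1 then (false, x.2) else (true, ~~ x.2).

(** The end points k and l of an arc of the projective line are vectors up to
  a factor, so the condition is homogeneous of even degree. *)
Definition inarc k l v : Prop := v != 0 /\ 0 <= dt k v * dt v l.

(** Four arcs at infinity, indexed by the letters: [s_pp] maps the complement
  of the arc of an inverse letter onto the arc of the letter, and [s_cyc]
  places the arcs disjointly, in the cyclic order of the letters, [seps] being
  the orientation of the plane. *)
Record schottky (g : letter -> 'M[R]_2) := Schottky {
  sk : letter -> R * R;
  sl : letter -> R * R;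
  sc : letter -> R;
  s_pos : forall x, 0 < sc x;
  s_kl : forall x, dt (sk x) (sl x) != 0;
  s_pp : forall x v, dt (sk x) (act (g x) v) * dt (act (g x) v) (sl x) =
                     - sc x * (dt (sk (linv x)) v * dt v (sl (linv x)));
  seps : R;
  s_cyc : forall x p q r, inarc (sk x) (sl x) p ->
     inarc (sk (nxt x)) (sl (nxt x)) q ->
     inarc (sk (nxt (nxt x))) (sl (nxt (nxt x))) r ->
     0 < seps * (dt p q * dt q r * dt p r) }.

Definition addv p q : R * R := (p.1 + q.1, p.2 + q.2).

Lemma cone_decomp k l v : 0 < dt k l -> inarc k l v ->
  exists z s t, [/\ z ^+ 2 = 1, 0 <= s, 0 <= t, 0 < s + t &
     v = scv z (addv (scv s k) (scv t l))].
Proof.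
move=> kl [v0 h].
have E : v = addv (scv (dt v l / dt k l) k) (scv (dt k v / dt k l) l).
  case: k l v kl h {v0} => [k1 k2] [l1 l2] [v1 v2]; rewrite /dt /scv /addv /= => kl _.
  by congr pair; field; apply: lt0r_neq0.
have [s0|s0] := ltP 0 (dt v l + dt k v).
  exists 1, (dt v l / dt k l), (dt k v / dt k l); split; rewrite ?expr1n ?scv1 //.
  - by apply: divr_ge0; [nra | exact: ltW].
  - by apply: divr_ge0; [nra | exact: ltW].
  - by rewrite -mulrDl divr_gt0.
exists (-1), (- dt v l / dt k l), (- dt k v / dt k l); split.
- by rewrite sqrrN expr1n.
- by apply: divr_ge0; [nra | exact: ltW].
- by apply: divr_ge0; [nra | exact: ltW].
- rewrite -mulrDl divr_gt0 //.
  rewrite ltNge; apply/negP => h1.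
  have h2 : dt v l = 0 by nra.
  have h3 : dt k v = 0 by nra.
  by move: v0; rewrite E h2 h3 !mul0r /scv /addv /= !mul0r !addr0 eqxx.
by rewrite {1}E /scv /addv /=; congr pair; ring.
Qed.

Definition pos4 k l k' l' :=
  [/\ 0 < dt k k', 0 < dt k l', 0 < dt l k' & 0 < dt l l'].

Lemma cone_pos k l k' l' (s t s' t' : R) : pos4 k l k' l' ->
  0 <= s -> 0 <= t -> 0 < s + t -> 0 <= s' -> 0 <= t' -> 0 < s' + t' ->
  0 < dt (addv (scv s k) (scv t l)) (addv (scv s' k') (scv t' l')).
Proof.
move=> [h1 h2 h3 h4] s0 t0 st s0' t0' st'.
have -> : dt (addv (scv s k) (scv t l)) (addv (scv s' k') (scv t' l')) =
  s * s' * dt k k' + s * t' * dt k l' + t * s' * dt l k' + t * t' * dt l l'.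
  by rewrite /dt /scv /addv /=; ring.
have P (a b c : R) : 0 <= a -> 0 <= b -> 0 < c -> 0 <= a * b * c.
  by move=> *; rewrite !mulr_ge0 // ltW.
have Q (a b c : R) : 0 < a -> 0 < b -> 0 < c -> 0 < a * b * c by move=> *; rewrite !mulr_gt0.
have H1 := P _ _ _ s0 s0' h1; have H2 := P _ _ _ s0 t0' h2.
have H3 := P _ _ _ t0 s0' h3; have H4 := P _ _ _ t0 t0' h4.
have [s1|s1] := eqVneq s 0; have [s2|s2] := eqVneq s' 0.
- have := Q _ _ _ _ _ h4; move/(_ t t'); lra.
- have := Q _ _ _ _ _ h3; move/(_ t s').
  have : 0 < s' by rewrite lt0r s2.
  by lra.
- have := Q _ _ _ _ _ h2; move/(_ s t').
  have : 0 < s by rewrite lt0r s1.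
  by lra.
have := Q _ _ _ _ _ h1; move/(_ s s').
have : 0 < s by rewrite lt0r s1.
have : 0 < s' by rewrite lt0r s2.
by lra.
Qed.

Lemma cone_cyc k1 l1 k2 l2 k3 l3 p q r :
  0 < dt k1 l1 -> 0 < dt k2 l2 -> 0 < dt k3 l3 ->
  pos4 k1 l1 k2 l2 -> pos4 k2 l2 k3 l3 -> pos4 k1 l1 k3 l3 ->
  inarc k1 l1 p -> inarc k2 l2 q -> inarc k3 l3 r ->
  0 < dt p q * dt q r * dt p r.
Proof.
move=> h1 h2 h3 h12 h23 h13 hp hq hr.
have [z1 [s1 [t1 [e1 s10 t10 st1 ->]]]] := cone_decomp h1 hp.
have [z2 [s2 [t2 [e2 s20 t20 st2 ->]]]] := cone_decomp h2 hq.
have [z3 [s3 [t3 [e3 s30 t30 st3 ->]]]] := cone_decomp h3 hr.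
have H12 := cone_pos h12 s10 t10 st1 s20 t20 st2.
have H23 := cone_pos h23 s20 t20 st2 s30 t30 st3.
have H13 := cone_pos h13 s10 t10 st1 s30 t30 st3.
rewrite !dt_scl !dt_scr.
set x := dt _ _ in H12 *; set y := dt _ _ in H23 *; set z := dt _ _ in H13 *.
have -> : z1 * (z2 * x) * (z2 * (z3 * y)) * (z1 * (z3 * z)) =
  z1 ^+ 2 * z2 ^+ 2 * z3 ^+ 2 * (x * y * z) by ring.
by rewrite e1 e2 e3 !mul1r !mulr_gt0.
Qed.

(** The determinant of two vectors of the upper half-plane is positive when
  their angles increase. *)
Definition ltv p q := [&& 0 < p.2, 0 < q.2 & 0 < dt p q].

Lemma ltv_trans : transitive ltv.
Proof.
move=> q p r /and3P[p2 q2 pq] /and3P[_ r2 qr]; apply/and3P; split=> //.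
have : 0 < q.2 * dt p r.
  have -> : q.2 * dt p r = p.2 * dt q r + r.2 * dt p q by rewrite /dt; ring.
  by rewrite addr_gt0 // mulr_gt0.
by rewrite pmulr_rgt0.
Qed.

Definition lmx (A B : 'M[R]_2) (x : letter) :=
  if x.1 then (if x.2 then adj2 A else A) else (if x.2 then adj2 B else B).

Lemma schottky_of_vectors (A B : 'M[R]_2) (s : R) a1 b1 b2 a2 a3 b3 b4 a4 :
  \det A = 1 -> \det B = 1 -> 0 < s ->
  sorted ltv [:: a1; b1; b2; a2; a3; b3; b4; a4] ->
  act A a2 = scv (-1) a1 -> act A a3 = scv (-1) a4 ->
  act B b4 = scv (-1) b1 -> act B b3 = scv s^-1 b2 ->
  schottky (lmx A B).
Proof.
move=> dA dB s0 srt A2 A3 B4 B3.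
have H i j : (i < j < 8)%N -> 0 < dt (nth 0 [:: a1; b1; b2; a2; a3; b3; b4; a4] i)
    (nth 0 [:: a1; b1; b2; a2; a3; b3; b4; a4] j).
  move=> /andP[ij j8].
  have := sorted_ltn_nth ltv_trans 0 srt; move/(_ i j); rewrite !inE.
  by move=> /(_ (ltn_trans ij j8) j8 ij) /and3P[].
have dtA u v : dt (act A u) (act A v) = dt u v by rewrite dt_act dA mul1r.
have dtB u v : dt (act B u) (act B v) = dt u v by rewrite dt_act dB mul1r.
have AV v : act A (act (adj2 A) v) = v by rewrite -actM mul_adj2 // act1.
have BV v : act B (act (adj2 B) v) = v by rewrite -actM mul_adj2 // act1.
have A1 : a1 = scv (-1) (act A a2) by rewrite A2 scvA mulrNN mulr1 scv1.
have A4 : a4 = scv (-1) (act A a3) by rewrite A3 scvA mulrNN mulr1 scv1.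
have B1 : b1 = scv (-1) (act B b4) by rewrite B4 scvA mulrNN mulr1 scv1.
have B2 : b2 = scv s (act B b3) by rewrite B3 scvA divff ?scv1 // lt0r_neq0.
pose k (x : letter) := if x.1 then (if x.2 then a2 else a4) else (if x.2 then b3 else b1).
pose l (x : letter) := if x.1 then (if x.2 then a3 else scv (-1) a1) else (if x.2 then b4 else b2).
pose c (x : letter) := if x.1 then 1 else if x.2 then s^-1 else s.
have c0 x : 0 < c x by rewrite /c; case: x => [[] []] /=; rewrite ?ltr01 ?invr_gt0.
have Hb : 0 < dt b1 b2 by exact: (H 1%N 2%N).
have Hb' : 0 < dt b3 b4 by exact: (H 5%N 6%N).
have Ha' : 0 < dt a2 a3 by exact: (H 3%N 4%N).
have Ha : 0 < dt a4 (scv (-1) a1) by rewrite dt_scr (dtC a1) mulrNN mul1r; exact: (H 0%N 7%N).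
have kl0 x : dt (k x) (l x) != 0.
  by apply: lt0r_neq0; case: x => [[] []].
refine (@Schottky _ k l c c0 kl0 _ 1 _).
  case=> [[] []] v; rewrite /k /l /c /lmx /=.
  - by rewrite -dtA AV -[dt _ a3]dtA AV A2 A3 !dt_scl !dt_scr (dtC v a1) (dtC a4 v); ring.
  - by rewrite {1}A4 {1}A1 !dt_scl !dt_scr !dtA (dtC v a2) (dtC v a3); ring.
  - by rewrite -dtB BV -[dt _ b4]dtB BV B3 B4 !dt_scl !dt_scr (dtC v b2) (dtC b1 v); ring.
  - by rewrite {1}B1 {1}B2 !dt_scl !dt_scr !dtB (dtC v b4) (dtC v b3); ring.
have p1 : pos4 b1 b2 a2 a3.
  by split; [exact: (H 1%N 3%N)|exact: (H 1%N 4%N)|exact: (H 2%N 3%N)|exact: (H 2%N 4%N)].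
have p2 : pos4 a2 a3 b3 b4.
  by split; [exact: (H 3%N 5%N)|exact: (H 3%N 6%N)|exact: (H 4%N 5%N)|exact: (H 4%N 6%N)].
have p3 : pos4 b1 b2 b3 b4.
  by split; [exact: (H 1%N 5%N)|exact: (H 1%N 6%N)|exact: (H 2%N 5%N)|exact: (H 2%N 6%N)].
have p4 i j : (0 < i < j)%N && (j < 7)%N ->
  let n := nth 0 [:: a1; b1; b2; a2; a3; b3; b4; a4] in
  pos4 (n i) (n j) a4 (scv (-1) a1).
  move=> /andP[/andP[i0 ij] j7] /=; rewrite /pos4 !dt_scr.
  have i7 := ltn_trans ij j7.
  rewrite (dtC a1 (nth 0 _ i)) (dtC a1 (nth 0 _ j)) !mulN1r !opprK; split.
  - by apply: (H i 7%N); rewrite i7.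
  - by apply: (H 0%N i); rewrite i0 (ltn_trans i7).
  - by apply: (H j 7%N); rewrite j7.
  - by apply: (H 0%N j); rewrite (ltn_trans i0 ij) (ltn_trans j7).
have p5 : pos4 b1 b2 a4 (scv (-1) a1) by exact: (p4 1%N 2%N).
have p6 : pos4 a2 a3 a4 (scv (-1) a1) by exact: (p4 3%N 4%N).
have p7 : pos4 b3 b4 a4 (scv (-1) a1) by exact: (p4 5%N 6%N).
case=> [[] []] p q r; rewrite /k /l /= => hp hq hr; rewrite mul1r.
- exact: (cone_cyc _ _ _ _ _ _ hp hq hr).
- have := cone_cyc Hb Ha' Ha p1 p6 p5 hq hr hp.
  by rewrite (dtC p q) (dtC p r); congr (_ < _); ring.
- have := cone_cyc Hb Hb' Ha p3 p7 p5 hr hp hq.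
  by rewrite (dtC q r) (dtC p r); congr (_ < _); ring.
- exact: (cone_cyc _ _ _ _ _ _ hp hq hr).
Qed.

End Schottky.

(** * Normal form of a crossing pair *)

Section NormalForm.
Variable R : realType.
Implicit Types (A B : 'M[R]_2).

(** The parameters of a crossing pair in the eigenbasis of its commutator,
  which becomes diag (- s^2, - s^-2). *)
Record nform (s d a0 b0 b1 c c1 : R) : Prop := NForm {
  nf_s : 1 < s; nf_d : 0 < d; nf_a0 : 0 < a0; nf_b0 : 0 < b0; nf_b1 : 0 < b1;
  nf_c : 0 < c; nf_c1 : 0 < c1;
  nf_A : b0 * c = 1 + s ^+ 2 * d ^+ 2;
  nf_B : b1 * c1 = 1 + s ^+ 2 * a0 ^+ 2;
  nf_rel : b0 * c1 + s ^+ 2 * (b1 * c) = s ^+ 2 * (1 + s ^+ 2) * (d * a0) }.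

Definition nfA (s d b0 c : R) := mx2 (- (s ^+ 2 * d)) (- b0) c d.
Definition nfB (s a0 b1 c1 : R) := mx2 (- a0) (- b1) c1 (s ^+ 2 * a0).

Lemma nform_Y s d a0 b0 b1 c c1 : nform s d a0 b0 b1 c c1 ->
  d * a0 < b1 * c /\ b1 * c < s ^+ 2 * (d * a0).
Proof.
case=> s1 hd ha hb0 hb1 hc hc1 eA eB rel.
set m := s ^+ 2 in eA eB rel *.
have m1 : 1 < m by rewrite /m expr_gt1 // ltW // (lt_trans ltr01).
have da : 0 < d * a0 by rewrite mulr_gt0.
have e1 : (b0 * c1) * (b1 * c) = (1 + m * d ^+ 2) * (1 + m * a0 ^+ 2).
  by rewrite -eA -eB; ring.
have e2 : m * ((b1 * c - d * a0) * (m * (d * a0) - b1 * c)) =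
   1 + m * d ^+ 2 + m * a0 ^+ 2.
  have -> : m * ((b1 * c - d * a0) * (m * (d * a0) - b1 * c)) =
   (m * (1 + m) * (d * a0) - m * (b1 * c)) * (b1 * c) - m ^+ 2 * (d * a0) ^+ 2 by ring.
  by rewrite -rel addrK e1; ring.
have h : 0 < (b1 * c - d * a0) * (m * (d * a0) - b1 * c).
  rewrite -(pmulr_rgt0 _ (lt_trans ltr01 m1)) e2.
  by rewrite !addr_gt0 ?mulr_gt0 ?exprn_gt0 // (lt_trans ltr01).
set Y := b1 * c in h *; set D := d * a0 in da h *.
have mD : D < m * D by rewrite ltr_pMl.
have h1 : D < Y.
  rewrite ltNge; apply/negP => h1.
  have h2 : 0 < m * D - Y by lra.
  by move: h; rewrite pmulr_lgt0 // subr_gt0; lra.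
by split=> //; move: h; rewrite pmulr_rgt0 ?subr_gt0 // => h; lra.
Qed.

Lemma nform_det s d a0 b0 b1 c c1 : nform s d a0 b0 b1 c c1 ->
  \det (nfA s d b0 c) = 1 /\ \det (nfB s a0 b1 c1) = 1.
Proof.
by case=> *; rewrite /nfA /nfB !det2E !en2; split; lra.
Qed.

(** The arcs end at points of the interval between the fixed points of the
  commutator and of its images under A^-1, A^-1 B^-1 and B^-1: these four gaps
  of the limit set separate the four arcs. *)
Lemma nform_schottky s d a0 b0 b1 c c1 : nform s d a0 b0 b1 c c1 ->
  schottky (lmx (nfA s d b0 c) (nfB s a0 b1 c1)).
Proof.
move=> nf; have [Y1 Y2] := nform_Y nf; have [dA dB] := nform_det nf.
case: (nf) => s1 hd ha hb0 hb1 hc hc1 eA eB rel.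
set A := nfA _ _ _ _ in dA *; set B := nfB _ _ _ _ in dB *.
have s0 : 0 < s by exact: lt_trans s1.
set m := s ^+ 2 in eA eB rel Y1 Y2 *.
have m0 : 0 < m by rewrite exprn_gt0.
have s3 : 0 < s ^+ 3 by rewrite exprn_gt0.
have dc : c * a0 < d * c1.
  rewrite -(ltr_pM2r hb1).
  have -> : d * c1 * b1 = d * (b1 * c1) by ring.
  rewrite eB; have : a0 * (b1 * c) < a0 * (m * (d * a0)) by rewrite ltr_pM2l.
  by lra.
pose iA := act (adj2 A); pose iB := act (adj2 B).
pose a1 := (s ^+ 2, 1 : R); pose b1' := (s, 1 : R).
pose b2 := scv (-1) (iA (s ^+ 3, 1)); pose a2 := scv (-1) (iA a1).
pose a3 := iA (iB (1, 1)); pose b3 := iA (iB (1, s)).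
pose b4 := scv (-1) (iB b1'); pose a4 := scv (-1) (iB (1, 1)).
have AV v : act A (iA v) = v by rewrite /iA -actM mul_adj2 // act1.
have BV v : act B (iB v) = v by rewrite /iB -actM mul_adj2 // act1.
have dtA u v : dt (iA u) (iA v) = dt u v by rewrite /iA dt_act det_adj2 dA mul1r.
have dtB u v : dt (iB u) (iB v) = dt u v by rewrite /iB dt_act det_adj2 dB mul1r.
have Bb3 : act B b3 = scv s^-1 b2.
  have -> : act B b3 = iA (act A (act B b3)).
    by rewrite /iA -[RHS]actM adj2_mul // act1.
  rewrite /b2 scvA /iA -act_scv; congr (act _ _).
  have mi : m * m^-1 = 1 by rewrite divff // lt0r_neq0.
  have AB : A *m B = mx2 (- m) 0 0 (- m^-1) *m (B *m A).
    apply: mx2P; rewrite /A /B /nfA /nfB !en2 -/m.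
    - by lra.
    - by ring.
    - have -> : 0 * (- a0 * - (m * d) + - b1 * c) + - m^-1 * (c1 * - (m * d) + m * a0 * c) =
        (m * m^-1) * (c1 * d - a0 * c) by ring.
      by rewrite mi; ring.
    - have -> : 0 * (- a0 * - b0 + - b1 * d) + - m^-1 * (c1 * - b0 + m * a0 * d) =
        m^-1 * (b0 * c1) - (m * m^-1) * (a0 * d) by ring.
      have -> : b0 * c1 = m * ((1 + m) * (d * a0) - b1 * c) by lra.
      by rewrite [m^-1 * (m * _)]mulrA (mulrC m^-1) mi; ring.
  rewrite /b3 /iA /iB -!actM AB -(mulmxA _ (B *m A)) -(mulmxA B A) mul_adj2 // mulmx1.
  rewrite -mulmxA mul_adj2 // mulmx1 /act /scv /= !en2; congr pair.
    by rewrite /m; field; apply: lt0r_neq0.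
  by rewrite /m; field; apply: lt0r_neq0.
have Bb4 : act B b4 = scv (-1) b1' by rewrite /b4 act_scv BV.
have Aa2 : act A a2 = scv (-1) a1 by rewrite /a2 act_scv AV.
have Aa3 : act A a3 = scv (-1) a4.
  by rewrite /a3 AV /a4 scvA mulrNN mulr1 scv1.
apply: (schottky_of_vectors dA dB s0 _ Aa2 Aa3 Bb4 Bb3).
have P4 (x y : R) : 0 < x -> 0 < y -> 0 < x * y by exact: mulr_gt0.
have b2y : 0 < b2.2.
  rewrite /b2 /iA /act /scv /adj2 /A /nfA /= !en2 -/m.
  have := P4 _ _ s3 hc; have := P4 _ _ m0 hd; lra.
have a2y : 0 < a2.2.
  rewrite /a2 /iA /act /scv /adj2 /A /nfA /= !en2 -/m.
  have := P4 _ _ m0 hc; have := P4 _ _ m0 hd; lra.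
have a3y : 0 < a3.2.
  rewrite /a3 /iA /iB /act /scv /adj2 /A /B /nfA /nfB /= !en2 -/m.
  have : 0 < m * (d * c1 - c * a0) by rewrite P4 // subr_gt0.
  lra.
have b3y : 0 < b3.2.
  rewrite /b3 /iA /iB /act /scv /adj2 /A /B /nfA /nfB /= !en2 -/m.
  have : 0 < m * (d * c1 - c * a0) by rewrite P4 // subr_gt0.
  have : 0 < s * (m * (d * a0) - b1 * c) by rewrite P4 // subr_gt0.
  lra.
have b4y : 0 < b4.2.
  rewrite /b4 /iB /act /scv /adj2 /B /nfB /= !en2 -/m.
  have := P4 _ _ s0 hc1; lra.
have a4y : 0 < a4.2.
  rewrite /a4 /iB /act /scv /adj2 /B /nfB /= !en2 -/m.
  lra.
have db12 : 0 < dt b1' b2.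
  rewrite /b2 /b1' /dt /iA /act /scv /adj2 /A /nfA /= !en2 -/m.
  have := P4 _ _ s0 (P4 _ _ s3 hc); have := P4 _ _ s0 (P4 _ _ m0 hd).
  have := P4 _ _ s3 hd; lra.
rewrite /sorted /= /ltv b2y a2y a3y b3y b4y a4y /b1' /a1 /= !ltr01 /= andbT.
apply/and5P; split=> //.
- rewrite /dt /= mulr1 mul1r; have := P4 _ _ s0 (_ : 0 < s - 1); rewrite subr_gt0 s1 => /(_ isT).
  by rewrite mulrBr mulr1 -expr2 subr_gt0.
- rewrite /b2 /a2 dt_scl dt_scr dtA /dt /a1 /=.
  have : 0 < s ^+ 2 * (s - 1) by rewrite P4 // subr_gt0.
  by rewrite -/m => h; rewrite exprS -/m; lra.
- rewrite /a2 /a3 dt_scl dtA /dt /iB /act /adj2 /B /nfB /= !en2 -/m.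
  have := P4 _ _ m0 hc1; have := P4 _ _ m0 ha; lra.
apply/and3P; split; first by rewrite /a3 /b3 dtA dtB /dt /=; lra.
  have : 0 < dt (act B b3) (act B b4).
    by rewrite Bb3 Bb4 dt_scl dt_scr (dtC b1') mulN1r opprK P4 // invr_gt0.
  by rewrite dt_act dB mul1r.
by rewrite /b4 /a4 dt_scl dt_scr dtB /dt /b1' /=; lra.
Qed.

End NormalForm.

Section NormalFormExists.
Variable R : realType.
Implicit Types (A B P : 'M[R]_2).

Lemma eig_tr (X : 'M[R]_2) m e f : eig X m e f -> \tr X = m + m^-1.
Proof.
case: e f => [e1 e2] [f1 f2] [_ [h1 h2] [h3 h4]]; rewrite /dt /= => d0.
apply: (mulIf d0); rewrite tr2E; move: (m^-1) h1 h2 h3 h4 => m' /= h1 h2 h3 h4.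
have -> : (X 0 0 + X 1 1) * (e1 * f2 - e2 * f1) =
  (X 0 0 * e1 + X 0 1 * e2) * f2 - (X 0 0 * f1 + X 0 1 * f2) * e2
  + e1 * (X 1 0 * f1 + X 1 1 * f2) - f1 * (X 1 0 * e1 + X 1 1 * e2) by ring.
by rewrite h1 h2 h3 h4; ring.
Qed.

(** The equation A B = [A, B] B A determines the diagonal entries of A and B
  from each other once the commutator is diagonal. *)
Lemma nform_of_diag (m : R) A B : \det A = 1 -> \det B = 1 -> 1 < m ->
  A *m B = mx2 (- m) 0 0 (- m^-1) *m (B *m A) ->
  exists P sg tau s d a0 b0 b1 c c1,
    [/\ \det P != 0, sg ^+ 2 = 1, tau ^+ 2 = 1, nform s d a0 b0 b1 c c1 &
     A *m P = sg *: (P *m nfA s d b0 c) /\ B *m P = tau *: (P *m nfB s a0 b1 c1)].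
Proof.
move=> dA dB m1 E.
have m0 : 0 < m by lra.
have mm : m * m^-1 = 1 by rewrite divff ?lt0r_neq0.
pose s := Num.sqrt m.
have sm : s ^+ 2 = m by rewrite sqr_sqrtr // ltW.
have s1 : 1 < s by rewrite -sqrtr1 ltr_sqrt.
pose D' := mx2 (- m^-1) 0 0 (- m).
have DD : D' *m mx2 (- m) 0 0 (- m^-1) = 1%:M.
  by apply: mx2P; rewrite !en2 -1?mm; ring.
have tA : \tr (D' *m A) = \tr A.
  have -> : D' *m A = B *m A *m adj2 B.
    by rewrite -[D' *m A]mulmx1 -(mul_adj2 dB) -!mulmxA (mulmxA A) E !mulmxA DD mul1mx.
  by rewrite mxtrace_mulC mulmxA adj2_mul // mul1mx.
have tB : \tr (mx2 (- m) 0 0 (- m^-1) *m B) = \tr B.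
  have -> : mx2 (- m) 0 0 (- m^-1) *m B = A *m B *m adj2 A.
    by rewrite E -!mulmxA mul_adj2 // mulmx1.
  by rewrite mxtrace_mulC mulmxA adj2_mul // mul1mx.
have E00 := congr1 (fun M : 'M[R]_2 => M 0 0) E.
move: dA dB tA tB E00; rewrite !det2E !tr2E !en2.
set a := A 0 0; set b := A 0 1; set c := A 1 0; set d := A 1 1.
set a' := B 0 0; set b' := B 0 1; set c' := B 1 0; set d' := B 1 1.
move=> dA dB tA tB E00.
have aE : a = - (m * d).
  have : m * (- m^-1 * a + 0 * c + (0 * b + - m * d)) = m * (a + d) by rewrite tA.
  have -> : m * (- m^-1 * a + 0 * c + (0 * b + - m * d)) = - (m * m^-1) * a - m ^+ 2 * d by ring.
  rewrite mm => h; have : (1 + m) * (a + m * d) = 0 by lra.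
  by move/eqP; rewrite mulf_eq0 => /orP[] /eqP; lra.
have dE : d' = - (m * a').
  have : m * (- m * a' + 0 * c' + (0 * b' + - m^-1 * d')) = m * (a' + d') by rewrite tB.
  have -> : m * (- m * a' + 0 * c' + (0 * b' + - m^-1 * d')) = - m ^+ 2 * a' - (m * m^-1) * d' by ring.
  rewrite mm => h; have : (1 + m) * (d' + m * a') = 0 by lra.
  by move/eqP; rewrite mulf_eq0 => /orP[] /eqP; lra.
have bc : - (b * c) = 1 + m * d ^+ 2 by rewrite -dA aE; ring.
have bc' : - (b' * c') = 1 + m * a' ^+ 2 by rewrite -dB dE; ring.
have rel : b * c' + m * (b' * c) = m * (1 + m) * (d * a').
  by move: E00; rewrite aE; lra.
have nz (x : R) : 0 < 1 + m * x ^+ 2.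
  by rewrite ltr_pwDl // mulr_ge0 // ?sqr_ge0 // ltW.
have c0 : c != 0 by apply: contraTneq (nz d) => h; rewrite -bc h mulr0 oppr0 ltxx.
have c0' : c' != 0 by apply: contraTneq (nz a') => h; rewrite -bc' h mulr0 oppr0 ltxx.
pose sg := Num.sg c; pose tau := Num.sg c'.
have sg1 : sg ^+ 2 = 1 by rewrite sqr_sg c0.
have tau1 : tau ^+ 2 = 1 by rewrite sqr_sg c0'.
have cp : 0 < sg * c by rewrite -normrEsg normr_gt0.
have cp' : 0 < tau * c' by rewrite -normrEsg normr_gt0.
have bp : 0 < - (sg * b).
  rewrite -(pmulr_lgt0 _ cp) (_ : _ * _ = sg ^+ 2 * - (b * c)); last by ring.
  by rewrite sg1 mul1r bc.
have bp' : 0 < - (tau * b').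
  rewrite -(pmulr_lgt0 _ cp') (_ : _ * _ = tau ^+ 2 * - (b' * c')); last by ring.
  by rewrite tau1 mul1r bc'.
pose d1 := sg * d; pose a1 := tau * a'.
have rel1 : - (sg * b) * (tau * c') + m * (- (tau * b') * (sg * c)) = m * (1 + m) * (d1 * - a1).
  rewrite (_ : _ + _ = - (sg * tau) * (b * c' + m * (b' * c))); last by ring.
  by rewrite rel /d1 /a1; ring.
have da : 0 < d1 * - a1.
  have mm1 : 0 < m * (1 + m) by rewrite mulr_gt0 //; lra.
  by rewrite -(pmulr_rgt0 _ mm1) -rel1 (addr_gt0 (mulr_gt0 bp cp') (mulr_gt0 m0 (mulr_gt0 bp' cp))).
have sgsg : sg * sg = 1 by rewrite -expr2.
have tata : tau * tau = 1 by rewrite -expr2.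
have relA : - (sg * b) * (sg * c) = 1 + s ^+ 2 * d1 ^+ 2.
  rewrite sm [LHS](_ : _ = sg ^+ 2 * - (b * c)); last by ring.
  by rewrite /d1 exprMn sg1 !mul1r.
have relB : - (tau * b') * (tau * c') = 1 + s ^+ 2 * a1 ^+ 2.
  rewrite sm [LHS](_ : _ = tau ^+ 2 * - (b' * c')); last by ring.
  by rewrite /a1 exprMn tau1 !mul1r.
have SG x : sg * (sg * x) = x by rewrite mulrA sgsg mul1r.
have TA x : tau * (tau * x) = x by rewrite mulrA tata mul1r.
have [d0|d0] := ltP 0 d1.
  exists 1%:M, sg, tau, s, d1, (- a1), (- (sg * b)), (- (tau * b')), (sg * c), (tau * c').
  split=> //; first by rewrite det1 oner_eq0.
    split=> //; [by move: da; rewrite pmulr_rgt0 | by rewrite sqrrN | by rewrite sm].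
  split; rewrite mulmx1 mul1mx /nfA /nfB sm; apply: mx2P; rewrite !en2 ?opprK ?SG ?TA //.
    by rewrite /d1 mulrN mulrCA SG -aE.
  by rewrite /a1 mulrN mulrN mulrCA TA -dE.
have d0' : 0 < - d1.
  by rewrite oppr_gt0 lt_neqAle d0 andbT; apply: contraTneq da => ->; rewrite mul0r ltxx.
exists (mx2 1 0 0 (-1)), (- sg), (- tau), s, (- d1), a1, (- (sg * b)), (- (tau * b')), (sg * c), (tau * c').
split=> //; rewrite ?sqrrN //.
- by rewrite det2E !en2 mul0r subr0 mul1r oppr_eq0 oner_eq0.
- split=> //.
  + by move: da; rewrite mulrN -mulNr pmulr_rgt0.
  + by rewrite sqrrN.
  + by rewrite sm rel1; ring.
split; rewrite /nfA /nfB sm; apply: mx2P; rewrite !en2.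
- by rewrite -[LHS]mul1r -sg1 -/a -/b aE /d1; ring.
- by rewrite -[LHS]mul1r -sg1 -/a -/b; ring.
- by rewrite -[LHS]mul1r -sg1 -/c -/d; ring.
- by rewrite -[LHS]mul1r -sg1 -/c -/d /d1; ring.
- by rewrite -[LHS]mul1r -tau1 -/a' -/b' /a1; ring.
- by rewrite -[LHS]mul1r -tau1 -/a' -/b'; ring.
- by rewrite -[LHS]mul1r -tau1 -/c' -/d'; ring.
- by rewrite -[LHS]mul1r -tau1 -/c' -/d' dE /a1; ring.
Qed.

Lemma normal_form A B : \det A = 1 -> \det B = 1 -> 4 < \det (comm2 A B) ->
  exists P sg tau s d a0 b0 b1 c c1,
    [/\ \det P != 0, sg ^+ 2 = 1, tau ^+ 2 = 1, nform s d a0 b0 b1 c c1 &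
     A *m P = sg *: (P *m nfA s d b0 c) /\ B *m P = tau *: (P *m nfB s a0 b1 c1)].
Proof.
move=> dA dB h.
pose C := A *m B *m (adj2 A *m adj2 B).
have dC : \det C = 1 by rewrite /C !det_mulmx !det_adj2 dA dB !mulr1.
have tC : \tr C = 2 - \det (comm2 A B).
  have : \tr (adj2 (adj2 A) *m (adj2 (adj2 B) *m (adj2 A *m adj2 B))) =
     2 - \det (comm2 (adj2 A) (adj2 B)) by rewrite tr_comm // det_adj2.
  have adjK X : adj2 (adj2 X) = X :> 'M[R]_2 by apply: mx2P; rewrite /adj2 !en2 ?opprK.
  rewrite !adjK /C mulmxA => ->; congr (_ - \det _).
  by rewrite /comm2 /adj2; apply: mx2P; rewrite !en2; ring.
have hC : hyp C by rewrite /hyp tC; nra.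
have [m [e [f hm]]] := eig_exists dC hC.
have tm := eig_tr hm; have m0 := eig_neq0 hm.
have [m2 he hf def] := hm.
have m1 : m < -1.
  have : m + m^-1 < -2 by rewrite -tm tC; lra.
  have [mp|mp] := ltP 0 m; first by have := mp; rewrite -invr_gt0; lra.
  by nra.
pose P := mx2 e.1 f.1 e.2 f.2.
have dP : \det P = dt e f by rewrite det2E /P !en2 /dt; ring.
have uP : P \in unitmx by rewrite unitmxE unitfE dP.
have CP : C *m P = P *m mx2 m 0 0 m^-1.
  case: he hf; rewrite /act /= => h1 h2 [h3 h4].
  apply: mx2P; rewrite [LHS]mul2E [RHS]mul2E /P !mx2s ?h1 ?h2 ?h3 ?h4; ring.
pose A1 := invmx P *m A *m P; pose B1 := invmx P *m B *m P.
have PA : P *m A1 = A *m P by rewrite /A1 !mulmxA mulmxV // mul1mx.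
have PB : P *m B1 = B *m P by rewrite /B1 !mulmxA mulmxV // mul1mx.
have dP0 : \det P != 0 by rewrite dP.
have dA1 : \det A1 = 1.
  by apply: (mulfI dP0); rewrite -det_mulmx PA det_mulmx dA mulrC.
have dB1 : \det B1 = 1.
  by apply: (mulfI dP0); rewrite -det_mulmx PB det_mulmx dB mulrC.
have CBA : C *m B *m A = A *m B.
  by rewrite /C -!mulmxA (mulmxA (adj2 B) B) adj2_mul // mul1mx adj2_mul // mulmx1.
have E : A1 *m B1 = mx2 (- - m) 0 0 (- (- m)^-1) *m (B1 *m A1).
  have -> : mx2 (- - m) 0 0 (- (- m)^-1) = mx2 m 0 0 m^-1 by rewrite invrN !opprK.
  have /(can_inj (mulKmx uP)) : P *m (A1 *m B1) = P *m (mx2 m 0 0 m^-1 *m (B1 *m A1)); last by [].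
  transitivity (C *m (B *m (A *m P))); last first.
    by rewrite (mulmxA P) -CP -(mulmxA C) (mulmxA P) PB -(mulmxA B) PA.
  by rewrite (mulmxA P A1) PA -(mulmxA A) PB (mulmxA A) -CBA -!mulmxA.
have mN : 1 < - m by lra.
have [Q [sg [tau [s [d [a0 [b0 [b1 [c [c1 [dQ h1 h2 nf [hA hB]]]]]]]]]]]] := nform_of_diag dA1 dB1 mN E.
exists (P *m Q), sg, tau, s, d, a0, b0, b1, c, c1; split=> //.
  by rewrite det_mulmx mulf_neq0.
split; first by rewrite mulmxA -PA -mulmxA hA -scalemxAr mulmxA.
by rewrite mulmxA -PB -mulmxA hB -scalemxAr mulmxA.
Qed.

Lemma schottky_conj (g g' : letter -> 'M[R]_2) P (sg : letter -> R) : \det P != 0 ->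
  (forall x, sg x ^+ 2 = 1) -> (forall x, g' x *m P = sg x *: (P *m g x)) ->
  schottky g -> schottky g'.
Proof.
move=> dP sg1 E [k l c c0 kl pp eps cyc].
pose iP v := scv (\det P)^-1 (act (adj2 P) v).
have PI v : v = act P (iP v).
  rewrite /iP act_scv -actM.
  have -> : P *m adj2 P = \det P *: 1%:M.
    by apply: mx2P; rewrite det2E /adj2 !en2; ring.
  case: v => v1 v2; rewrite /act /scv /= !en2; congr pair; field; exact: dP.
have ga x v : act (g' x) (act P v) = scv (sg x) (act P (act (g x) v)).
  by rewrite -!actM E /act /scv !en2 /=; congr pair; ring.
pose k' x := act P (k x); pose l' x := act P (l x).
have QE x v : dt (k' x) (act P v) * dt (act P v) (l' x) =
   \det P ^+ 2 * (dt (k x) v * dt v (l x)) by rewrite !dt_act; ring.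
have arcE x v : inarc (k' x) (l' x) (act P v) -> inarc (k x) (l x) v.
  case=> v0; rewrite QE pmulr_rge0 ?exprn_even_gt0 // => h; split=> //.
  apply: contraNneq v0 => ->; rewrite /act /= !mulr0 !addr0; exact/eqP.
have kl' x : dt (k' x) (l' x) != 0 by rewrite dt_act mulf_neq0.
refine (@Schottky _ _ k' l' c c0 kl' _ (eps * \det P) _).
  move=> x v; rewrite (PI v) ga dt_scl dt_scr.
  transitivity (sg x ^+ 2 * (dt (k' x) (act P (act (g x) (iP v))) *
     dt (act P (act (g x) (iP v))) (l' x))); first by ring.
  by rewrite sg1 mul1r !QE pp; ring.
move=> x p q r; rewrite (PI p) (PI q) (PI r) => /arcE hp /arcE hq /arcE hr.
have := cyc x _ _ _ hp hq hr; rewrite !dt_act => h.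
have -> : eps * \det P * (\det P * dt (iP p) (iP q) * (\det P * dt (iP q) (iP r)) *
   (\det P * dt (iP p) (iP r))) =
   \det P ^+ 4 * (eps * (dt (iP p) (iP q) * dt (iP q) (iP r) * dt (iP p) (iP r))) by ring.
by rewrite mulr_gt0 // exprn_even_gt0.
Qed.

Lemma conj_adj A P A0 (sg : R) : \det A = 1 -> \det A0 = 1 -> sg ^+ 2 = 1 ->
  A *m P = sg *: (P *m A0) -> adj2 A *m P = sg *: (P *m adj2 A0).
Proof.
move=> dA dA0 s1 E.
have E' : P *m A0 = sg *: (A *m P) by rewrite E scalerA -expr2 s1 scale1r.
rewrite -[P in LHS]mulmx1 -(mul_adj2 dA0) (mulmxA P) E' -scalemxAl -scalemxAr.
by rewrite !mulmxA adj2_mul // mul1mx.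
Qed.

Lemma schottky_exists A B : \det A = 1 -> \det B = 1 -> 4 < \det (comm2 A B) ->
  inhabited (schottky (lmx A B)).
Proof.
move=> dA dB h; have [P [sg [tau [s [d [a0 [b0 [b1 [c [c1 [dP s1 t1 nf [hA hB]]]]]]]]]]]] := normal_form dA dB h.
have [dA0 dB0] := nform_det nf.
constructor; apply: (@schottky_conj _ _ P (fun x => if x.1 then sg else tau) dP _ _ (nform_schottky nf)).
  by case=> [[] []].
by case=> [[] []] //=; rewrite /lmx /=; apply: conj_adj.
Qed.

(** The images under A^-1 and B^-1 of a fixed point of the commutator span a
  cone that both generators, up to sign, map into its interior. *)
Lemma positive_basis A B : \det A = 1 -> \det B = 1 -> 4 < \det (comm2 A B) ->
  exists G sg tau A' B',
   [/\ \det G != 0, sg ^+ 2 = 1, tau ^+ 2 = 1,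
     (forall i j, 0 < A' i j /\ 0 < B' i j) &
     A *m G = sg *: (G *m A') /\ B *m G = tau *: (G *m B')].
Proof.
move=> dA dB h; have [P [sg [tau [s [d [a0 [b0 [b1 [c [c1 [dP sg1 t1 nf [hA hB]]]]]]]]]]]] := normal_form dA dB h.
have [Y1 Y2] := nform_Y nf.
case: (nf) => s1 hd ha hb0 hb1 hc hc1 eA eB rel.
have s0 : 0 < s by exact: lt_trans s1.
set m := s ^+ 2 in eA eB rel Y1 Y2.
have m0 : 0 < m by rewrite exprn_gt0.
have sm : s ^+ 2 = m by [].
clearbody m.
have P4 (x y : R) : 0 < x -> 0 < y -> 0 < x * y by exact: mulr_gt0.
pose D := m * a0 * c - d * c1.
have D0 : 0 < D.
  rewrite /D subr_gt0 -(ltr_pM2r hb0).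
  have -> : m * a0 * c * b0 = m * a0 * (b0 * c) by ring.
  have -> : d * c1 * b0 = d * (m * (1 + m) * (d * a0) - m * (b1 * c)) by rewrite -rel; ring.
  have : d * m * (d * a0) < d * m * (b1 * c) by rewrite ltr_pM2l // P4.
  rewrite eA; have := P4 _ _ m0 ha; lra.
pose G0 := mx2 (- (m * a0)) d c1 (- c).
pose A' := mx2 ((D ^+ 2 + m * c ^+ 2) / (D * c1)) (c / D) (m * c / D) (c1 / D).
pose B' := mx2 (c / D) (c1 / (m * D)) (c1 / D) ((D ^+ 2 + c1 ^+ 2 / m) / (c * D)).
have Dd : m * a0 * c - d * c1 = D by [].
have Dn := lt0r_neq0 D0; have cn := lt0r_neq0 hc; have c1n := lt0r_neq0 hc1.
have mn := lt0r_neq0 m0.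
exists (P *m G0), (- sg), tau, A', B'; split=> //.
- by rewrite det_mulmx mulf_neq0 // det2E /G0 !en2 mulrNN; apply: lt0r_neq0; rewrite -/D.
- by rewrite sqrrN.
- move=> i j; case: (ord2P i) => ->; case: (ord2P j) => ->; rewrite /A' /B' !en2;
  do ?[by [] | split | apply: divr_gt0 | apply: mulr_gt0 | apply: exprn_gt0 | apply: addr_gt0].
split.
  rewrite mulmxA hA -scalemxAl -!mulmxA scaleNr -scalerN; congr (_ *: _).
  rewrite -mulmxN; congr (_ *m _); apply: mx2P; rewrite /nfA /G0 /A' !en2 ?sm.
  + have E : b0 * c1 = m * (1 + m) * (d * a0) - m * (b1 * c) by lra.
    have -> : - (m * d) * - (m * a0) + - b0 * c1 = m * (b1 * c) - m * (d * a0).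
      by transitivity (m * m * (d * a0) - b0 * c1); [ring | rewrite E; ring].
    have -> : - (- (m * a0) * ((D ^+ 2 + m * c ^+ 2) / (D * c1)) + d * (m * c / D)) =
      (m * a0 * D ^+ 2 + m * c * (m * a0 * c - d * c1)) / (D * c1).
      by clear A' B'; clearbody D; field; rewrite ?Dn ?cn ?c1n ?mn.
    rewrite Dd; apply: (mulIf (mulf_neq0 Dn c1n)); rewrite divfK ?mulf_neq0 //.
    have -> : (m * (b1 * c) - m * (d * a0)) * (D * c1) =
      D * (m * c * (b1 * c1) - m * a0 * (d * c1)) by ring.
    rewrite eB; have -> : d * c1 = m * a0 * c - D by rewrite -Dd; ring.
    by ring.
  + have -> : - (- (m * a0) * (c / D) + d * (c1 / D)) = (m * a0 * c - d * c1) / D.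
      by clear A' B'; clearbody D; field; rewrite ?Dn ?cn ?c1n ?mn.
    rewrite Dd divff // mulrNN eA; ring.
  + have -> : c * - (m * a0) + d * c1 = - D by rewrite -Dd; ring.
    by clear A' B'; clearbody D; field; rewrite ?Dn ?cn ?c1n ?mn.
  + by clear A' B'; clearbody D; field; rewrite ?Dn ?cn ?c1n ?mn.
rewrite mulmxA hB -scalemxAl -!mulmxA; congr (_ *: (_ *m _)).
apply: mx2P; rewrite /nfB /G0 /B' !en2 ?sm.
+ have -> : - (m * a0) * (c / D) + d * (c1 / D) = - ((m * a0 * c - d * c1) / D).
    by clear A' B'; clearbody D; field; rewrite ?Dn ?cn ?c1n ?mn.
  by rewrite Dd divff //; transitivity (m * a0 ^+ 2 - b1 * c1); [ring | rewrite eB; ring].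
+ have E : b0 * c1 = m * (1 + m) * (d * a0) - m * (b1 * c) by lra.
  have -> : - (m * a0) * (c1 / (m * D)) + d * ((D ^+ 2 + c1 ^+ 2 / m) / (c * D)) =
     (d * m * D ^+ 2 - c1 * (m * a0 * c - d * c1)) / (m * c * D).
    by clear A' B'; clearbody D; field; rewrite ?Dn ?cn ?c1n ?mn.
  rewrite Dd; apply: (mulIf (mulf_neq0 (mulf_neq0 mn cn) Dn)); rewrite divfK ?mulf_neq0 //.
  have -> : (- a0 * d + - b1 * - c) * (m * c * D) = D * (c * (m * (b1 * c) - m * (d * a0))) by ring.
  have -> : m * (b1 * c) = m * (1 + m) * (d * a0) - b0 * c1 by rewrite E; ring.
  have -> : D * (c * (m * (1 + m) * (d * a0) - b0 * c1 - m * (d * a0))) =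
     D * (d * m * (m * a0 * c) - c1 * (b0 * c)) by ring.
  have -> : m * a0 * c = D + d * c1 by rewrite -Dd; ring.
  by rewrite eA; ring.
+ by clear A' B'; clearbody D; field; rewrite ?Dn ?cn ?c1n ?mn.
+ have -> : c1 * d + m * a0 * - c = - D by rewrite -Dd; ring.
  by clear A' B'; clearbody D; field; rewrite ?Dn ?cn ?c1n ?mn.
Qed.

End NormalFormExists.

(** * Words and powers in the free group *)

Section Words.

Definition gl (x : letter) : F2 := @MkF2 [:: x] isT.

Definition pw (s : seq letter) : F2 := foldr (fun x g => gl x * g)%g 1%g s.

Lemma pw_cons x s : pw (x :: s) = (gl x * pw s)%g. Proof. by []. Qed.

Lemma pw_cat s t : pw (s ++ t) = (pw s * pw t)%g.
Proof. by elim: s => [|x s IH]; rewrite ?mul1g //= IH mulgA. Qed.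

Lemma pw1 x : pw [:: x] = gl x. Proof. by rewrite /= mulg1. Qed.

Lemma pw_rcons s x : pw (rcons s x) = (pw s * gl x)%g.
Proof. by rewrite -cats1 pw_cat pw1. Qed.

Lemma word_mul u v : word (u * v)%g = mulw (word u) (word v). Proof. by []. Qed.

Lemma word_pw s : reduced s -> word (pw s) = s.
Proof.
elim: s => [//|x s IH] rs.
rewrite pw_cons word_mul IH; last exact: path_sorted rs.
by case: s rs {IH} => [//|y s] /= /andP[/negPf ->].
Qed.

Lemma pwK u : pw (word u) = u.
Proof. by apply/val_inj; rewrite /= word_pw //; case: u. Qed.

Lemma gl_linv x : gl (linv x) = (gl x)^-1%g.
Proof. by apply/val_inj. Qed.

Lemma size_push x s : (size (push x s) <= (size s).+1)%N.
Proof. by case: s => [//|y s] /=; case: ifP => //= _; rewrite ltnW. Qed.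

Lemma size_pw s : (size (word (pw s)) <= size s)%N.
Proof.
elim: s => [//|x s IH]; rewrite pw_cons word_mul /=.
exact: leq_trans (size_push _ _) _.
Qed.

Lemma size_wordM u v : (size (word (u * v)%g) <= size (word u) + size (word v))%N.
Proof. by rewrite -{1}(pwK u) -{1}(pwK v) -pw_cat -size_cat size_pw. Qed.

Lemma invw_rcons s x : invw (rcons s x) = linv x :: invw s.
Proof. by rewrite /invw map_rcons rev_rcons. Qed.

Lemma invw_cons s x : invw (x :: s) = rcons (invw s) (linv x).
Proof. by rewrite /invw /= rev_cons. Qed.

Lemma pw_invw s : pw (invw s) = (pw s)^-1%g.
Proof.
elim: s => [|x s IH]; first by rewrite /= invg1.
by rewrite invw_cons pw_rcons IH gl_linv pw_cons invgM.
Qed.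

Lemma invw_ends x s : exists t,
  invw (x :: s) = linv (last x s) :: t /\ last (linv (last x s)) t = linv x.
Proof.
case/lastP: s => [|s y]; first by exists [::].
rewrite last_rcons -rcons_cons invw_rcons invw_cons.
by exists (rcons (invw s) (linv x)); rewrite last_rcons.
Qed.

Definition pwr (u k : F2) : Prop := exists n : nat, (k = u ^+ n \/ k = u ^- n)%g.

Lemma pwr_mull u k : pwr u k -> pwr u (u * k)%g.
Proof.
case=> n [->|->]; first by exists n.+1; left; rewrite expgS.
case: n => [|n]; first by exists 1%N; left; rewrite expg0 invg1 mulg1 expg1.
by exists n; right; rewrite expgSr invgM mulVKg.
Qed.

Lemma pwr_inv u k : pwr u k -> pwr u k^-1%g.
Proof. by case=> n [->|->]; exists n; [right | left; rewrite invgK]. Qed.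

Lemma pwr_mullV u k : pwr u k -> pwr u (u^-1 * k)%g.
Proof.
case=> n [->|->].
  case: n => [|n]; first by exists 1%N; right; rewrite expg0 mulg1 expg1.
  by exists n; left; rewrite expgS mulKg.
by exists n.+1; right; rewrite expgSr invgM.
Qed.

Lemma pwr_comm u k : pwr u k -> commute u k.
Proof.
by case=> n [->|->]; [exact: commuteX | exact/commuteV/commuteX].
Qed.

Lemma pwr_type (t : bool) s : all (fun x : letter => x.1 == t) s -> pwr (gl (t, false)) (pw s).
Proof.
elim: s => [|[t' e] s IH] /=; first by exists 0%N; left.
case/andP=> /eqP /= -> /IH h; case: e => //.
  by rewrite -[(t, true)]/(linv (t, false)) gl_linv; apply: pwr_mullV.
exact: pwr_mull.
Qed.

(** The two ends of a word are stripped of the letters that do not matter,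
  unless nothing remains. *)
Lemma strip (T : eqType) (p q : pred T) (s : seq T) :
  exists s1 s2 s3, [/\ s = s1 ++ (s2 ++ s3), all p s1, all q s3 &
     s2 = [::] \/ exists x t, [/\ s2 = x :: t, ~~ p x & ~~ q (last x t)]].
Proof.
have R (q' : pred T) (r : seq T) : exists r1 r2, [/\ r = r1 ++ r2, all q' r2 &
    r1 = [::] \/ exists r' y, r1 = rcons r' y /\ ~~ q' y].
  elim/last_ind: r => [|r y [r1 [r2 [E h1 h2]]]]; first by exists [::], [::]; split=> //; left.
  case qy : (q' y); last first.
    by exists (rcons r y), [::]; rewrite cats0; split=> //; right; exists r, y; rewrite qy.
  by exists r1, (rcons r2 y); rewrite -rcons_cat E all_rcons qy h1; split.
elim: s => [|x s [s1 [s2 [s3 [E h1 h2 h3]]]]].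
  by exists [::], [::], [::]; split=> //; left.
case px : (p x); first by exists (x :: s1), s2, s3; rewrite E /= px; split.
have [r1 [r2 [E' h4 h5]]] := R q (x :: s).
exists [::], r1, r2; split=> //.
case: h5 => [->|[r' [y [e qy]]]]; [by left | right].
move: E'; rewrite e; case: r' e => [|x' r'] e /= [].
  by move=> xy _; rewrite -xy in qy *; exists x, [::]; rewrite px.
by move=> <- _; exists x, (rcons r' y); rewrite last_rcons px -rcons_cons.
Qed.

End Words.

(** * Limits of iterates *)

Section Limit.
Variable R : realType.
Implicit Types (X Y : 'M[R]_2) (e f p q r v z k l : R * R) (m : R).

Lemma small_power (m T : R) : 1 < m ^+ 2 -> 0 < T -> exists n : nat, (m^-1) ^+ (2 * n) < T.
Proof.
move=> m1 T0; pose h := m ^+ 2 - 1.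
have h0 : 0 < h by rewrite subr_gt0.
have B n : 1 + n%:R * h <= (m ^+ 2) ^+ n.
  elim: n => [|n IH]; first by rewrite mul0r addr0 expr0.
  have mE : m ^+ 2 = 1 + h by rewrite /h; ring.
  rewrite mE in IH *; rewrite exprS.
  apply: le_trans (ler_wpM2l _ IH); last by lra.
  rewrite -natr1; have : 0 <= n%:R * (h * h) by rewrite mulr_ge0 // mulr_ge0 // ltW.
  by lra.
pose n := Num.bound (T^-1 / h); exists n.
have hn : T^-1 / h < n%:R.
  by apply: archi_boundP; rewrite divr_ge0 ?invr_ge0 // ltW.
have hn2 : T^-1 < (m ^+ 2) ^+ n.
  by apply: lt_le_trans (B n); move: hn; rewrite ltr_pdivrMr // => ?; lra.
rewrite exprM exprVn exprVn invf_plt ?posrE //; first by rewrite exprn_gt0 //; lra.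
Qed.

(** Iterating X drives every vector off the repelling line to the attracting
line, so a closed condition satisfied along the way holds in the limit. *)
Lemma limit_arc X m e f k l z : m != 0 -> 1 < m ^+ 2 -> act X e = scv m e -> act X f = scv m^-1 f ->
  dt e f != 0 -> dt z f != 0 ->
  (forall n, 0 <= dt k (iter n (act X) z) * dt (iter n (act X) z) l) ->
  0 <= dt k e * dt e l.
Proof.
move=> m0 m1 he hf ef zf H.
pose al := dt z f / dt e f; pose be := dt e z / dt e f.
have zE : z = addv (scv al e) (scv be f).
  case: (e) (f) (z) ef @al @be {he hf zf H} => [e1 e2] [f1 f2] [z1 z2].
  by rewrite /dt /addv /scv /= => ef; congr pair; field.
have al0 : al != 0 by rewrite mulf_neq0 ?invr_neq0.
have it n : iter n (act X) z = addv (scv (al * m ^+ n) e) (scv (be * m^-1 ^+ n) f).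
  elim: n => [|n IH]; first by rewrite /= !expr0 !mulr1.
  rewrite iterS IH /act /=; move: he hf; rewrite /act /scv /= => -[h1 h2] [h3 h4].
  rewrite /addv /= !exprSr; congr pair.
    transitivity (al * m ^+ n * (X 0 0 * e.1 + X 0 1 * e.2) + be * m^-1 ^+ n * (X 0 0 * f.1 + X 0 1 * f.2)); first by ring.
    by rewrite h1 h3; ring.
  transitivity (al * m ^+ n * (X 1 0 * e.1 + X 1 1 * e.2) + be * m^-1 ^+ n * (X 1 0 * f.1 + X 1 1 * f.2)); first by ring.
  by rewrite h2 h4; ring.
rewrite leNgt; apply/negP => Q0.
pose A := al ^+ 2 * (dt k e * dt e l).
pose B := al * be * (dt k e * dt f l + dt k f * dt e l).
pose C := be ^+ 2 * (dt k f * dt f l).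
have A0 : A < 0 by rewrite /A pmulr_rlt0 // exprn_even_gt0.
pose T := Num.min 1 (- A / (`|B| + `|C| + 1)).
have N0 : 0 < `|B| + `|C| + 1 by rewrite ltr_wpDl // addr_ge0.
have T0 : 0 < T by rewrite lt_min ltr01 divr_gt0 // oppr_gt0.
have [n hn] := small_power m1 T0.
have := H n; rewrite it.
set t := m^-1 ^+ (2 * n) in hn.
have t0 : 0 < t by rewrite /t exprM exprn_gt0 // exprn_even_gt0 // invr_neq0.
have tE : t = m^-1 ^+ n * m^-1 ^+ n by rewrite /t mul2n -addnn exprD.
have mm : m ^+ n * m^-1 ^+ n = 1 by rewrite -exprMn divff // expr1n.
have mp : 0 < m ^+ n * m ^+ n by rewrite -expr2 exprn_even_gt0 // expf_neq0.
set Q := _ * _ => Qn.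
have QE : Q = (m ^+ n * m ^+ n) * (A + B * t + C * t ^+ 2).
  rewrite tE /Q /A /B /C.
  transitivity ((m ^+ n * m ^+ n) * (al ^+ 2 * (dt k e * dt e l)) +
    (m ^+ n * m^-1 ^+ n) * (al * be * (dt k e * dt f l + dt k f * dt e l)) +
    (m^-1 ^+ n * m^-1 ^+ n) * (be ^+ 2 * (dt k f * dt f l))).
    by rewrite /dt /addv /scv /=; ring.
  transitivity ((m ^+ n * m ^+ n) * (al ^+ 2 * (dt k e * dt e l)) +
    (m ^+ n * m^-1 ^+ n) ^+ 2 * (al * be * (dt k e * dt f l + dt k f * dt e l)) +
    (m ^+ n * m^-1 ^+ n) ^+ 2 * (m^-1 ^+ n * m^-1 ^+ n) * (be ^+ 2 * (dt k f * dt f l))); last by ring.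
  by rewrite mm; ring.
move: Qn; rewrite QE pmulr_rge0 // leNgt => /negP; apply.
have t1 : t < 1 by apply: lt_le_trans hn _; rewrite ge_min lexx.
have tA : t * (`|B| + `|C| + 1) < - A.
  by rewrite -ltr_pdivlMr //; apply: lt_le_trans hn _; rewrite ge_min lexx orbT.
have hB : B * t <= `|B| * t by rewrite ler_pM2r // ler_norm.
have hC : C * t ^+ 2 <= `|C| * t.
  apply: le_trans (_ : `|C| * t ^+ 2 <= _); first by rewrite ler_wpM2r ?ler_norm // sqr_ge0.
  by rewrite ler_wpM2l // expr2 ler_piMl // ltW.
by lra.
Qed.

End Limit.

(** * Representations of the free group *)

Section Rep.
Variable R : realType.
Implicit Types (u v h : F2) (e f p q r z : R * R) (m : R) (x y : letter) (s w : seq letter).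

Definition isrep (rho : F2 -> 'M[R]_2) : Prop :=
  (forall u, \det (rho u) = 1) /\ (forall u v, rho (u * v)%g = rho u *m rho v).

(** That the commutator of the generators has trace less than -2 is what
  distinguishes the one-holed torus from the pair of pants. *)
Definition toric (rho : F2 -> 'M[R]_2) := 4 < \det (comm2 (rho gen_a) (rho gen_b)).

Variable rho : F2 -> 'M[R]_2.
Hypothesis rep : isrep rho.

Lemma rep_det u : \det (rho u) = 1. Proof. exact: rep.1. Qed.
Lemma repM u v : rho (u * v)%g = rho u *m rho v. Proof. exact: rep.2. Qed.
Lemma rep1 : rho 1%g = 1%:M.
Proof.
have h : rho 1%g *m rho 1%g = rho 1%g by rewrite -repM mulg1.
by rewrite -[LHS]mul1mx -(adj2_mul (rep_det 1%g)) -mulmxA h.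
Qed.
Lemma repV u : rho (u^-1)%g = adj2 (rho u).
Proof.
rewrite -[LHS]mul1mx -(adj2_mul (rep_det u)) -mulmxA -repM mulgV rep1.
by rewrite mulmx1.
Qed.
Lemma repJ u h : rho (u ^ h)%g = adj2 (rho h) *m rho u *m rho h.
Proof. by rewrite conjgE !repM repV mulmxA. Qed.

Lemma rep_actV u p : act (rho u) (act (rho u^-1%g) p) = p.
Proof. by rewrite -actM -repM mulgV rep1 act1. Qed.
Lemma rep_actK u p : act (rho u^-1%g) (act (rho u) p) = p.
Proof. by rewrite -actM -repM mulVg rep1 act1. Qed.
Lemma rep_dt u p q : dt (act (rho u) p) (act (rho u) q) = dt p q.
Proof. by rewrite dt_act rep_det mul1r. Qed.
Lemma rep_act0 u p : p != 0 -> act (rho u) p != 0.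
Proof. exact/act_neq0/rep_det. Qed.

Lemma comm2J X Y P : \det P = 1 ->
  \det (comm2 (adj2 P *m X *m P) (adj2 P *m Y *m P)) = \det (comm2 X Y) :> R.
Proof.
move=> dP; have -> : comm2 (adj2 P *m X *m P) (adj2 P *m Y *m P) = adj2 P *m comm2 X Y *m P.
  rewrite /comm2 mulmxBr mulmxBl -!mulmxA.
  by rewrite !(mulmxA P) (mul_adj2 dP) !mul1mx.
by rewrite !det_mulmx det_adj2 dP mul1r mulr1.
Qed.

Lemma crossJ u v h : cross (rho (u ^ h)%g) (rho (v ^ h)%g) <-> cross (rho u) (rho v).
Proof. by rewrite /cross !repJ comm2J // rep_det. Qed.

Lemma comm2_adj X Y : \det (comm2 (adj2 X) Y) = \det (comm2 X Y) :> R.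
Proof. by rewrite /comm2 /adj2 !det2E !en2; ring. Qed.

Lemma crossV u v : cross (rho u^-1%g) (rho v) <-> cross (rho u) (rho v).
Proof. by rewrite /cross repV comm2_adj. Qed.

Lemma crossCE u v : cross (rho u) (rho v) <-> cross (rho v) (rho u).
Proof. by split; apply: crossC. Qed.

Lemma crossVr u v : cross (rho u) (rho v^-1%g) <-> cross (rho u) (rho v).
Proof. by rewrite crossCE crossV crossCE. Qed.

Lemma not_cross_self (X : 'M[R]_2) : ~ cross X X.
Proof. by rewrite /cross /comm2 subrr det2E !mxE mulr0 subrr ltxx. Qed.

Lemma hypJ u h : hyp (rho (u ^ h)%g) <-> hyp (rho u).
Proof. by rewrite /hyp repJ mxtrace_mulC mulmxA (mul_adj2 (rep_det h)) mul1mx. Qed.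

Lemma eigJ u h m e f : eig (rho u) m e f ->
  eig (rho (u ^ h)%g) m (act (rho h^-1%g) e) (act (rho h^-1%g) f).
Proof.
case=> m1 he hf ef.
have E p c : act (rho u) p = scv c p ->
    act (rho (u ^ h)%g) (act (rho h^-1%g) p) = scv c (act (rho h^-1%g) p).
  by move=> hv; rewrite conjgE !repM !actM rep_actV hv act_scv.
by split; [| exact: E | exact: E | rewrite rep_dt].
Qed.

Lemma eigV u m e f : eig (rho u) m e f -> eig (rho u^-1%g) m f e.
Proof.
move=> h; have m0 := eig_neq0 h; case: h => m1 he hf ef.
split=> //; last by rewrite dtC oppr_eq0.
  by rewrite -{1}(scv1 f) -(divff m0) -scvA -hf act_scv rep_actK.
by rewrite -{1}(scv1 e) -(mulVf m0) -scvA -he act_scv rep_actK.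
Qed.

End Rep.

(** * Fixed points read off words *)

Section PingPong.
Variable R : realType.
Implicit Types (u v h : F2) (e f p q r z : R * R) (m : R) (x y t : letter) (s w : seq letter).
Variable rho : F2 -> 'M[R]_2.
Hypothesis rep : isrep rho.
Variable S : schottky (fun x => rho (gl x)).

Definition arc x p : Prop := inarc (sk S x) (sl S x) p.

Lemma linvK' x : linv (linv x) = x. Proof. exact: linvK. Qed.

Lemma linv_neq x : linv x != x.
Proof. by case: x => [[] []]. Qed.

Lemma act_gl_inv x p : act (rho (gl x)) (act (rho (gl (linv x))) p) = p.
Proof. by rewrite gl_linv rep_actV. Qed.

Lemma pingpong x p : p != 0 -> ~ arc (linv x) p -> arc x (act (rho (gl x)) p).
Proof.
move=> p0 np; split; first exact: rep_act0.
rewrite s_pp mulNr -mulrN mulr_ge0 ?ltW ?s_pos // oppr_gt0 ltNge.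
by apply/negP => h; apply: np.
Qed.

Lemma arc_scv x c p : c != 0 -> arc x (scv c p) <-> arc x p.
Proof.
move=> c0; rewrite /arc /inarc dt_scl dt_scr.
have -> : c * dt (sk S x) p * (c * dt p (sl S x)) = c ^+ 2 * (dt (sk S x) p * dt p (sl S x)) by ring.
rewrite pmulr_rge0 ?exprn_even_gt0 //.
split=> -[p0 h]; split=> //; last exact: scv_neq0.
by apply: contraNneq p0 => ->; rewrite /scv /= mulr0; apply/eqP.
Qed.

Lemma arc_sk x : arc x (sk S x).
Proof. by split; [exact: dt_neq0l (s_kl S x) | rewrite dtvv mul0r]. Qed.

(** An order compatible with the cyclic one, starting on the left of the axis
  of a. *)
Definition idx x : nat := if x.1 then (if x.2 then 1 else 3) else (if x.2 then 2 else 0).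

Lemma cyc_idx x y t p q r : (idx x < idx y)%N -> (idx y < idx t)%N ->
  arc x p -> arc y q -> arc t r -> 0 < seps S * (dt p q * dt q r * dt p r).
Proof.
have C := @s_cyc _ _ S.
have rot a b c : dt a b * dt b c * dt a c = dt b c * dt c a * dt b a by move=> *; rewrite (dtC a c) (dtC a b); ring.
move: x y t => [[] []] [[] []] [[] []] // _ _ hp hq hr.
- exact: (C (true, true)).
- by rewrite -rot; apply: (C (true, false)).
- exact: (C (false, false)).
- by rewrite rot; apply: (C (false, true)).
Qed.

Lemma arc_disj x y p : arc x p -> arc y p -> x = y.
Proof.
move=> hx hy; apply/eqP; case: (eqVneq x y) => // xy; exfalso.
have [t [tx ty]] : exists t, t != x /\ t != y.
  move: x y xy {hx hy} => [[] []] [[] []] //= _;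
  first [by exists (true, true) | by exists (true, false) | by exists (false, true) | by exists (false, false)].
have ht := arc_sk t.
have N : ~~ (0 < seps S * (dt p p * dt p (sk S t) * dt p (sk S t))) by rewrite dtvv !mul0r mulr0 ltxx.
have N' : ~~ (0 < seps S * (dt p (sk S t) * dt (sk S t) p * dt p p)) by rewrite dtvv !mulr0 ltxx.
have N2 : ~~ (0 < seps S * (dt (sk S t) p * dt p p * dt (sk S t) p)) by rewrite dtvv mulr0 mul0r mulr0 ltxx.
wlog xy' : x y xy tx ty hx hy / (idx x < idx y)%N.
  move=> W; case: (ltngtP (idx x) (idx y)) => h; first exact: (W x y).
    by apply: (W y x) => //; rewrite eq_sym.
  by move: x y xy h {tx ty hx hy W} => [[] []] [[] []].
have ne a b : a != b -> idx a = idx b -> False by move: a b => [[] []] [[] []].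
case: (ltngtP (idx t) (idx x)) => h1; last exact: (ne _ _ tx).
  by move: N2; rewrite (cyc_idx h1 xy' ht hx hy).
case: (ltngtP (idx t) (idx y)) => h2; last exact: (ne _ _ ty).
  by move: N'; rewrite (cyc_idx h1 h2 hx ht hy).
by move: N; rewrite (cyc_idx xy' h2 hx hy ht).
Qed.

Lemma word_arc x s p : reduced (x :: s) -> p != 0 -> ~ arc (linv (last x s)) p ->
  arc x (act (rho (pw (x :: s))) p).
Proof.
elim: s x => [|y s IH] x; first by rewrite pw1 => _; exact: pingpong.
rewrite [reduced _]/= => /andP[yx rs] p0 np.
rewrite pw_cons repM // actM; apply: pingpong; first exact: rep_act0.
by move=> h; move: yx; rewrite (arc_disj h (IH _ rs p0 np)) eqxx.
Qed.

Lemma third x y : x != y -> exists t, t != x /\ t != y.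
Proof.
move: x y => [[] []] [[] []] //= _;
first [by exists (true, true) | by exists (true, false) | by exists (false, true) | by exists (false, false)].
Qed.

(** By ping-pong the iterates of a suitable vector stay in the arc of the
  first letter, which is closed, and they converge to the attracting line. *)
Lemma attract_arc x s m e f : reduced (x :: s) -> last x s != linv x ->
  eig (rho (pw (x :: s))) m e f -> arc x e.
Proof.
set W := pw (x :: s); set y := last x s => rs yx hW.
have m0 := eig_neq0 hW; have [m1 he hf ef] := hW.
have xy : x != linv y by apply: contraNneq yx => ->; rewrite linvK'.
have [t [tx ty]] := third xy.
have it n z : z != 0 -> ~ arc (linv y) z -> arc x (iter n.+1 (act (rho W)) z).
  move=> z0 nz; elim: n => [|n IH]; first exact: word_arc.
  rewrite iterS; apply: word_arc => //; first by case: IH.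
  by move=> h; move: xy; rewrite (arc_disj IH h) eqxx.
pose z := sk S t; have ht : arc t z := arc_sk t.
have [z0 _] := ht.
have nz : ~ arc (linv y) z by move=> h; move: ty; rewrite (arc_disj ht h) eqxx.
have f0 := dt_neq0r ef; have e0 := dt_neq0l ef.
have zf : dt z f != 0.
  apply/negP => /eqP zf; have [c fE] := dt_eq0 z0 zf.
  have c0 : c != 0 by apply: contraNneq f0 => h; rewrite fE h /scv !mul0r.
  have ft : arc t f by rewrite fE arc_scv.
  have ny : ~ arc (linv y) f by move=> h; move: ty; rewrite (arc_disj ft h) eqxx.
  have := word_arc rs f0 ny; rewrite -/W hf arc_scv ?invr_neq0 // => h.
  by move: tx; rewrite (arc_disj ft h) eqxx.
have Wz0 : dt (act (rho W) z) f != 0.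
  have : dt (act (rho W) z) (act (rho W) f) != 0 by rewrite rep_dt.
  by rewrite hf dt_scr mulf_eq0 negb_or => /andP[].
split=> //.
apply: (limit_arc m0 m1 he hf ef Wz0) => n.
by rewrite -iterSr; have [] := it n z z0 nz.
Qed.

Lemma repel_arc x s m e f : reduced (x :: s) -> last x s != linv x ->
  eig (rho (pw (x :: s))) m e f -> arc (linv (last x s)) f.
Proof.
move=> rs yx /(eigV rep); rewrite -pw_invw.
have [t [E lt]] := invw_ends x s; rewrite E => h.
apply: (attract_arc _ _ h); first by rewrite -E; apply: invw_reduced.
by rewrite lt linvK' eq_sym.
Qed.

Lemma cross_alt X Y m n e f e' f' x : eig X m e f -> eig Y n e' f' ->
  arc x e -> arc (nxt (nxt x)) f ->
  arc (nxt x) e' -> arc (nxt (nxt (nxt x))) f' -> cross X Y.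
Proof.
move=> hX hY he hf he' hf'; rewrite (cross_eig hX hY).
have N4 : nxt (nxt (nxt (nxt x))) = x by case: x {he hf he' hf'} => [[] []].
have h1 := s_cyc he he' hf; have h2 : 0 < seps S * (dt f f' * dt f' e * dt f e).
  by apply: (s_cyc hf hf'); rewrite N4.
have e0 : seps S != 0 by apply: contraTneq h1 => ->; rewrite mul0r ltxx.
have d0 : 0 < (seps S * dt e f) ^+ 2.
  have [_ _ _ ef] := hX; rewrite exprn_even_gt0 //; exact: mulf_neq0.
rewrite -(pmulr_rlt0 _ d0).
have := mulr_gt0 h1 h2; rewrite -oppr_lt0; congr (_ < _).
rewrite (dtC e' f) (dtC e f') (dtC e f); ring.
Qed.

Lemma noncross_arc X Y m n e f e' f' x : eig X m e f -> eig Y n e' f' ->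
  arc x e -> arc (nxt (nxt x)) f -> arc (nxt x) e' -> arc (nxt x) f' -> ~ cross X Y.
Proof.
move=> hX hY he hf he' hf'; rewrite (cross_eig hX hY).
have h1 := s_cyc he he' hf; have h2 := s_cyc he hf' hf.
have d0 : 0 < (seps S * dt e f) ^+ 2.
  have e0 : seps S != 0 by apply: contraTneq h1 => ->; rewrite mul0r ltxx.
  have [_ _ _ ef] := hX; rewrite exprn_even_gt0 //; exact: mulf_neq0.
rewrite -(pmulr_rlt0 _ d0) => h3; have := mulr_gt0 h1 h2.
rewrite ltNge => /negP; apply; apply: ltW; move: h3; congr (_ < _).
rewrite (dtC f e') (dtC f f'); ring.
Qed.

(** Lines through the edge from 1 to a: one end leaves 1 in the direction x,
  the other leaves a in the direction y. *)
Definition through_a p q x y :=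
  [/\ arc x p, x != (true, false), arc y (act (rho (gl (true, true))) q) & y != (true, true)].

(** 0 on the left of the axis of a, 2 on its right, 1 along it. *)
Definition side x : nat := if x.1 then 1 else if x.2 then 2 else 0.

(** The ends leaving from the origin of the edge and those leaving from its
  end are each cyclically ordered by their directions, so two lines that
  exchange sides separate each other. *)
Lemma dt4_through p q x y p' q' x' y' : through_a p q x y -> through_a p' q' x' y' ->
  (side x < side x')%N -> (side y' < side y)%N ->
  dt p p' * dt p q' * (dt q p' * dt q q') < 0.
Proof.
move=> [hp xa hq ya] [hp' xa' hq' ya'] lx ly.
have a_arc t z : arc t (act (rho (gl (true, true))) z) -> t != (true, true) -> arc (true, false) z.
  move=> h tA; rewrite -(act_gl_inv (true, false) z); apply: pingpong; first by case: h.
  by move=> h'; move: tA; rewrite (arc_disj h h') eqxx.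
have aq := a_arc _ _ hq ya; have aq' := a_arc _ _ hq' ya'.
have h1 : 0 < seps S * (dt p p' * dt p' q * dt p q).
  apply: (cyc_idx _ _ hp hp' aq).
    by move: x x' xa xa' lx {hp hp'} => [[] []] [[] []].
  by move: x' xa' {hp' lx} => [[] []].
have Ap : arc (true, true) (act (rho (gl (true, true))) p).
  apply: pingpong; first by case: hp.
  by move=> h; move: xa; rewrite (arc_disj hp h) eqxx.
have h2 : 0 < seps S * (dt p q * dt q q' * dt p q').
  set g := gl (true, true).
  rewrite -(rep_dt rep g p q) -(rep_dt rep g q q') -(rep_dt rep g p q') {}/g.
  set P := act _ p in Ap *; set Q := act _ q in hq *; set Q' := act _ q' in hq' *.
  move: y y' ya ya' ly hq hq' => [[] []] [[] []] // _ _ _ hq hq'.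
  - have := @cyc_idx (false, false) (true, true) (true, false) _ _ _ isT isT hq' Ap hq.
    by rewrite (dtC P Q') (dtC Q Q'); congr (_ < _); ring.
  - exact: (@cyc_idx (true, true) (false, true) (true, false) _ _ _ isT isT Ap hq hq').
  - have := @cyc_idx (false, false) (true, true) (false, true) _ _ _ isT isT hq' Ap hq.
    by rewrite (dtC P Q') (dtC Q Q'); congr (_ < _); ring.
have d0 : 0 < (seps S * dt p q) ^+ 2.
  have e0 : seps S != 0 by apply: contraTneq h1 => ->; rewrite mul0r ltxx.
  have ef : dt p q != 0 by apply: contraTneq h1 => ->; rewrite mulr0 mulr0 ltxx.
  rewrite exprn_even_gt0 //; exact: mulf_neq0.
rewrite -(pmulr_rlt0 _ d0); have := mulr_gt0 h1 h2; rewrite -oppr_lt0; congr (_ < _).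
rewrite (dtC q p'); ring.
Qed.

Definition line_of X p q := exists m, eig X m p q \/ eig X m q p.

Lemma cross_lines X Y p q p' q' : line_of X p q -> line_of Y p' q' ->
  dt p p' * dt p q' * (dt q p' * dt q q') < 0 -> cross X Y.
Proof.
by move=> [m [] hX] [n [] hY] h; rewrite (cross_eig hX hY); move: h; congr (_ < _); ring.
Qed.

(** Conjugation by the first letter gives the word that starts with the next
  one, and its attracting arc locates the second end of the line. *)
Lemma through_pos s (z y : letter) : reduced ((true, false) :: s) -> hyp (rho (pw ((true, false) :: s))) ->
  z = head (true, false) s -> y = last (true, false) s -> y != (true, true) ->
  exists p q, line_of (rho (pw ((true, false) :: s))) p q /\ through_a p q (linv y) z.
Proof.
set a := (true, false) => rs hw zE yE ya.
have [m [e [f hW]]] := eig_exists (rep_det rep _) hw.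
exists f, e; split; first by exists m; right.
have hf : arc (linv y) f by rewrite yE; apply: (repel_arc rs _ hW); rewrite -yE.
split=> //; first by apply: contraNneq ya => h; rewrite -(linvK' y) h.
  case: s rs zE yE hW {hw} => [|z' s] rs zE yE hW.
    have [m1 he _ _] := hW; have m0 := eig_neq0 hW.
    have ha : arc a e by apply: (attract_arc rs _ hW).
    have : act (rho (gl (true, true))) e = scv m^-1 e.
      apply: (etrans _ (act_gl_inv (true, true) (scv m^-1 e))); congr (act _ _).
      by rewrite act_scv -[linv _]/a -pw1 he scvA mulVf // scv1.
    by rewrite zE => ->; rewrite arc_scv ?invr_neq0.
  have rs' : reduced (z' :: rcons s a).
    have := path_sorted rs; rewrite /reduced /= rcons_path => -> /=.
    by rewrite yE in ya; apply: contraNneq ya => h; rewrite /= -(linvK' (last _ _)) -h.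
  have := eigJ rep (gl a) hW; rewrite -gl_linv => hW'.
  have E : (pw (a :: z' :: s) ^ gl a)%g = pw (z' :: rcons s a).
    by rewrite conjgE (pw_cons a) -mulgA mulKg -rcons_cons pw_rcons.
  rewrite E in hW'; rewrite zE; apply: (attract_arc rs' _ hW').
  by rewrite last_rcons; move: rs => /= /andP[h _]; rewrite -(inj_eq (inv_inj linvK)) linvK' eq_sym.
by rewrite zE; case: s rs {zE yE hW hw} => [|z' s] //= /andP[].
Qed.

Lemma through_neg s (z y : letter) : reduced ((true, true) :: s) -> hyp (rho (pw ((true, true) :: s))) ->
  z = head (true, true) s -> y = last (true, true) s -> y != (true, false) ->
  exists p q, line_of (rho (pw (rcons s (true, true)))) p q /\ through_a p q z (linv y).
Proof.
set a' := (true, true) => rs hw zE yE ya.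
have [m [e [f hW]]] := eig_exists (rep_det rep _) hw.
have hf : arc (linv y) f by rewrite yE; apply: (repel_arc rs _ hW); rewrite -yE.
have E : (pw (a' :: s) ^ gl a')%g = pw (rcons s a').
  by rewrite conjgE (pw_cons a') -mulgA mulKg pw_rcons.
have := eigJ rep (gl a') hW; rewrite E -gl_linv [linv a']/= => hW'.
exists (act (rho (gl (true, false))) e), (act (rho (gl (true, false))) f).
split; first by exists m; left.
have za : z != (true, false) by rewrite zE; case: s rs {zE yE hW hw E hW'} => [|z' s] //= /andP[].
split=> //.
- case: s rs zE yE hW {hw} E hW' => [|z' s] rs zE yE hW E hW'.
    have [m1 he _ _] := hW; have m0 := eig_neq0 hW.
    have ha : arc a' e by apply: (attract_arc rs _ hW).
    have -> : act (rho (gl (true, false))) e = scv m^-1 e.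
      apply: (etrans _ (act_gl_inv (true, false) (scv m^-1 e))); congr (act _ _).
      by rewrite act_scv -[linv _]/a' -pw1 he scvA mulVf // scv1.
    by rewrite zE arc_scv ?invr_neq0.
  have rs' : reduced (z' :: rcons s a').
    have := path_sorted rs; rewrite /reduced /= rcons_path => -> /=.
    by rewrite yE in ya; apply: contraNneq ya => h; rewrite /= -(linvK' (last _ _)) -h.
  rewrite rcons_cons in hW'; rewrite zE; apply: (attract_arc rs' _ hW').
  by rewrite last_rcons; move: rs => /= /andP[h _]; rewrite -(inj_eq (inv_inj linvK)) linvK' eq_sym.
- by rewrite (act_gl_inv (true, true)).
- by apply: contraNneq ya => h; rewrite -(linvK' y) h.
Qed.

End PingPong.

(** * Lines of the generators *)

Section Localization.
Variable R : realType.
Implicit Types (u v h k : F2) (e f p q r z : R * R) (m : R) (x y t : letter) (s w : seq letter).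

Lemma gl_a : gl (true, false) = gen_a. Proof. by apply/val_inj. Qed.
Lemma gl_b : gl (false, false) = gen_b. Proof. by apply/val_inj. Qed.

Lemma toric_schottky (rho : F2 -> 'M[R]_2) : isrep rho -> toric rho ->
  inhabited (schottky (fun x => rho (gl x))).
Proof.
move=> rep tor.
have -> : (fun x => rho (gl x)) = lmx (rho gen_a) (rho gen_b).
  apply: funext => -[[] []]; rewrite /lmx /= -?(repV rep) ?gl_a ?gl_b //.
    by rewrite -[(true, true)]/(linv (true, false)) gl_linv gl_a.
  by rewrite -[(false, true)]/(linv (false, false)) gl_linv gl_b.
by apply: schottky_exists => //; apply: rep_det.
Qed.

Lemma comm_hyp (X Y : 'M[R]_2) : \det X = 1 -> \det Y = 1 -> 4 < \det (comm2 X Y) -> hyp X /\ hyp Y.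
Proof.
move=> dX dY; rewrite det_comm2 // /hyp.
move: (\tr X) (\tr Y) (\tr (X *m Y)) => x y z h.
have E : 16 < (x ^+ 2 - 4) * (y ^+ 2 - 4).
  have : 0 <= (2 * z - x * y) ^+ 2 by rewrite sqr_ge0.
  by nra.
have x2 := sqr_ge0 x; have y2 := sqr_ge0 y.
have [hx|hx] := ltP 4 (x ^+ 2); have [hy|hy] := ltP 4 (y ^+ 2) => //.
- by split => //; have : (x ^+ 2 - 4) * (y ^+ 2 - 4) <= 0; [rewrite mulr_ge0_le0 ?subr_ge0 ?subr_le0 // ltW | lra].
- by have : (x ^+ 2 - 4) * (y ^+ 2 - 4) <= 0; [rewrite mulr_le0_ge0 ?subr_ge0 ?subr_le0 // ltW | lra].
have : (4 - x ^+ 2) * (4 - y ^+ 2) <= 4 * 4 by rewrite ler_pM ?subr_ge0 //; lra.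
by lra.
Qed.

Lemma toric_hyp (rho : F2 -> 'M[R]_2) : isrep rho -> toric rho ->
  hyp (rho gen_a) /\ hyp (rho gen_b).
Proof. by move=> rep; apply: comm_hyp; exact: rep_det. Qed.

Variable rho : F2 -> 'M[R]_2.
Hypothesis rep : isrep rho.
Hypothesis tor : toric rho.
Variable S : schottky (fun x => rho (gl x)).
Local Notation arc := (arc S).

Lemma eig_pwr u k m e f : eig (rho u) m e f -> pwr u k ->
  (exists2 c, c != 0 & act (rho k) e = scv c e) /\ (exists2 c, c != 0 & act (rho k) f = scv c f).
Proof.
move=> hu; have m0 := eig_neq0 hu; have [_ he hf _] := hu; have [_ hf' he' _] := eigV rep hu.
have G v c z (n : nat) : c != 0 -> act (rho v) z = scv c z ->
    exists2 c', c' != 0 & act (rho (v ^+ n)%g) z = scv c' z.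
  move=> c0 hz; elim: n => [|n [c' c0' IH]].
    by exists 1; rewrite ?oner_eq0 // expg0 (rep1 rep) act1 scv1.
  exists (c' * c); first exact: mulf_neq0.
  by rewrite expgS (repM rep) actM IH act_scv hz scvA.
have mi : m^-1 != 0 by rewrite invr_neq0.
case=> n [] ->; split; rewrite -?expVgn; [exact: G he | exact: G hf | exact: G he' | exact: G hf'].
Qed.

Lemma gen_arcs (t : bool) : exists m e f, [/\ eig (rho (gl (t, false))) m e f,
  arc (t, false) e & arc (t, true) f].
Proof.
have hh : hyp (rho (gl (t, false))).
  by have [ha hb] := toric_hyp rep tor; case: t; rewrite ?gl_a ?gl_b.
have [m [e [f h]]] := eig_exists (rep_det rep _) hh; exists m, e, f.
split=> //; rewrite -pw1 in h.
  by apply: (attract_arc rep S _ _ h) => //; case: t {hh h}.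
by apply: (repel_arc rep S _ _ h) => //; case: t {hh h}.
Qed.

(** Stripping from k^-1 the powers of a at one end and those of the generator
  at the other leaves a word that sends both fixed points to the arc of its
  first letter. *)
Lemma localize (t : bool) k :
  (exists i j, [/\ pwr (gl (t, false)) i, pwr gen_a j & k = (i * j)%g]) \/
  exists j x m e f, [/\ pwr gen_a j, x.1 = false,
     eig (rho (gl (t, false) ^ (k * j))%g) m e f, arc x e & arc x f].
Proof.
have [m [e [f [he ae af]]]] := gen_arcs t.
have [s1 [s2 [s3 [E h1 h3 h2]]]] := strip (fun x : letter => x.1 == true) (fun x : letter => x.1 == t) (word k^-1%g).
have kE : k^-1%g = (pw s1 * (pw s2 * pw s3))%g by rewrite -!pw_cat -E pwK.
have p1 : pwr gen_a (pw s1) by rewrite -gl_a; apply: pwr_type.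
have p3 : pwr (gl (t, false)) (pw s3) by apply: pwr_type.
case: h2 => [s20|[x [s [s2E hx hl]]]].
  left; exists (pw s3)^-1%g, (pw s1)^-1%g; split; try exact: pwr_inv.
  by rewrite -invgM -[LHS]invgK kE s20 mul1g.
right; exists (pw s1), x, m, (act (rho (k * pw s1)^-1%g) e), (act (rho (k * pw s1)^-1%g) f).
have kjE : ((k * pw s1)^-1 = pw s2 * pw s3)%g by rewrite invgM kE mulKg.
have rs : reduced (x :: s).
  have := word_reduced k^-1%g; rewrite /reduced E s2E.
  by move=> /cat_sorted2[_ /cat_sorted2[]].
have [[c c0 ce] [c' c0' cf]] := eig_pwr he p3.
have [_ _ _ ef] := he; have e0 := dt_neq0l ef; have f0 := dt_neq0r ef.
split=> //; first by move: hx; case: (x.1).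
- exact: eigJ.
- rewrite kjE (repM rep) actM ce act_scv arc_scv // s2E; apply: word_arc => //.
  by move=> h; move: hl; rewrite -[last x s]linvK' -(arc_disj ae h) eqxx.
rewrite kjE (repM rep) actM cf act_scv arc_scv // s2E; apply: word_arc => //.
by move=> h; move: hl; rewrite -[last x s]linvK' -(arc_disj af h) eqxx.
Qed.

Lemma noncross_side Y x m e f : x.1 = false -> eig Y m e f -> arc x e -> arc x f ->
  ~ cross (rho gen_a) Y.
Proof.
have [ma [ea [fa [ha aea afa]]]] := gen_arcs true; rewrite gl_a in ha.
case: x => [[] [] // _ hY he hf].
  by rewrite /cross -comm2_adj -(repV rep); exact: (noncross_arc (eigV rep ha) hY afa aea he hf).
exact: (noncross_arc ha hY aea afa he hf).
Qed.

Lemma pwr_conj u j : pwr u j -> (u ^ j = u)%g.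
Proof. by move/pwr_comm => h; apply/conjg_fixP/commgP. Qed.

(** After a translation along the axis of a, the other line has both ends in
  one arc on one side of this axis. *)
Lemma noncross_a k : ~ cross (rho gen_a) (rho (gen_a ^ k)%g).
Proof.
have := localize true k; rewrite gl_a.
case=> [[i [j [hi hj ->]]]|[j [x [m [e [f [hj hx he ae af]]]]]]].
  by rewrite conjgM (pwr_conj hi) (pwr_conj hj); exact: not_cross_self.
rewrite -(crossJ rep _ _ j) (pwr_conj hj) -conjgM.
exact: (noncross_side hx he ae af).
Qed.

Lemma commute_a k : rho gen_a *m rho (gen_a ^ k)%g = rho (gen_a ^ k)%g *m rho gen_a -> pwr gen_a k.
Proof.
have := localize true k; rewrite gl_a.
case=> [[i [j [hi hj ->]]]|[j [x [m [e [f [hj hx he ae af]]]]]]] hc.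
  have [n hn] := hj.
  have K (l : nat) v : pwr gen_a v -> pwr gen_a (gen_a ^+ l * v)%g.
    by elim: l => [|l IH] hv; rewrite ?expg0 ?mul1g // expgS -mulgA; apply: pwr_mull; apply: IH.
  have K' (l : nat) v : pwr gen_a v -> pwr gen_a (gen_a ^- l * v)%g.
    by elim: l => [|l IH] hv; rewrite ?expg0 ?invg1 ?mul1g // expgSr invgM -mulgA; apply: pwr_mullV; apply: IH.
  by case: hi => l [->|->]; [exact: K | exact: K'].
exfalso.
have [ma [ea [fa [ha aea afa]]]] := gen_arcs true; rewrite gl_a in ha.
have hc' : rho gen_a *m rho (gen_a ^ (k * j))%g = rho (gen_a ^ (k * j))%g *m rho gen_a.
  have h1 : rho (gen_a * gen_a ^ k)%g = rho (gen_a ^ k * gen_a)%g.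
    by rewrite (repM rep gen_a (gen_a ^ k)%g) (repM rep (gen_a ^ k)%g gen_a).
  have : rho ((gen_a * gen_a ^ k) ^ j)%g = rho ((gen_a ^ k * gen_a) ^ j)%g by rewrite (repJ rep _ j) h1 -(repJ rep).
  rewrite (conjMg gen_a (gen_a ^ k)%g j) (conjMg (gen_a ^ k)%g gen_a j) (pwr_conj hj) -conjgM.
  by rewrite (repM rep gen_a (gen_a ^ (k * j))%g) (repM rep (gen_a ^ (k * j))%g gen_a).
have [h _] := comm_eig (rep_det rep _) (rep_det rep _) hc' ha.
have ea0 : ea != 0 by case: aea.
have bad z : z != 0 -> arc x z -> dt ea z = 0 -> False.
  move=> z0 az h'; have [c zE] := dt_eq0 ea0 h'.
  have c0 : c != 0 by apply: contraNneq z0 => hc0; rewrite zE hc0 /scv !mul0r.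
  have az' : arc (true, false) z by rewrite zE arc_scv.
  by move: hx; rewrite (arc_disj az az').
have [_ _ _ ef] := he.
by case: (eig_line he h); apply: bad => //; [exact: dt_neq0l ef | exact: dt_neq0r ef].
Qed.

Lemma cross_ab k : cross (rho gen_a) (rho (gen_b ^ k)%g) ->
  exists2 j, pwr gen_a j & (gen_b ^ k = gen_b ^ j)%g.
Proof.
have := localize false k; rewrite gl_b.
case=> [[i [j [hi hj ->]]]|[j [x [m [e [f [hj hx he ae af]]]]]]] hc.
  by exists j => //; rewrite conjgM (pwr_conj hi).
exfalso; move: hc; rewrite -(crossJ rep _ _ j) (pwr_conj hj) -conjgM.
exact: (noncross_side hx he ae af).
Qed.

(** The four ends lie in the four arcs, alternately, when the two lines run
  straight on through a vertex. *)
Lemma cross_straight x (s : seq letter) y (t : seq letter) : reduced (x :: s) -> reduced (y :: t) ->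
  x.1 = true -> y.1 = false -> last x s = x -> last y t = y ->
  hyp (rho (pw (x :: s))) -> hyp (rho (pw (y :: t))) ->
  cross (rho (pw (x :: s))) (rho (pw (y :: t))).
Proof.
move=> rs rt x1 y1 lx ly hx hy.
have [m [e [f he]]] := eig_exists (rep_det rep _) hx.
have [m' [e' [f' he']]] := eig_exists (rep_det rep _) hy.
have nl (z : letter) : z != linv z by rewrite eq_sym linv_neq.
have xs : last x s != linv x by rewrite lx.
have yt : last y t != linv y by rewrite ly.
have ae := attract_arc rep S rs xs he; have af := repel_arc rep S rs xs he.
have ae' := attract_arc rep S rt yt he'; have af' := repel_arc rep S rt yt he'.
rewrite lx in af; rewrite ly in af'.
have xx : linv x = nxt (nxt x) by case: (x) => [[] []].
rewrite xx in af.
case: (eqVneq y (nxt x)) => [yE|yE].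
  apply: (cross_alt he he' ae af); rewrite -?yE //.
  by rewrite (_ : nxt (nxt y) = linv y) //; case: (y) => [[] []].
have yE' : linv y = nxt x.
  by move: x y x1 y1 yE {rs rt hx hy lx ly he he' xs yt ae af ae' af' xx} => [[] []] [[] []].
apply/(crossVr rep); apply: (cross_alt he (eigV rep he') ae af); rewrite -?yE' //.
by rewrite (_ : nxt (nxt (linv y)) = y) //; case: (y) => [[] []].
Qed.

End Localization.

(** * Turns of cyclic words *)

Section CyclicWords.
Local Open Scope nat_scope.
Implicit Types (t : bool) (x y z : letter) (i j k : nat).
Variables (W : nat -> letter) (n : nat).

(** A cyclically reduced word is read periodically; n is a period and need not
  be the least one. *)
Definition cyclic_word := [/\ (0 < n)%N, forall k, W (k + n)%N = W k &
  forall k, W k.+1 != linv (W k)].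

(** Orienting the edge crossed by the (i+1)st letter positively, the directions
  in which the line leaves its origin and its end. *)
Definition dir_start i := if (W i.+1).2 then W i.+2 else linv (W i).
Definition dir_end i := if (W i.+1).2 then linv (W i) else W i.+2.

(** For edges of type t: 0 on the left, 2 on the right, 1 straight on. *)
Definition pos t x : nat := if x.1 == t then 1 else if x.2 (+) t then 0 else 2.

(** No line through an edge enters on the left of another one and leaves on
  its right. *)
Definition uncrossed t := forall i j, (W i.+1).1 = t -> (W j.+1).1 = t ->
  ~ ((pos t (dir_start i) < pos t (dir_start j))%N /\ (pos t (dir_end j) < pos t (dir_end i))%N).

(** At a letter of the given type the word either runs straight on at both
  sides or returns to the side from which it came. *)
Definition flanked t := forall i, (W i.+1).1 = t ->
  ((W i).1 == t) = ((W i.+2).1 == t) /\ ((W i).1 != t -> W i.+2 = linv (W i)).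

Hypothesis cW : cyclic_word.

Lemma cyc_mod i : W (i %% n) = W i.
Proof.
case: cW => n0 per _; rewrite {2}(divn_eq i n) addnC.
by elim: (i %/ n) => [|k IH]; rewrite ?mul0n ?addn0 // mulSn addnCA addnC per.
Qed.

Lemma cyc_mod1 i : W (i %% n).+1 = W i.+1.
Proof. by rewrite -cyc_mod -[LHS]cyc_mod -[RHS]cyc_mod -addn1 -[in RHS]addn1 !modnDml cyc_mod. Qed.

Lemma cyc_mod2 i : W (i %% n).+2 = W i.+2.
Proof.
by rewrite -[LHS]cyc_mod -[RHS]cyc_mod -[in LHS]addn2 -[in RHS]addn2 !modnDml.
Qed.

Definition cnt (P : nat -> bool) : nat := \sum_(i < n) P i.

Lemma cnt_shift (P : nat -> bool) : P n = P 0%N -> cnt (fun i => P i.+1) = cnt P.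
Proof.
rewrite /cnt; have [n0 _ _] := cW; case: n n0 => // n' _ E.
by rewrite big_ord_recr big_ord_recl /= E addnC.
Qed.

Lemma count_match (P Q : nat -> bool) : cnt P = cnt Q ->
  (forall i j, P i -> ~~ Q i -> Q j -> ~~ P j -> False) ->
  forall i, (i < n)%N -> P i = Q i.
Proof.
move=> E H; pose A := [set i : 'I_n | P i]%SET; pose B := [set i : 'I_n | Q i]%SET.
have cA : #|A| = cnt P by rewrite -sum1_card big_mkcond; apply: eq_bigr => i _; rewrite inE; case: (P i).
have cB : #|B| = cnt Q by rewrite -sum1_card big_mkcond; apply: eq_bigr => i _; rewrite inE; case: (Q i).
have eAB : #|A| = #|B| by rewrite cA cB.
suff AB : A = B by move=> i hi; have := congr1 (fun C : {set 'I_n} => Ordinal hi \in C) AB; rewrite !inE.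
apply/eqP; rewrite eqEcard eAB leqnn andbT; apply/fintype.subsetP => i; rewrite !inE => Pi.
apply/negPn/negP => Qi.
have : ~~ (B \subset A)%SET.
  apply/negP => BA; have : (B == A)%SET by rewrite eqEcard BA eAB leqnn.
  by move/eqP/setP/(_ i); rewrite !inE Pi (negPf Qi).
by case/fintype.subsetPn => j; rewrite !inE => Qj Pj; apply: (H i j).
Qed.

Definition cstart t z := cnt (fun i => ((W i.+1).1 == t) && (dir_start i == z)).
Definition cend t z := cnt (fun i => ((W i.+1).1 == t) && (dir_end i == z)).

(** Lines that do not cross keep their order along an edge, so equal numbers
  on one side at the two ends mean the same lines. *)
Lemma uncrossed_match t z : uncrossed t -> z.1 != t -> cstart t z = cend t z ->
  forall i, (W i.+1).1 = t -> (dir_start i == z) = (dir_end i == z).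
Proof.
move=> U zt E i hi.
have pz x : pos t x = pos t z -> x = z.
  by rewrite /pos (negPf zt); move: x z zt {E} => [[] []] [[] []]; case: t {U hi} => /=.
have pz02 x : x != z -> if z.2 (+) t then (pos t z < pos t x)%N else (pos t x < pos t z)%N.
  by rewrite /pos (negPf zt); move: x z zt {E pz} => [[] []] [[] []]; case: t {U hi} => //=.
have n0 : (0 < n)%N by case: cW.
have := @count_match _ _ E _ (i %% n)%N (ltn_pmod _ n0).
rewrite cyc_mod1 hi eqxx /= /dir_start /dir_end cyc_mod1 cyc_mod2 cyc_mod; apply.
move=> j k /andP[/eqP tj sj] ej /andP[/eqP tk ek] sk.
move: ej sk; rewrite tj tk eqxx /= => ej sk.
have sjE : dir_start j = z by apply/eqP.
have ekE : dir_end k = z by apply/eqP.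
have := pz02 _ ej; have := pz02 _ sk.
case: ifP => _ h1 h2; first by apply: (U j k tj tk); rewrite sjE ekE.
by apply: (U k j tk tj); rewrite sjE ekE.
Qed.

Definition adj x y := cnt (fun i => (W i == x) && (W i.+1 == y)).

Lemma adj_shift x y : adj x y = cnt (fun i => (W i.+1 == x) && (W i.+2 == y)).
Proof.
rewrite /adj -(@cnt_shift (fun i => (W i == x) && (W i.+1 == y))) //.
by have [_ per _] := cW; rewrite -(per 0%N) -(per 1%N) add0n add1n.
Qed.

Lemma cntD (P Q P' : nat -> bool) : (forall i, P i = Q i + P' i :> nat)%N ->
  cnt P = (cnt Q + cnt P')%N.
Proof. by move=> E; rewrite /cnt -big_split /=; apply: eq_bigr => i _; exact: E. Qed.

Lemma cstartE t z : cstart t z = (adj (linv z) (t, false) + adj (t, true) z)%N.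
Proof.
rewrite (adj_shift (t, true)) /adj; apply: cntD => i; rewrite /dir_start.
move: (W i) (W i.+1) (W i.+2) z => [[] []] [[] []] [[] []] [[] []]; by case: t.
Qed.

Lemma cendE t z : cend t z = (adj (t, false) z + adj (linv z) (t, true))%N.
Proof.
rewrite (adj_shift (t, false)) /adj; apply: cntD => i; rewrite /dir_end.
move: (W i) (W i.+1) (W i.+2) z => [[] []] [[] []] [[] []] [[] []]; by case: t.
Qed.

Lemma cstart_total t : cnt (fun i => (W i.+1).1 == t) =
  (cstart t (~~ t, false) + cstart t (~~ t, true) + cstart t (t, false) + cstart t (t, true))%N.
Proof.
rewrite /cstart /cnt -!big_split /=; apply: eq_bigr => i _.
by move: (dir_start i) (W i.+1) => [[] []] [[] []]; case: t.
Qed.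

Lemma cend_total t : cnt (fun i => (W i.+1).1 == t) =
  (cend t (~~ t, false) + cend t (~~ t, true) + cend t (t, false) + cend t (t, true))%N.
Proof.
rewrite /cend /cnt -!big_split /=; apply: eq_bigr => i _.
by move: (dir_end i) (W i.+1) => [[] []] [[] []]; case: t.
Qed.

Lemma flanked_adj t x y : flanked t -> y.1 == t -> x.1 != t -> adj x y = adj y (linv x).
Proof.
move=> F yt xt; rewrite (adj_shift y) /adj /cnt; apply: eq_bigr => i _; congr (nat_of_bool _).
have := F i.
move: (W i) (W i.+1) (W i.+2) => p q r.
case: (eqVneq q y) => [-> /(_ (eqP yt)) [h1 h2]|]; last by rewrite andbF.
rewrite /= andbT; case: (eqVneq p x) h1 h2 => [->|px] h1 h2.
  by rewrite (h2 xt) eqxx.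
apply/esym/negP => /eqP rE; have pt : p.1 != t by rewrite h1 rE.
move: px; have := h2 pt; rewrite rE; move/(inv_inj linvK) => ->.
by rewrite eqxx.
Qed.

(** At the letters of the other type every turn is symmetric, so at each end
  of an edge of type t the two sides are equally frequent; since the totals at
  both ends agree, each side is as frequent at one end as at the other. *)
Lemma flanked_other t : flanked (~~ t) -> uncrossed t -> flanked t.
Proof.
move=> F U.
have nt : (t == ~~ t) = false by case: (t).
have tn : (~~ t == t) = false by case: (t).
have A x y : y.1 == ~~ t -> x.1 != ~~ t -> adj x y = adj y (linv x) by exact: flanked_adj.
have e1 : cstart t (~~ t, false) = cstart t (~~ t, true).
  rewrite !cstartE /= (A (t, true) (~~ t, false)) ?eqxx ?nt //.
  by rewrite (A (t, true) (~~ t, true)) ?eqxx ?nt //= addnC.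
have e2 : cend t (~~ t, false) = cend t (~~ t, true).
  rewrite !cendE /= (A (t, false) (~~ t, false)) ?eqxx ?nt //.
  by rewrite (A (t, false) (~~ t, true)) ?eqxx ?nt //= addnC.
have e3 : (cstart t (t, false) + cstart t (t, true) = cend t (t, false) + cend t (t, true))%N.
  rewrite !cstartE !cendE /=.
  have [_ _ red] := cW.
  have Z x : adj x (linv x) = 0%N.
    rewrite /adj /cnt big1 // => i _; have := red i.
    by case: (eqVneq (W i) x) => //= -> /negPf ->.
  have z1 : adj (t, true) (t, false) = 0 := Z (t, true).
  have z2 : adj (t, false) (t, true) = 0 := Z (t, false).
  by rewrite -[linv (t, false)]/(t, true) -[linv (t, true)]/(t, false) z1 z2; lia.
have e4 : cstart t (~~ t, false) = cend t (~~ t, false).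
  by have := cstart_total t; rewrite (cend_total t); lia.
have e5 : cstart t (~~ t, true) = cend t (~~ t, true) by rewrite -e1 -e2.
move=> i hi.
have := uncrossed_match U _ e4 hi; have := uncrossed_match U _ e5 hi.
rewrite /= tn => /(_ isT) h1 /(_ isT) h2.
have [_ _ red] := cW; have := red i; have := red i.+1.
move: h1 h2 hi; rewrite /dir_start /dir_end {e1 e2 e3 e4 e5 A F U}.
by move: (W i) (W i.+1) (W i.+2) => [[] []] [[] []] [[] []]; case: t nt tn.
Qed.

(** Every edge of type t is left by turning to one of two sides at each of its
  ends. A side taken at most half of the time is taken exactly half of the
  time, which is the same at both ends. *)
Lemma flanked_balanced t : (forall i, (W i).1 = t -> (W i.+1).1 = ~~ t) -> uncrossed t ->
  (forall e, (2 * cstart t (~~ t, e) <= cnt (fun i => (W i.+1).1 == t))%N) ->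
  (forall e, (2 * cend t (~~ t, e) <= cnt (fun i => (W i.+1).1 == t))%N) -> flanked t.
Proof.
move=> I U Hs He.
have tn : (~~ t == t) = false by case: (t).
have Z x : x.1 = t -> (adj x (t, false) = 0 /\ adj x (t, true) = 0)%N.
  move=> xt; rewrite /adj /cnt; split; rewrite big1 // => i _;
  case: (eqVneq (W i) x) => //= E; have := I i; rewrite E => /(_ xt) h;
  by apply/eqP; rewrite eqb0; apply: contraFN tn => /eqP h'; rewrite -h h'.
have [z1 z2] := Z (t, false) erefl; have [z3 z4] := Z (t, true) erefl.
have [s01 s02] : cstart t (t, false) = 0%N /\ cstart t (t, true) = 0%N by rewrite !cstartE -[linv (t, false)]/(t, true) -[linv (t, true)]/(t, false) ?z1 ?z2 ?z3 ?z4.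
have [s11 s12] : cend t (t, false) = 0%N /\ cend t (t, true) = 0%N by rewrite !cendE -[linv (t, false)]/(t, true) -[linv (t, true)]/(t, false) ?z1 ?z2 ?z3 ?z4.
have T1 := cstart_total t; have T2 := cend_total t.
have e4 : cstart t (~~ t, false) = cend t (~~ t, false).
  by have := Hs true; have := Hs false; have := He true; have := He false; lia.
have e5 : cstart t (~~ t, true) = cend t (~~ t, true) by lia.
move=> i hi.
have := uncrossed_match U _ e4 hi; have := uncrossed_match U _ e5 hi.
rewrite /= tn => /(_ isT) h1 /(_ isT) h2.
have [_ _ red] := cW; have := red i; have := red i.+1; have := I i; have := I i.+1.
move: h1 h2 hi; rewrite /dir_start /dir_end {e4 e5 Hs He U Z T1 T2 s01 s02 s11 s12}.
by move: (W i) (W i.+1) (W i.+2) => [[] []] [[] []] [[] []]; case: (t) tn => // _ h1 h2 h3 h4 h5; do ?[by have := h4 h3 | by have := h5 erefl].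
Qed.

(** A repeated letter propagates along the whole word; without repetition
  every turn goes back to the side of the previous one. *)
Lemma flanked_rigid : (forall t, flanked t) ->
  (forall i, W i = W 0%N) \/ (forall i, W i.+2 = linv (W i)).
Proof.
move=> F; have [n0 per red] := cW.
case: (pselect (exists i, (W i).1 = (W i.+1).1)) => [[i0 E]|N]; [left | right]; last first.
  move=> i; have [_ h] := F _ i erefl; apply: h; apply/eqP => h.
  by apply: N; exists i.
have eqL i : (W i).1 = (W i.+1).1 -> W i.+1 = W i.
  by have := red i; move: (W i) (W i.+1) => [[] []] [[] []].
have fw k : (W (i0 + k)%N).1 = (W (i0 + k).+1).1 /\ W (i0 + k)%N = W i0.
  elim: k => [|k [IH1 IH2]]; first by rewrite addn0.
  rewrite addnS (eqL _ IH1) IH2; split=> //.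
  have [h _] := F _ (i0 + k)%N erefl; move: h; rewrite IH1 eqxx => /esym/eqP h.
  by rewrite -IH2 IH1 h.
have all0 i : W i = W i0.
  rewrite -(fw (i + i0 * n - i0)%N).2 subnKC.
    by rewrite -cyc_mod modnMDl' || (rewrite -[LHS]cyc_mod -[RHS]cyc_mod addnC modnMDl).
  by rewrite (leq_trans _ (leq_addl _ _)) // leq_pmulr.
by move=> i; rewrite (all0 i) (all0 0%N).
Qed.

End CyclicWords.

(** * Endomorphisms of the free group *)

Section Homs.
Implicit Types (u v h k : F2) (x y : letter) (s : seq letter) (phi psi : F2 -> F2).

Definition morph phi : Prop := {morph phi : x y / (x * y)%g}.

Lemma morph1 phi : morph phi -> phi 1%g = 1%g.
Proof. by move=> m; apply: (mulgI (phi 1%g)); rewrite -m !mulg1. Qed.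
Lemma morphV phi u : morph phi -> phi (u^-1)%g = ((phi u)^-1)%g.
Proof. by move=> m; apply: (mulgI (phi u)); rewrite -m !mulgV morph1. Qed.
Lemma morphJ phi u h : morph phi -> phi (u ^ h)%g = (phi u ^ phi h)%g.
Proof. by move=> m; rewrite !conjgE !m morphV. Qed.
Lemma morphX phi u n : morph phi -> phi (u ^+ n)%g = (phi u ^+ n)%g.
Proof. by move=> m; elim: n => [|n IH]; rewrite ?expg0 ?morph1 // !expgS m IH. Qed.
Lemma morph_pwr phi u k : morph phi -> pwr u k -> pwr (phi u) (phi k).
Proof.
by move=> m [n [->|->]]; exists n; [left | right]; rewrite ?morphV // morphX.
Qed.
Lemma morph_comp phi psi : morph phi -> morph psi -> morph (phi \o psi).
Proof. by move=> m1 m2 u v; rewrite /= m2 m1. Qed.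
Lemma morph_conj h : morph (fun u => (u ^ h)%g).
Proof. by move=> u v; rewrite conjMg. Qed.

Lemma morph_ext phi psi : morph phi -> morph psi ->
  phi gen_a = psi gen_a -> phi gen_b = psi gen_b -> phi =1 psi.
Proof.
move=> m1 m2 ea eb u; rewrite -(pwK u); elim: (word u) => [|x s IH].
  by rewrite /= !morph1.
rewrite pw_cons m1 m2 IH; congr (_ * _)%g.
case: x => [[] []].
- by rewrite -[(true, true)]/(linv (true, false)) gl_linv gl_a !morphV ?ea.
- by rewrite gl_a.
- by rewrite -[(false, true)]/(linv (false, false)) gl_linv gl_b !morphV ?eb.
- by rewrite gl_b.
Qed.

(** A homomorphism when f is compatible with inversion. *)
Definition subst (f : letter -> F2) u : F2 := foldr (fun x g => f x * g)%g 1%g (word u).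

Lemma subst_morph f : (forall x, f (linv x) = (f x)^-1%g) -> morph (subst f).
Proof.
move=> fV u v; rewrite /subst word_mul.
have P x s : foldr (fun x g => f x * g)%g 1%g (push x s) = (f x * foldr (fun x g => f x * g)%g 1%g s)%g.
  by case: s => [//|y s] /=; case: ifP => // /eqP ->; rewrite fV mulVKg.
elim: (word u) => [|x s IH]; first by rewrite /= mul1g.
by rewrite /mulw /= P -/(mulw s (word v)) IH mulgA.
Qed.

Lemma subst_gl f x : subst f (gl x) = f x.
Proof. by rewrite /subst /= mulg1. Qed.

Lemma subst_pw f s : (forall x, f (linv x) = (f x)^-1%g) ->
  subst f (pw s) = foldr (fun x g => f x * g)%g 1%g s.
Proof.
move=> fV; have m := subst_morph fV.
by elim: s => [|x s IH]; rewrite ?morph1 // pw_cons m subst_gl IH.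
Qed.

(** A lift of the rotation of order four of the torus. *)
Definition quarter := subst (fun x => gl (nxt x)).

Lemma nxt_linv x : nxt (linv x) = linv (nxt x).
Proof. by case: x => [[] []]. Qed.

Lemma quarter_morph : morph quarter.
Proof. by apply: subst_morph => x; rewrite nxt_linv gl_linv. Qed.

Lemma quarter_pw s : quarter (pw s) = pw (map nxt s).
Proof.
rewrite /quarter subst_pw; last by move=> x; rewrite nxt_linv gl_linv.
by elim: s => [//|x s IH]; rewrite /= IH.
Qed.

Lemma quarter4 u : quarter (quarter (quarter (quarter u))) = u.
Proof.
rewrite -(pwK u) !quarter_pw -!map_comp (eq_map (g := id)) ?map_id //.
by case=> [[] []].
Qed.

End Homs.

(** * Lines of a cyclic word *)

Section CyclicElements.
Variables (W : nat -> letter) (n : nat).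
Hypothesis cW : cyclic_word W n.

Definition wd i : seq letter := mkseq (fun k => W (i + k)%N) n.
Definition el i : F2 := pw (wd i).
Definition wtail i := mkseq (fun k => W (i.+1 + k)%N) n.-1.

Lemma wd_cons i : wd i = W i :: wtail i.
Proof.
have [n0 _ _] := cW; rewrite /wd /wtail; case: n n0 => // n' _.
rewrite /mkseq /= addn0 (iotaDl 1 0) -map_comp; congr cons.
by apply: eq_map => k /=; rewrite addnA addn1.
Qed.

Lemma wd_rcons i : wd i.+1 = rcons (wtail i) (W i).
Proof.
have [n0 per _] := cW; rewrite /wd /wtail; case: n n0 per => // n' _ per.
by rewrite mkseqS /= addSnnS per.
Qed.

Lemma wd_last i : last (W i.+1) (wtail i.+1) = W i.
Proof.
have : last (W i) (wd i.+1) = W i by rewrite wd_rcons last_rcons.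
by rewrite wd_cons.
Qed.

Lemma wtail_head i : head (W i) (wtail i) = W i.+1.
Proof.
have := wd_rcons i; rewrite wd_cons; case E : (wtail i) => [|y s] //= [] //.
Qed.

Lemma wd_reduced i : reduced (wd i).
Proof.
have [n0 per red] := cW; apply/(sortedP (W 0%N)) => k; rewrite size_mkseq => hk.
by rewrite !nth_mkseq ?addnS ?red // ltnW.
Qed.

Lemma size_wd i : size (wd i) = n. Proof. exact: size_mkseq. Qed.

Lemma word_el i : word (el i) = wd i. Proof. exact/word_pw/wd_reduced. Qed.

Lemma el_succ i : el i.+1 = (el i ^ gl (W i))%g.
Proof. by rewrite /el wd_rcons wd_cons pw_rcons pw_cons conjgE -mulgA mulKg. Qed.

Definition pre i : F2 := pw (mkseq W i).

Lemma pre_succ i : pre i.+1 = (pre i * gl (W i))%g.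
Proof. by rewrite /pre mkseqS pw_rcons. Qed.

Lemma el_pre i : el i = (el 0 ^ pre i)%g.
Proof.
elim: i => [|i IH]; first by rewrite conjg1.
by rewrite el_succ IH pre_succ conjgM.
Qed.

Lemma pre_mul k : pre (k * n) = (el 0 ^+ k)%g.
Proof.
elim: k => [|k IH]; first by rewrite mul0n expg0.
rewrite mulSn expgS -IH /pre /el -pw_cat; congr pw.
have [_ per _] := cW.
apply: (@eq_from_nth _ (W 0%N)); rewrite ?size_cat !size_mkseq // => j hj.
rewrite nth_mkseq // nth_cat size_mkseq; case: ltnP => jn; rewrite nth_mkseq //.
  by rewrite -[RHS]per subnK.
by rewrite -(ltn_add2r n) subnK // addnC.
Qed.

End CyclicElements.

Lemma cyclic_word_map (f : letter -> letter) W n : injective f ->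
  (forall x, f (linv x) = linv (f x)) -> cyclic_word W n -> cyclic_word (fun i => f (W i)) n.
Proof.
move=> fI fV [n0 per red]; split=> // k; first by rewrite per.
by rewrite -fV (inj_eq fI).
Qed.

Definition prv (x : letter) := nxt (nxt (nxt x)).
Lemma prvK : cancel prv nxt. Proof. by case=> [[] []]. Qed.
Lemma prv_linv x : prv (linv x) = linv (prv x). Proof. by case: x => [[] []]. Qed.

Lemma el_prv W n i : quarter (el (fun i => prv (W i)) n i) = el W n i.
Proof.
rewrite /el quarter_pw /wd /mkseq -map_comp; congr pw.
by apply: eq_map => k /=; rewrite prvK.
Qed.

(** The rotation of order four exchanges the two types of letters and
  preserves the order of the directions. *)
Lemma uncrossed_prv W : uncrossed (fun i => prv (W i)) true -> uncrossed W false.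
Proof.
move=> U i j hi hj; have := U i j; rewrite /dir_start /dir_end.
move: (W i) (W j) (W i.+1) (W j.+1) (W i.+2) (W j.+2) hi hj.
move=> x y [[] e] [[] e'] z t //= _ _ H [h1 h2]; apply: H => //.
move: e e' h1 h2 => [] [] /=; move: x y z t => [[] []] [[] []] [[] []] [[] []] //=.
Qed.

Section Geometric.
Variable R : realType.
Implicit Types (e f p q r z : R * R).

Lemma rep_comp (rho : F2 -> 'M[R]_2) phi : isrep rho -> morph phi -> isrep (rho \o phi).
Proof. by move=> [d m] mp; split=> [u|u v] /=; rewrite ?d // mp m. Qed.

Lemma toric_quarter (rho : F2 -> 'M[R]_2) : isrep rho -> toric rho -> toric (rho \o quarter).
Proof.
move=> rep; rewrite /toric /=.
have -> : quarter gen_a = gen_b by rewrite -gl_a /quarter subst_gl gl_b.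
have -> : quarter gen_b = gen_a^-1%g.
  by rewrite -gl_b /quarter subst_gl -gl_a -gl_linv.
by rewrite repV // /comm2 /adj2 !det2E !en2 => h; apply: lt_le_trans h _; lra.
Qed.

Variables (W : nat -> letter) (n : nat).
Hypothesis cW : cyclic_word W n.

Section A.
Variable rho : F2 -> 'M[R]_2.
Hypothesis rep : isrep rho.
Hypothesis tor : toric rho.
Hypothesis hypW : hyp (rho (el W n 0)).

Lemma hyp_el i : hyp (rho (el W n i)).
Proof. by rewrite (el_pre cW) hypJ. Qed.

Lemma through_W (S : schottky (fun x => rho (gl x))) i : (W i.+1).1 = true ->
  exists p q j, [/\ line_of (rho (el W n j)) p q,
    through_a S p q (dir_start W i) (dir_end W i) & j = if (W i.+1).2 then i.+2 else i.+1].
Proof.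
move=> h1; have rs := wd_reduced cW i.+1; have hh := hyp_el i.+1.
have [_ _ red] := cW; have redi := red i.
have eh := wtail_head cW i.+1; have el' := wd_last cW i.
have er := wd_rcons cW i.+1.
rewrite /el (wd_cons cW) in hh; rewrite (wd_cons cW) in rs.
rewrite /dir_start /dir_end.
case E : (W i.+1) h1 redi eh el' er rs hh => [[] [] //] _ redi eh el' er rs hh /=.
  have [|p [q [h2 h3]]] := through_neg rep S rs hh (esym eh) (esym el').
    by apply: contraNneq redi => ->.
  by exists p, q, i.+2; split=> //; rewrite /el er.
have [|p [q [h2 h3]]] := through_pos rep S rs hh (esym eh) (esym el').
  by apply: contraNneq redi => ->.
by exists p, q, i.+1; split=> //; rewrite /el (wd_cons cW) E.
Qed.

Lemma side_pos x : side x = pos true x.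
Proof. by case: x => [[] []]. Qed.

(** Two lines through a common edge that exchange sides cross. *)
Lemma uncrossed_a : (forall h h', ~ cross (rho (el W n 0 ^ h)%g) (rho (el W n 0 ^ h')%g)) ->
  uncrossed W true.
Proof.
move=> N i j hi hj; rewrite -!side_pos => -[h1 h2].
have [S] := toric_schottky rep tor.
have [p [q [j1 [l1 t1 _]]]] := through_W S hi.
have [p' [q' [j2 [l2 t2 _]]]] := through_W S hj.
have := cross_lines l1 l2 (dt4_through rep t1 t2 h1 h2).
by rewrite (el_pre cW j1) (el_pre cW j2); apply: N.
Qed.

Lemma cross_el i j : (W i).1 = true -> W i.+1 = W i -> (W j).1 = false -> W j.+1 = W j ->
  cross (rho (el W n i.+1)) (rho (el W n j.+1)).
Proof.
move=> hi ei hj ej; have [S] := toric_schottky rep tor.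
have H := cross_straight rep S (x := W i.+1) (y := W j.+1).
have hx := hyp_el i.+1; have hy := hyp_el j.+1.
have rx := wd_reduced cW i.+1; have ry := wd_reduced cW j.+1.
move: hx hy rx ry; rewrite /el !(wd_cons cW) => hx hy rx ry.
by apply: (H _ _ rx ry _ _ _ _ hx hy); rewrite ?(wd_last cW) ?ei ?ej.
Qed.
End A.

End Geometric.

Lemma uncrossed_b (R : realType) (W : nat -> letter) n (rho : F2 -> 'M[R]_2) :
  cyclic_word W n -> isrep rho -> toric rho -> hyp (rho (el W n 0)) ->
  (forall h h', ~ cross (rho (el W n 0 ^ h)%g) (rho (el W n 0 ^ h')%g)) -> uncrossed W false.
Proof.
move=> cW rep tor hW N; apply: uncrossed_prv.
have cW' : cyclic_word (fun i => prv (W i)) n.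
  by apply: cyclic_word_map cW; [exact: can_inj prvK | exact: prv_linv].
apply: (uncrossed_a cW' (rep_comp rep quarter_morph) (toric_quarter rep tor)).
  by rewrite /= el_prv.
by move=> h h'; rewrite /= !(morphJ _ _ quarter_morph) el_prv; exact: N.
Qed.

(** * Peripheral words *)

Section Interior.
Variable R : realType.
Implicit Types (u v h : F2) (e f p q r z : R * R) (m : R) (x y t : letter) (s w : seq letter).
Variable rho : F2 -> 'M[R]_2.
Hypothesis rep : isrep rho.
Variable S : schottky (fun x => rho (gl x)).
Local Notation arc := (arc S).

Definition iarc x p : Prop := p != 0 /\ 0 < dt (sk S x) p * dt p (sl S x).

Lemma iarcW x p : iarc x p -> arc x p.
Proof. by case=> p0 h; split=> //; exact: ltW. Qed.

Lemma pingpong_i x p : p != 0 -> ~ arc (linv x) p -> iarc x (act (rho (gl x)) p).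
Proof.
move=> p0 np; split; first exact: rep_act0.
rewrite s_pp mulNr -mulrN mulr_gt0 ?s_pos // oppr_gt0 ltNge.
by apply/negP => h; apply: np.
Qed.

Lemma iarc_back x p : iarc (linv x) (act (rho (gl (linv x))) p) -> ~ arc x p.
Proof.
case=> _; rewrite s_pp linvK' mulNr -mulrN pmulr_rgt0 ?s_pos // oppr_gt0 => h [_].
by rewrite leNgt h.
Qed.

Lemma iarc_scv x c p : c != 0 -> iarc x (scv c p) -> iarc x p.
Proof.
move=> c0 [p0]; rewrite dt_scl dt_scr.
have -> : c * dt (sk S x) p * (c * dt p (sl S x)) = c ^+ 2 * (dt (sk S x) p * dt p (sl S x)) by ring.
rewrite pmulr_rgt0 ?exprn_even_gt0 // => h; split=> //.
by apply: contraNneq p0 => ->; rewrite /scv /= mulr0; apply/eqP.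
Qed.

Lemma word_iarc x s p : reduced (x :: s) -> p != 0 -> ~ arc (linv (last x s)) p ->
  iarc x (act (rho (pw (x :: s))) p).
Proof.
case: s => [|y s]; first by rewrite pw1 => _; exact: pingpong_i.
rewrite [reduced _]/= => /andP[yx rs] p0 np.
rewrite pw_cons repM // actM; apply: pingpong_i; first exact: rep_act0.
by move=> h; move: yx; rewrite (arc_disj h (word_arc rep rs p0 np)) eqxx.
Qed.

Lemma cyclic_core v : v != 1%g -> exists s x (t : seq letter),
  word v = s ++ (x :: t) ++ invw s /\ last x t != linv x.
Proof.
have [N] := ubnP (size (word v)); elim: N v => [//|N IH] v hN v1.
case E : (word v) hN => [|x t] hN.
  by case/eqP: v1; rewrite -(pwK v) E.
case: (eqVneq (last x t) (linv x)) => [lx|lx]; last by exists [::], x, t; rewrite cats0.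
case/lastP: t E lx hN => [|t y] E.
  by move/eqP; rewrite eq_sym (negPf (linv_neq x)).
rewrite last_rcons => yE; rewrite {}yE in E * => hN.
have rt : reduced t.
  have := word_reduced v; rewrite /reduced E /= => /path_sorted.
  by rewrite -cats1 => /cat_sorted2[].
have t1 : pw t != 1%g.
  apply/eqP => /(congr1 (fun g : F2 => word g)); rewrite word_pw // => t0.
  by have := word_reduced v; rewrite E t0 /= eqxx.
have [|s [z [r [E' lr]]]] := IH (pw t) _ t1.
  by rewrite word_pw //; move: hN; rewrite /= size_rcons !ltnS; apply: leq_trans.
exists (x :: s), z, r; split=> //.
move: E'; rewrite word_pw // => ->.
by rewrite invw_cons -!cats1 -!catA !cat_cons -?catA.
Qed.

(** A conjugate is cyclically reduced, and ping-pong maps the complement of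
  a closed arc into the interior of another one. *)
Lemma eig_interior v m e f : eig (rho v) m e f -> exists x, iarc x e.
Proof.
move=> hv.
have v1 : v != 1%g.
  apply/eqP => vE; have := eig_sub_neq0 hv; have := eig_tr hv.
  have := eig_neq0 hv => m0; rewrite vE (rep1 rep) tr2E !en2 => h.
  have : m * (m + m^-1) = m * (1 + 1) by rewrite h.
  rewrite mulrDr divff // => h2; have m1 : m = 1 by nra.
  by rewrite m1 invr1 subrr expr0n ltxx.
have [s [x [t [E lx]]]] := cyclic_core v1.
have rv := word_reduced v; rewrite E in rv.
have [rs [rt _]] : reduced s /\ reduced (x :: t) /\ True.
  by move: rv => /cat_sorted2[h1 /cat_sorted2[h2 _]].
pose g := pw (x :: t).
have vE : (v ^ pw s)%g = g.
  rewrite -(pwK v) E !pw_cat pw_invw conjgE -/g.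
  by rewrite !mulgA mulVg mul1g mulgVK.
have := eigJ rep (pw s) hv; rewrite vE; set e' := act _ e => he'.
have [_ he1 _ ef'] := he'; have e0' := dt_neq0l ef'.
have m0 := eig_neq0 he'.
have ae' := attract_arc rep S rt lx he'.
have ne' : ~ arc (linv (last x t)) e'.
  by move=> h; move: lx; rewrite -[last x t]linvK' -(arc_disj ae' h) eqxx.
have ie' : iarc x e' by have := word_iarc rt e0' ne'; rewrite -/g he1 => /(iarc_scv m0).
have eE : e = act (rho (pw s)) e' by rewrite /e' rep_actV.
clear vE he' he1 ef' e0' ae' ne'; clearbody e'.
case/lastP: s rs rv E eE => [|s z] rs rv E eE.
  by exists x; rewrite eE /= (rep1 rep) act1.
case sE : (rcons s z) => [|y r]; first by move: (congr1 size sE); rewrite size_rcons.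
exists y; rewrite eE sE; apply: word_iarc; first by rewrite -sE.
  by case: ie'.
have -> : last y r = z by have := congr1 (last y) sE; rewrite last_rcons.
move=> h; have xz := arc_disj (iarcW ie') h.
have : sorted (fun a b => b != linv a) (rcons s z ++ x :: t ++ invw (rcons s z)) := rv.
rewrite cat_rcons => /cat_sorted2[_] /= /andP[]; by rewrite xz eqxx.
Qed.

End Interior.

Section Peripheral.
Variable R : realType.
Implicit Types (u v h : F2) (e f p q r z : R * R) (m : R) (x y t : letter) (s w : seq letter).
Variable rho : F2 -> 'M[R]_2.
Hypothesis rep : isrep rho.
Variable S : schottky (fun x => rho (gl x)).
Local Notation arc := (arc S).
Local Notation iarc := (iarc S).
Variables (W : nat -> letter) (n : nat).
Hypothesis cW : cyclic_word W n.
Hypothesis turnW : forall i, W i.+2 = linv (W i).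

Lemma turn_adj : W 1 = nxt (W 0) \/ W 0 = nxt (W 1).
Proof.
have [_ _ red] := cW; have := red 0%N; have := red 1%N; rewrite turnW.
by move: (W 0%N) (W 1%N) => [[] []] [[] []] //; auto.
Qed.

Lemma turn_adj_i : (forall i, W i.+1 = nxt (W i)) \/ (forall i, W i = nxt (W i.+1)).
Proof.
case: turn_adj => h; [left | right].
  elim=> [//|i IH]; rewrite turnW IH.
  by case: (W i) => [[] []].
elim=> [//|i IH]; rewrite turnW IH.
by case: (W i.+1) => [[] []].
Qed.

Lemma pre_eig i m p q : eig (rho (el W n 0)) m p q ->
  arc (W i) (act (rho (pre W i)^-1%g) p) /\ arc (W i.+1) (act (rho (pre W i)^-1%g) q).
Proof.
move=> h; have := eigJ rep (pre W i) h; rewrite -(el_pre cW) /el (wd_cons cW) => hi.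
have rs := wd_reduced cW i; rewrite (wd_cons cW) in rs.
have [n0 per red] := cW.
have lE : last (W i) (wtail W n i) = W (i + n.-1)%N.
  have : last (W i) (wd W n i) = W (i + n.-1)%N.
    by rewrite -nth_last /wd size_mkseq nth_mkseq // prednK.
  by rewrite (wd_cons cW).
have lE2 : linv (last (W i) (wtail W n i)) = W i.+1.
  have e : (i + n.-1).+2 = (i.+1 + n)%N by move: n0; lia.
  by rewrite lE -turnW e per.
have lx : last (W i) (wtail W n i) != linv (W i).
  by have := red i.+1; rewrite turnW -lE2 linvK' eq_sym.
split; first exact: (attract_arc rep S rs lx hi).
by rewrite -lE2; exact: (repel_arc rep S rs lx hi).
Qed.

(** A fixed point in the gap beyond the line of a word that always turns the
  same way would have to follow that word forever. *)
Lemma gap_empty m p q v m' f f' K : eig (rho (el W n 0)) m p q -> eig (rho v) m' f f' ->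
  (forall i y g, arc y g -> y != W i -> y != W i.+1 ->
     0 < K * (dt (act (rho (pre W i)^-1%g) p) g * dt (act (rho (pre W i)^-1%g) q) g)) ->
  K * (dt p f * dt q f) < 0 -> False.
Proof.
move=> hu hv gapK gf.
have [hm1 hp hq pq] := hu; have m0 := eig_neq0 hu; have p0 := dt_neq0l pq; have q0 := dt_neq0r pq.
have ne01 : W 0%N != W 1%N.
  by have [_ _ red] := cW; have := red 1%N; rewrite turnW (inj_eq (inv_inj linvK)).
have away (w : F2) z z' : eig (rho w) m' z z' -> K * (dt p z * dt q z) < 0 -> ~ arc (W 0%N) z.
  move=> hw gz hz.
  have gap_i i : K * (dt (act (rho (pre W i)^-1%g) p) (act (rho (pre W i)^-1%g) z) *
     dt (act (rho (pre W i)^-1%g) q) (act (rho (pre W i)^-1%g) z)) < 0 by rewrite !rep_dt.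
  have corner i : exists2 y, iarc y (act (rho (pre W i)^-1%g) z) & (y == W i) || (y == W i.+1).
    have := eigJ rep (pre W i) hw => /(eig_interior rep S)[y hy]; exists y => //.
    apply/negPn/negP; rewrite negb_or => /andP[h1 h2].
    by have := gapK i _ _ (iarcW hy) h1 h2; have := gap_i i; lra.
  have H i : arc (W i) (act (rho (pre W i)^-1%g) z).
    elim: i => [|i IH]; first by rewrite /pre /= invg1 (rep1 rep) act1.
    have [y hy /orP[/eqP yE|/eqP yE]] := corner i.+1; first by rewrite -yE; exact: iarcW.
    exfalso; move: hy; rewrite yE turnW pre_succ invgM repM // actM -gl_linv.
    by move/iarc_back; apply.
  have [_ hq' hp' qp] := eigV rep hu.
  have zp : dt z p != 0.
    by rewrite dtC oppr_eq0; apply: contraTneq gz => ->; rewrite mul0r mulr0 ltxx.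
  have : 0 <= dt (sk S (W 0%N)) q * dt q (sl S (W 0%N)).
    apply: (limit_arc m0 hm1 hq' hp' qp zp) => k.
    have [n0 per red] := cW.
    have WkE : W (k * n)%N = W 0%N by elim: k => [//|k IH]; rewrite mulSn addnC per.
    have := H (k * n)%N; rewrite WkE (pre_mul cW).
    have -> : act (rho (el W n 0 ^+ k)^-1%g) z = iter k (act (rho (el W n 0)^-1%g)) z.
      elim: k {WkE} => [|k IH]; first by rewrite expg0 invg1 (rep1 rep) act1.
      by rewrite expgSr invgM repM // actM IH.
    by case.
  have [_ aq] := pre_eig 0 hu; move: aq; rewrite /pre /= invg1 (rep1 rep) act1 => aq h.
  by move: ne01; rewrite (arc_disj (conj q0 h : arc (W 0%N) q) aq) eqxx.
have [ap _] := pre_eig 0 hu; move: ap; rewrite /pre /= invg1 (rep1 rep) act1 => ap.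
have ip : iarc (W 0%N) p.
  have [y hy] := eig_interior rep S hu.
  by rewrite (arc_disj ap (iarcW hy)).
have qf : dt f q != 0.
  by rewrite dtC oppr_eq0; apply: contraTneq gf => ->; rewrite !mulr0 ltxx.
have orbit k : exists (w : F2) z', eig (rho w) m' (iter k (act (rho (el W n 0))) f) z' /\
    K * (dt p (iter k (act (rho (el W n 0))) f) * dt q (iter k (act (rho (el W n 0))) f)) < 0.
  elim: k => [|k [w [z' [hw gz]]]]; first by exists v, f'.
  exists (w ^ (el W n 0)^-1)%g, (act (rho (el W n 0)) z').
  have := eigJ rep (el W n 0)^-1%g hw; rewrite invgK => h; split=> //.
  set z := iter k _ f in gz *; rewrite iterS -/z.
  have e1 : dt p z = m * (m^-1 * dt p z) by rewrite mulrA divff // mul1r.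
  have e2 : dt p (act (rho (el W n 0)) z) = m^-1 * dt p z.
    by rewrite -(rep_dt rep (el W n 0) p z) hp dt_scl mulrA mulVf // mul1r.
  have e3 : dt q (act (rho (el W n 0)) z) = m * dt q z.
    by rewrite -(rep_dt rep (el W n 0) q z) hq dt_scl mulrA divff // mul1r.
  rewrite e2 e3; have -> : m^-1 * dt p z * (m * dt q z) = (m * m^-1) * (dt p z * dt q z) by ring.
  by rewrite divff // mul1r.
have allneg k : 0 <= dt (sk S (W 0%N)) (iter k (act (rho (el W n 0))) f) *
    dt (iter k (act (rho (el W n 0))) f) (scv (-1) (sl S (W 0%N))).
  have [w [z' [hw gz]]] := orbit k; have [_ _ _ zz] := hw.
  rewrite dt_scr mulN1r mulrN oppr_ge0 leNgt; apply/negP => h.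
  by apply: (away _ _ _ hw gz); split; [exact: dt_neq0l zz | exact: ltW].
have := limit_arc m0 hm1 hp hq pq qf allneg.
by case: ip => _ h; rewrite dt_scr mulN1r mulrN oppr_ge0 leNgt h.
Qed.

(** One of the two ends of a crossing line would lie in the gap beyond the
  line of the word. *)
Lemma peripheral_noncross v : hyp (rho (el W n 0)) -> hyp (rho v) ->
  ~ cross (rho (el W n 0)) (rho v).
Proof.
move=> hu hv.
have [m [p [q eu]]] := eig_exists (rep_det rep _) hu.
have [m' [f [f' ev]]] := eig_exists (rep_det rep _) hv.
rewrite (cross_eig eu ev) => hc.
have [K gapK] : exists K, forall i y g, arc y g -> y != W i -> y != W i.+1 ->
     0 < K * (dt (act (rho (pre W i)^-1%g) p) g * dt (act (rho (pre W i)^-1%g) q) g).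
  have N4 x : nxt (nxt (nxt (nxt x))) = x by case: x => [[] []].
  case: turn_adj_i => adjW; [exists (seps S * dt p q) | exists (seps S * dt q p)] => i y g hg y1 y2;
    rewrite -(rep_dt rep (pre W i)^-1%g); have [hp hq] := pre_eig i eu;
    move: hp hq; set P := act _ p; set Q := act _ q => hp hq.
  - rewrite adjW in hq y2.
    have : y = nxt (nxt (W i)) \/ y = nxt (nxt (nxt (W i))).
      by move: (W i) y y1 y2 {hg hp hq P Q} => [[] []] [[] []] //= _ _; auto.
    case=> yE; rewrite yE in hg.
      by have := s_cyc hp hq hg; congr (_ < _); ring.
    have := s_cyc hg; move=> /(_ P Q); rewrite N4 => /(_ hp hq).
    by rewrite (dtC P g) (dtC Q g); congr (_ < _); ring.
  rewrite (adjW i) in hp y1.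
  have : y = nxt (nxt (W i.+1)) \/ y = nxt (nxt (nxt (W i.+1))).
    by move: (W i.+1) y y1 y2 {hg hp hq P Q} => [[] []] [[] []] //= _ _; auto.
  case=> yE; rewrite yE in hg.
    by have := s_cyc hq hp hg; congr (_ < _); ring.
  have := s_cyc hg; move=> /(_ Q P); rewrite N4 => /(_ hq hp).
  by rewrite (dtC P g) (dtC Q g); congr (_ < _); ring.
have : K ^+ 2 * (dt p f * dt p f' * (dt q f * dt q f')) <= 0.
  by rewrite mulr_ge0_le0 ?sqr_ge0 // ltW.
have [g1|g1] := ltP (K * (dt p f * dt q f)) 0; first by case: (gap_empty eu ev gapK g1).
have [g2|g2] := ltP (K * (dt p f' * dt q f')) 0.
  by case: (gap_empty eu (eigV rep ev) gapK g2).
move=> h; have K0 : K = 0 \/ K != 0 by case: (eqVneq K 0); auto.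
have : 0 <= K * (dt p f * dt q f) * (K * (dt p f' * dt q f')) by rewrite mulr_ge0.
have -> : K * (dt p f * dt q f) * (K * (dt p f' * dt q f')) =
   K ^+ 2 * (dt p f * dt p f' * (dt q f * dt q f')) by ring.
have Kn : K != 0.
  have y3 : linv (W 0%N) != W 1%N by have [_ _ red] := cW; rewrite eq_sym red.
  have := gapK 0%N (linv (W 0%N)) _ (arc_sk S _) (linv_neq _) y3.
  by apply: contraTneq => ->; rewrite mul0r ltxx.
have : K ^+ 2 * (dt p f * dt p f' * (dt q f * dt q f')) < 0.
  by rewrite pmulr_rlt0 // exprn_even_gt0.
by lra.
Qed.

End Peripheral.

(** * Twists and words of minimal length *)

Section Moves.
Implicit Types (u v h k c : F2) (x y z : letter) (s : seq letter) (phi psi : F2 -> F2).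

(** The Dehn twists along a, up to inner automorphisms. *)
Definition twl z := subst (fun x => if x.1 then gl x else
  if x.2 then (gl x * gl (linv z))%g else (gl z * gl x)%g).
Definition twr z := subst (fun x => if x.1 then gl x else
  if x.2 then (gl z * gl x)%g else (gl x * gl (linv z))%g).

Lemma twl_morph z : morph (twl z).
Proof.
apply: subst_morph => -[[] []] /=; rewrite ?invgM -?gl_linv ?linvK' //.
Qed.

Lemma twr_morph z : morph (twr z).
Proof.
apply: subst_morph => -[[] []] /=; rewrite ?invgM -?gl_linv ?linvK' //.
Qed.

(** A submonoid of the automorphisms that contains lifts of generators of
  SL_2(Z). *)
Inductive moves : (F2 -> F2) -> Prop :=
| moves_id : moves id
| moves_quarter phi : moves phi -> moves (phi \o quarter)
| moves_twl phi z : z.1 -> moves phi -> moves (phi \o twl z)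
| moves_conj phi c : moves phi -> moves (phi \o (fun u => (u ^ c)%g)).

Lemma moves_morph phi : moves phi -> morph phi.
Proof.
elim=> {phi} [u v //|phi _ m|phi z _ _ m|phi c _ m].
- exact: morph_comp m quarter_morph.
- exact: morph_comp m (twl_morph z).
- exact: morph_comp m (morph_conj c).
Qed.

Lemma moves_comp phi psi : moves phi -> moves psi -> moves (phi \o psi).
Proof.
move=> hp; elim=> {psi} [//|psi _ m|psi z hz _ m|psi c _ m].
- exact: (moves_quarter m).
- exact: (moves_twl hz m).
- exact: (moves_conj c m).
Qed.

Lemma twl_a z : twl z gen_a = gen_a. Proof. by rewrite -gl_a /twl subst_gl. Qed.
Lemma twl_b z : twl z gen_b = (gl z * gen_b)%g. Proof. by rewrite -gl_b /twl subst_gl. Qed.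
Lemma twr_a z : twr z gen_a = gen_a. Proof. by rewrite -gl_a /twr subst_gl. Qed.
Lemma twr_b z : twr z gen_b = (gen_b * gl (linv z))%g. Proof. by rewrite -gl_b /twr subst_gl. Qed.

Lemma twl_fix z x : z.1 -> x.1 -> twl z (gl x) = gl x.
Proof. by move=> z1 x1; rewrite /twl subst_gl x1. Qed.

Lemma twlK z : z.1 -> cancel (twl z) (twl (linv z)).
Proof.
move=> z1; apply: (morph_ext (morph_comp (twl_morph _) (twl_morph z)) (psi := id)) => //=.
  by rewrite !twl_a.
by rewrite twl_b twl_morph twl_b twl_fix // gl_linv mulVKg.
Qed.

Lemma twrE z : z.1 -> twr z =1 (fun u => (u ^ gl (linv z))%g) \o twl (linv z).
Proof.
move=> z1; apply: morph_ext; [exact: twr_morph | exact: morph_comp (morph_conj _) (twl_morph _) |..] => /=.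
  by rewrite twr_a twl_a; case: z z1 => [[] []] // _; apply/val_inj.
by rewrite twr_b twl_b conjgE -mulgA mulKg.
Qed.

Lemma moves_inv phi : moves phi -> exists psi, [/\ moves psi, cancel phi psi & cancel psi phi].
Proof.
have step p q g g' : [/\ moves q, cancel p q & cancel q p] ->
    moves g' -> cancel g g' -> cancel g' g ->
    exists psi', [/\ moves psi', cancel (p \o g) psi' & cancel psi' (p \o g)].
  move=> [m k1 k2] mg h1 h2; exists (g' \o q); split; first exact: moves_comp.
    by move=> u /=; rewrite k1 h1.
  by move=> u /=; rewrite h2 k2.
elim=> {phi} [|phi' _ [psi h]|phi' z hz _ [psi h]|phi' c _ [psi h]].
- by exists id; split=> //; exact: moves_id.
- apply: (step _ _ _ (id \o quarter \o quarter \o quarter) h).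
  + by do 3 apply: moves_quarter; exact: moves_id.
  + by move=> u /=; rewrite quarter4.
  + by move=> u /=; rewrite quarter4.
- apply: (step _ _ _ (id \o twl (linv z)) h).
  + by apply: moves_twl => //; exact: moves_id.
  + by move=> u /=; rewrite twlK.
  + by move=> u /=; rewrite -{1}(linvK' z) twlK.
apply: (step _ _ _ (id \o (fun u => (u ^ c^-1)%g)) h).
- exact: (moves_conj _ moves_id).
- by move=> u /=; rewrite conjgK.
- by move=> u /=; rewrite conjgKV.
Qed.

Lemma quarter_bdry : quarter bdry = (bdry ^ gen_a^-1)%g.
Proof. by apply/val_inj. Qed.

Lemma twl_bdry z : z.1 -> twl z bdry = bdry.
Proof. by case: z => [[] []] // _; apply/val_inj. Qed.

Lemma moves_bdry phi : moves phi -> exists c, phi bdry = (bdry ^ c)%g.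
Proof.
elim=> {phi} [|phi m [c h]|phi z hz m [c h]|phi c' m [c h]].
- by exists 1%g; rewrite conjg1.
- by exists (c * phi gen_a^-1)%g; rewrite /= quarter_bdry (morphJ _ _ (moves_morph m)) h conjgM.
- by exists c; rewrite /= twl_bdry.
by exists (c * phi c')%g; rewrite /= (morphJ _ _ (moves_morph m)) h conjgM.
Qed.

Lemma moves_bij phi : moves phi -> bijective phi.
Proof. by move=> /moves_inv[psi [_ h1 h2]]; exists psi. Qed.

End Moves.

Section Tightness.
Variables (W : nat -> letter) (n : nat).
Hypothesis cW : cyclic_word W n.
Implicit Types (x y z : letter).

Lemma junction_prod (f : letter -> F2) (c : letter -> letter -> F2) i m :
  foldr (fun x g => f x * g)%g 1%g (mkseq (fun k => W (i.+1 + k)%N) m) =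
  (c (W i) (W i.+1) * foldr (fun k g => (c (W (i + k)%N) (W (i + k).+1))^-1 * f (W (i + k).+1) *
     c (W (i + k).+1) (W (i + k).+2) * g) 1 (iota 0 m) * (c (W (i + m)%N) (W (i + m).+1))^-1)%g.
Proof.
elim: m => [|m IH]; first by rewrite /= addn0 mulg1 mulgV.
have fr (T : Type) (F : T -> F2) (l : seq T) : foldr (fun t g => F t * g)%g 1%g l = (\prod_(t <- l) F t)%g.
  by elim: l => [|t l IHl]; rewrite ?big_nil // big_cons /= IHl.
rewrite !fr in IH *; rewrite mkseqS -cats1 big_cat big_seq1 IH.
have -> : iota 0 m.+1 = iota 0 m ++ [:: m] by rewrite -addn1 iotaD.
rewrite big_cat big_seq1 addSn addnS.
set A := (\prod_(_ <- _) _)%g; set C := c (W i) _; set D := c (W (i + m)%N) _.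
by rewrite !mulgA mulgK.
Qed.

Lemma size_foldr (F : nat -> F2) (B : nat -> nat) s : (forall k, size (word (F k)) <= B k)%N ->
  (size (word (foldr (fun k g => F k * g)%g 1%g s)) <= \sum_(k <- s) B k)%N.
Proof.
move=> H; elim: s => [|k s IH]; first by rewrite big_nil.
rewrite big_cons /=; apply: leq_trans (size_wordM _ _) _; exact: leq_add.
Qed.

(** Correcting elements c inserted between the images of consecutive letters
  telescope, and J counts the junctions where they make the image shorter. *)
Lemma junction_bound (f : letter -> F2) (c : letter -> letter -> F2) (J : letter -> letter -> bool) :
  (forall x, f (linv x) = (f x)^-1%g) ->
  (forall x y z, y != linv x -> z != linv y ->
     (size (word ((c x y)^-1 * f y * c y z)%g) + J x y + J y z <= 1 + (y.1 == false))%N) ->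
  (forall k, (n <= size (word (subst f (el W n 0) ^ k)%g))%N) ->
  (2 * cnt n (fun i => J (W i) (W i.+1)) <= cnt n (fun i => (W i.+1).1 == false))%N.
Proof.
move=> fV H tight; have [n0 per red] := cW.
pose k := (subst f (gl (W 0%N)) * c (W 0%N) (W 1%N))%g.
have E : (subst f (el W n 0) ^ k)%g =
   foldr (fun k g => (c (W k) (W k.+1))^-1 * f (W k.+1) * c (W k.+1) (W k.+2) * g)%g 1%g (iota 0 n).
  rewrite /k conjgM -(morphJ _ _ (subst_morph fV)) -(el_succ cW) /el /wd (subst_pw _ fV).
  rewrite (junction_prod f c 0 n) conjgE !mulgA mulVg mul1g.
  have -> : W (0 + n)%N = W 0%N by rewrite per.
  have -> : W (0 + n).+1 = W 1%N by rewrite -addSn per.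
  by rewrite mulgVK.
have := tight k; rewrite E => h.
pose B i := (1 + (( W i.+1).1 == false) - J (W i) (W i.+1) - J (W i.+1) (W i.+2))%N.
have HB i : (size (word ((c (W i) (W i.+1))^-1 * f (W i.+1) * c (W i.+1) (W i.+2))%g) <= B i)%N.
  by have := H (W i) (W i.+1) (W i.+2) (red i) (red i.+1); rewrite /B; lia.
have HJ i : (B i + J (W i) (W i.+1) + J (W i.+1) (W i.+2) = 1 + ((W i.+1).1 == false))%N.
  by have := H (W i) (W i.+1) (W i.+2) (red i) (red i.+1); rewrite /B; lia.
have := leq_trans h (size_foldr (iota 0 n) HB).
have -> : \sum_(k0 <- iota 0 n) B k0 = \sum_(i < n) B i.
  by rewrite -(big_mkord xpredT) /index_iota subn0.
have sh := cnt_shift cW (P := fun i => J (W i) (W i.+1)).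
have S : (\sum_(i < n) B i + cnt n (fun i => J (W i) (W i.+1)) + cnt n (fun i => J (W i.+1) (W i.+2)) =
  n + cnt n (fun i => (W i.+1).1 == false))%N.
  transitivity (\sum_(i < n) (1 + ((W i.+1).1 == false)))%N; last by rewrite big_split /= sum1_card card_ord.
  by rewrite /cnt -!big_split /=; apply: eq_bigr => i _; rewrite HJ.
rewrite sh in S; first by move: S; rewrite /=; move: (cnt _ _) (cnt _ _) (\sum_(i < n) B i)%N => a b d; lia.
by rewrite -(per 0%N) -(per 1%N) add0n add1n.
Qed.

Definition Jstart z x y := ((x == linv z) && (y == (false, false))) || ((x == (false, true)) && (y == z)).
Definition Jend z x y := ((x == (false, false)) && (y == z)) || ((x == linv z) && (y == (false, true))).

Lemma cnt_Jstart z : z.1 -> cnt n (fun i => Jstart z (W i) (W i.+1)) = cstart W n false z.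
Proof.
move=> z1; rewrite (cstartE cW) /adj; apply: cntD => i; rewrite /Jstart.
by move: (W i) (W i.+1) z z1 => [[] []] [[] []] [[] []].
Qed.

Lemma cnt_Jend z : z.1 -> cnt n (fun i => Jend z (W i) (W i.+1)) = cend W n false z.
Proof.
move=> z1; rewrite (cendE cW) /adj; apply: cntD => i; rewrite /Jend.
by move: (W i) (W i.+1) z z1 => [[] []] [[] []] [[] []].
Qed.

(** No twist along a shortens the word, even up to conjugation. *)
Definition tight := forall z, z.1 -> forall k,
  (n <= size (word (twl z (el W n 0) ^ k)%g))%N /\ (n <= size (word (twr z (el W n 0) ^ k)%g))%N.

(** A twist changes the number of letters of type a by one for each b: it
  shortens the word when more than half of the edges b start with the
  cancelling letter. *)
Lemma tight_start z : tight -> z.1 -> (2 * cstart W n false z <= cnt n (fun i => (W i.+1).1 == false))%N.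
Proof.
move=> T z1; rewrite -cnt_Jstart //.
apply: (@junction_bound _ (fun x y => if Jstart z x y then gl z else 1%g) _ _ _ (fun k => (T z z1 k).1)).
  by case=> [[] []] /=; rewrite ?invgM -?gl_linv ?linvK'.
by case: z z1 {T} => [[] e] // _ [[] []] [[] []] [[] []]; case: e.
Qed.

Lemma tight_end z : tight -> z.1 -> (2 * cend W n false z <= cnt n (fun i => (W i.+1).1 == false))%N.
Proof.
move=> T z1; rewrite -cnt_Jend //.
apply: (@junction_bound _ (fun x y => if Jend z x y then gl z else 1%g) _ _ _ (fun k => (T z z1 k).2)).
  by case=> [[] []] /=; rewrite ?invgM -?gl_linv ?linvK'.
by case: z z1 {T} => [[] e] // _ [[] []] [[] []] [[] []]; case: e.
Qed.

(** Minimality bounds the frequency of the turns at the letters of type b, and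
  the absence of crossings does the rest. *)
Lemma tight_rigid : tight -> uncrossed W true -> uncrossed W false ->
  (forall i, (W i).1 = false -> (W i.+1).1 = true) ->
  (forall i, W i = W 0%N) \/ (forall i, W i.+2 = linv (W i)).
Proof.
move=> T Ua Ub I; apply: (flanked_rigid cW).
have Fb : flanked W false.
  apply: (flanked_balanced cW) => // e; [exact: (tight_start T) | exact: (tight_end T)].
by case=> //; exact: (@flanked_other _ _ cW true Fb Ua).
Qed.

End Tightness.

(** * Classification of simple curves *)

Section Classification.
Implicit Types (u v h k c : F2) (x y z : letter) (phi psi : F2 -> F2).

Lemma pw_nseq x n : pw (nseq n x) = (gl x ^+ n)%g.
Proof. by elim: n => [|n IH] //=; rewrite IH expgS. Qed.

Lemma reduced_nseq_cat n z y s : z.1 != y.1 -> reduced (y :: s) -> reduced (nseq n z ++ y :: s).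
Proof.
move=> zy rs; elim: n => [//|[|n] IH] /=.
  by rewrite /reduced /= -/(reduced (y :: s)) in rs *; rewrite rs andbT; apply: contraNneq zy => ->.
by move: IH => /= ->; rewrite andbT eq_sym linv_neq.
Qed.

Lemma reduced_cat_nseq n z y s : z.1 != (last y s).1 -> reduced (y :: s) -> reduced ((y :: s) ++ nseq n z).
Proof.
move=> zy rs; have S (k : nat) : nseq k.+1 z = rcons (nseq k z) z by elim: k => // k IH; congr cons; exact: IH.
elim: n => [|n IH]; first by rewrite cats0.
rewrite S -rcons_cat /reduced /= rcons_path -/(reduced ((y :: s) ++ nseq n z)).
apply/andP; split; first exact: IH.
rewrite last_cat; case: n {IH} => [|n] /=; first by apply: contraNneq zy => ->.
have -> : last z (nseq n z) = z by elim: n.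
by rewrite eq_sym linv_neq.
Qed.

Lemma reduced_nseq n x : reduced (nseq n x).
Proof.
elim: n => [//|[//|n] IH]; rewrite /reduced /= in IH *.
by rewrite IH andbT eq_sym linv_neq.
Qed.

Lemma size_glX x n : size (word (gl x ^+ n)%g) = n.
Proof. by rewrite -pw_nseq word_pw ?reduced_nseq // size_nseq. Qed.

Lemma size_wordV u : size (word u^-1%g) = size (word u).
Proof. by rewrite /= /invw size_rev size_map. Qed.

(** The powers of a do not cancel with the ends of the word. *)
Lemma size_conj_a y s k : reduced (y :: s) -> y.1 = false -> (last y s).1 = false ->
  pwr gen_a k -> (size (word (pw (y :: s) ^ k)%g) <= size (y :: s))%N -> k = 1%g.
Proof.
move=> rs y1 l1 pk.
have [n [z [z1 kE]]] : exists n z, z.1 = true /\ k = pw (nseq n z).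
  case: pk => n [->|->]; exists n.
    by exists (true, false); rewrite pw_nseq gl_a.
  by exists (true, true); rewrite pw_nseq -[(true, true)]/(linv (true, false)) gl_linv gl_a expVgn.
have kV : (k^-1 = pw (nseq n (linv z)))%g by rewrite kE !pw_nseq gl_linv expVgn.
rewrite conjgE kV {1}kE -!pw_cat word_pw; last first.
  rewrite cat_cons; apply: reduced_nseq_cat; first by rewrite y1 /= z1.
  by apply: (@reduced_cat_nseq n z y s); rewrite ?l1 ?z1.
rewrite !size_cat !size_nseq /= => h.
have n0 : n = 0%N by lia.
by rewrite kE n0.
Qed.

Lemma gl_moves x : exists2 phi, moves phi & gl x = phi gen_a.
Proof.
have m0 := moves_id; have m1 := moves_quarter m0; have m2 := moves_quarter m1.
have m3 := moves_quarter m2.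
case: x => [[] []]; [exists (id \o quarter \o quarter) | exists id | exists (id \o quarter \o quarter \o quarter)
  | exists (id \o quarter)] => //; by apply/val_inj.
Qed.

(** An element of minimal length in its conjugacy class is cyclically reduced.
  *)
Lemma el_of u : u != 1%g -> (forall k, size (word u) <= size (word (u ^ k)%g))%N ->
  exists W n, [/\ cyclic_word W n, el W n 0 = u & n = size (word u)].
Proof.
move=> u1 min; case E : (word u) => [|x s]; first by case/eqP: u1; rewrite -(pwK u) E.
have rs : reduced (x :: s) by rewrite -E; exact: word_reduced.
have lx : x != linv (last x s).
  apply/negP => /eqP xl.
  case/lastP: s E rs xl => [|s y] E rs; first by move/eqP; rewrite eq_sym (negPf (linv_neq x)).
  rewrite last_rcons => xl.
  have ue : (u ^ gl x = pw s)%g.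
    by rewrite -(pwK u) E pw_cons conjgE -mulgA mulKg pw_rcons xl gl_linv mulgK.
  have := min (gl x); rewrite ue E word_pw; last first.
    by move: rs; rewrite /reduced /= -cats1 => /path_sorted; case/cat_sorted2.
  by rewrite /= size_rcons; lia.
pose w := x :: s; pose n := size w; exists (fun i => nth x w (i %% n)), n.
have n0 : (0 < n)%N by [].
have cW : cyclic_word (fun i => nth x w (i %% n)) n.
  split=> // k; first by rewrite modnDr.
  have kn : (k %% n < n)%N by rewrite ltn_pmod.
  case: (ltnP (k %% n).+1 n) => h.
    have -> : (k.+1 %% n = (k %% n).+1)%N by rewrite -addn1 -modnDml addn1 modn_small.
    have /(sortedP x)/(_ (k %% n)%N) := rs; rewrite -/w -/n; exact.
  have e : (k %% n).+1 = n by apply/eqP; rewrite eqn_leq h andbT.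
  have -> : (k.+1 %% n = 0)%N by rewrite -addn1 -modnDml addn1 e modnn.
  have -> : (k %% n = n.-1)%N by have := congr1 predn e.
  by rewrite /n nth_last.
split=> //; rewrite -(pwK u) /el; congr pw; rewrite E -/w.
apply: (@eq_from_nth _ x); rewrite size_mkseq // => i hi.
by rewrite nth_mkseq // add0n modn_small.
Qed.

Lemma el_const W n : (forall i, W i = W 0%N) -> el W n 0 = (gl (W 0%N) ^+ n)%g.
Proof.
move=> cst; rewrite -pw_nseq /el; congr pw; rewrite -[nseq n _](mkseq_nth (W 0%N)) size_nseq.
by apply: eq_map => i /=; rewrite nth_nseq cst; case: ifP.
Qed.

Definition rooted u := forall k, commute u k -> pwr u k.

Lemma rooted_glX x n : rooted (gl x ^+ n)%g -> n = 1%N.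
Proof.
move=> r; have [|m [E|E]] := r (gl x); first exact/commute_sym/commuteX.
  have := congr1 (fun u : F2 => size (word u)) E.
  by rewrite -expgnA size_glX /= => /esym/eqP; rewrite muln_eq1 => /andP[/eqP].
have := congr1 (fun u : F2 => size (word u)) E.
by rewrite size_wordV -expgnA size_glX /= => /esym/eqP; rewrite muln_eq1 => /andP[/eqP].
Qed.

Section Rho.
Variable R : realType.
Implicit Type rho : F2 -> 'M[R]_2.

Lemma toric_bdry rho : isrep rho -> toric rho <-> \tr (rho bdry) < -2.
Proof.
move=> rep; have -> : rho bdry = adj2 (rho gen_a) *m (adj2 (rho gen_b) *m (rho gen_a *m rho gen_b)).
  by rewrite /bdry commgEl conjgE !repM // !repV.
by rewrite tr_comm ?rep_det // /toric; split => h; lra.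
Qed.

Lemma tr_repJ rho u h : isrep rho -> \tr (rho (u ^ h)%g) = \tr (rho u).
Proof. by move=> rep; rewrite repJ // mxtrace_mulC mulmxA mul_adj2 ?rep_det // mul1mx. Qed.

Lemma toric_morph rho phi c : isrep rho -> toric rho -> morph phi -> phi bdry = (bdry ^ c)%g ->
  toric (rho \o phi).
Proof.
move=> rep tor mp E; have rep' := rep_comp rep mp.
by apply/(toric_bdry rep'); rewrite /= E tr_repJ //; apply/toric_bdry.
Qed.

Lemma toric_moves rho phi : isrep rho -> toric rho -> moves phi -> toric (rho \o phi).
Proof.
by move=> rep tor m; have [c E] := moves_bdry m; exact: toric_morph rep tor (moves_morph m) E.
Qed.

(** Simplicity of the closed geodesic of u, in terms of the crossings of its
  lifts only. *)
Definition simple_in rho u :=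
  [/\ hyp (rho u), forall h, ~ cross (rho u) (rho (u ^ h)%g) & rooted u].

Lemma simple_in_noncross rho u : isrep rho -> simple_in rho u ->
  forall h h', ~ cross (rho (u ^ h)%g) (rho (u ^ h')%g).
Proof.
move=> rep [_ N _] h h' /(proj2 (crossJ rep _ _ h^-1%g)); rewrite conjgK -conjgM; exact: N.
Qed.

Lemma simple_inJ rho u c : isrep rho -> simple_in rho u -> simple_in rho (u ^ c)%g.
Proof.
move=> rep su; have [hu N r] := su; split; first by apply/hypJ.
  by move=> h; rewrite -conjgM; exact: simple_in_noncross.
move=> k ck; have cm : commute u (k ^ c^-1)%g.
  by rewrite /commute -{1 2}(conjgK c u) -(conjMg (u ^ c)) -(conjMg k) ck.
by have := morph_pwr (morph_conj c) (r _ cm); rewrite conjgKV.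
Qed.

Lemma simple_in_comp rho u phi psi : isrep rho -> morph phi -> morph psi ->
  cancel phi psi -> cancel psi phi -> simple_in rho u -> simple_in (rho \o psi) (phi u).
Proof.
move=> rep mp mq k1 k2 [hu N r]; split; first by rewrite /= k1.
  by move=> h; rewrite /= (morphJ _ _ mq) k1; exact: N.
move=> k ck; have cm : commute u (psi k).
  by rewrite /commute -{1 2}(k1 u) -(mq (phi u)) -(mq k) ck.
by have := morph_pwr mp (r _ cm); rewrite k2.
Qed.

Lemma hyp_neq1 rho u : isrep rho -> hyp (rho u) -> u != 1%g.
Proof.
move=> rep; apply: contraTneq => ->; rewrite /hyp rep1 // tr2E !en2.
by rewrite -leNgt; lra.
Qed.

Lemma tight_rigid_rep rho W n : isrep rho -> toric rho -> cyclic_word W n ->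
  simple_in rho (el W n 0) -> tight W n ->
  (forall i, (W i).1 = false -> (W i.+1).1 = true) ->
  (forall i, W i = W 0%N) \/ (forall i, W i.+2 = linv (W i)).
Proof.
move=> rep tor cW su T; have [hu _ _] := su; have N := simple_in_noncross rep su.
apply: (tight_rigid cW T); [exact: (uncrossed_a cW rep tor) | exact: (uncrossed_b cW rep tor)].
Qed.

Lemma tight_of W n : (forall z, z.1 -> forall k, (n <= size (word (twl z (el W n 0) ^ k)%g))%N) ->
  tight W n.
Proof.
move=> H z z1 k; split; first exact: H.
have zV : (linv z).1 by [].
have -> : (twr z (el W n 0) = twl (linv z) (el W n 0) ^ gl (linv z))%g by exact: twrE.
by rewrite -conjgM; exact: H.
Qed.

(** Up to the automorphisms considered, the word follows the boundary of the
  torus: it always turns to the same side. *)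
Definition peripheral u := exists phi W n,
  [/\ moves phi, cyclic_word W n, forall i, W i.+2 = linv (W i) & u = phi (el W n 0)].

Lemma same_type_eq (W : nat -> letter) n i : cyclic_word W n -> (W i).1 = (W i.+1).1 -> W i.+1 = W i.
Proof.
by case=> _ _ red; have := red i; move: (W i) (W i.+1) => [[] []] [[] []].
Qed.

(** A representative of minimal length under the twists is a letter or always
  turns to the same side. If b b occurs in it then a a does not, since the two
  lines would cross, and the rotation of order four exchanges a and b. *)
Lemma simple_classification rho u : isrep rho -> toric rho -> simple_in rho u ->
  (exists2 phi, moves phi & u = phi gen_a) \/ peripheral u.
Proof.
have [N] := ubnP (size (word u)); elim: N rho u => [//|N IH] rho u hN rep tor su.
have [hu _ r] := su.
case: (pselect (exists2 phi, moves phi & (size (word (phi u)) < size (word u))%N)) => [[phi m lt]|min].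
  have [psi [mq k1 k2]] := moves_inv m.
  have [||||[f mf E]|[f [W [n [mf cW tW E]]]]] := IH (rho \o psi) (phi u).
  - by apply: leq_trans lt _; rewrite -ltnS.
  - exact: rep_comp rep (moves_morph mq).
  - exact: toric_moves.
  - exact: simple_in_comp rep (moves_morph m) (moves_morph mq) k1 k2 su.
  - by left; exists (psi \o f); [exact: moves_comp | rewrite /= -E k1].
  - right; exists (psi \o f), W, n; split=> //; first exact: moves_comp.
    by rewrite /= -E k1.
have {}min phi : moves phi -> (size (word u) <= size (word (phi u)))%N.
  by move=> m; rewrite leqNgt; apply/negP => lt; apply: min; exists phi.
have mc k : (size (word u) <= size (word (u ^ k)%g))%N by exact: (min _ (moves_conj k moves_id)).
have [W [n [cW uE nE]]] := el_of (hyp_neq1 rep hu) mc.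
have key rho' W' (psi : F2 -> F2) : isrep rho' -> toric rho' -> cyclic_word W' n -> moves psi ->
   el W' n 0 = psi u -> simple_in rho' (el W' n 0) ->
   (forall i, (W' i).1 = false -> (W' i.+1).1 = true) ->
   (exists2 phi, moves phi & el W' n 0 = phi gen_a) \/ (forall i, W' i.+2 = linv (W' i)).
  move=> rep' tor' cW' mpsi E su' I.
  have T : tight W' n.
    apply: tight_of => z z1 k; rewrite E nE.
    have := min ((id \o (fun v => (v ^ k)%g)) \o (id \o twl z) \o psi); apply.
    apply: moves_comp => //; apply: moves_comp; first exact: (moves_conj k moves_id).
    exact: (moves_twl z1 moves_id).
  have [cst|turn] := tight_rigid_rep rep' tor' cW' su' T I; last by right.
  left; have Ec := el_const n cst; have [_ _ r'] := su'.
  rewrite Ec in r'; have n1 := rooted_glX r'.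
  by rewrite Ec n1 expg1; have [phi m ->] := gl_moves (W' 0%N); exists phi.
case: (pselect (exists i, (W i).1 = false /\ (W i.+1).1 = false)) => [[i [i1 i2]]|noBB].
  have ei := same_type_eq cW (etrans i1 (esym i2)).
  have m3 : moves (id \o quarter \o quarter \o quarter) by do 3 apply: moves_quarter; exact: moves_id.
  have cW' : cyclic_word (fun i => prv (W i)) n.
    by apply: cyclic_word_map cW; [exact: can_inj prvK | exact: prv_linv].
  have E : el (fun i => prv (W i)) n 0 = quarter (quarter (quarter u)).
    by rewrite -[LHS]quarter4 el_prv uE.
  have [||[phi m E2]|turn] := key (rho \o quarter) (fun i => prv (W i)) _
      (rep_comp rep quarter_morph) (toric_quarter rep tor) cW' m3 E.
  - have q4 v : quarter (id (quarter (quarter (quarter v)))) = v by exact: quarter4.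
    rewrite E; apply: (simple_in_comp rep (moves_morph m3) quarter_morph _ _ su) => v /=; exact: quarter4.
  - move=> j j1; apply: contraTT isT => j2.
    have jt : (W j).1 = true by move: j1; case: (W j) => [[] []].
    have jt' : (W j.+1).1 = true by move: j2; case: (W j.+1) => [[] []].
    have ej := same_type_eq cW (etrans jt (esym jt')).
    have hu' : hyp (rho (el W n 0)) by rewrite uE.
    have := cross_el cW rep tor hu' jt ej i1 ei.
    by rewrite (el_pre cW j.+1) (el_pre cW i.+1) uE => /(simple_in_noncross rep su).
  - left; exists (quarter \o phi); first by apply: (moves_comp (moves_quarter moves_id) m).
    by rewrite /= -E2 el_prv uE.
  right; exists quarter, (fun i => prv (W i)), n; split=> //; first exact: (moves_quarter moves_id).
  by rewrite el_prv uE.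
have [||[phi m E2]|turn] := key rho W id rep tor cW moves_id uE.
- by rewrite uE.
- move=> j j1; case j2 : ((W j.+1).1) => //; by case: noBB; exists j.
- by left; exists phi => //; rewrite -uE.
by right; exists id, W, n; split=> //; exact: moves_id.
Qed.

End Rho.
End Classification.

(** * Curves meeting once *)

Section Meeting.
Variable R : realType.
Implicit Types (u v h k c : F2) (x y z : letter) (rho : F2 -> 'M[R]_2) (phi psi : F2 -> F2).

(** All crossings of lifts of v with the axis of u are equivalent under
  translations along this axis: the curves meet in one point. *)
Definition meets rho u v :=
  (exists h, cross (rho u) (rho (v ^ h)%g)) /\
  forall h h', cross (rho u) (rho (v ^ h)%g) -> cross (rho u) (rho (v ^ h')%g) ->
    exists2 m, pwr u m & (v ^ h' = (v ^ h) ^ m)%g.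

Lemma meets_comp rho u v phi psi : morph phi -> morph psi -> cancel phi psi -> cancel psi phi ->
  meets rho u v -> meets (rho \o psi) (phi u) (phi v).
Proof.
move=> mp mq k1 k2 [[h ch] M].
have E h' : (rho \o psi) (phi v ^ h')%g = rho (v ^ psi h')%g by rewrite /= (morphJ _ _ mq) k1.
split; first by exists (phi h); rewrite E /= !k1.
move=> h1 h2; rewrite !E /= k1 => c1 c2; have [m pm hm] := M _ _ c1 c2.
exists (phi m); first exact: morph_pwr.
by have := congr1 phi hm; rewrite !(morphJ _ _ mp) !k2.
Qed.

Lemma meetsJ rho u v c : meets rho u v -> meets rho u (v ^ c)%g.
Proof.
move=> [[h ch] M]; split; first by exists (c^-1 * h)%g; rewrite -conjgM mulVKg.
move=> h1 h2; rewrite -!(conjgM v); exact: M.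
Qed.

(** An occurrence of b b makes the line of the word cross the axis of a. If it
  crossed once more, at a letter a that is not flanked, the two conjugates
  would agree up to a power of a, which the position of that letter forbids.
  *)
Lemma flanked_a rho W n i0 : isrep rho -> toric rho -> cyclic_word W n ->
  simple_in rho (el W n 0) -> meets rho gen_a (el W n 0) -> (W i0).1 = false -> (W i0.+1).1 = false ->
  flanked W true.
Proof.
move=> rep tor cW su [_ M] i1 i2; have [hu _ _] := su.
have ei := same_type_eq cW (etrans i1 (esym i2)).
have noaa j : (W j).1 = true -> (W j.+1).1 = false.
  move=> h; apply: contraTF isT => h'; have ej := same_type_eq cW (etrans h (esym h')).
  have := cross_el cW rep tor hu h ej i1 ei.
  by rewrite (el_pre cW j.+1) (el_pre cW i0.+1) => /(simple_in_noncross rep su).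
have noaa' j : (W j.+1).1 = true -> (W j).1 = false.
  by move=> h; case E: (W j).1 => //; move: (noaa _ E); rewrite h.
have [ha _] := toric_hyp rep tor.
have [S] := toric_schottky rep tor.
have ci : cross (rho gen_a) (rho (el W n i0.+1)).
  rewrite -gl_a -(mulg1 (gl _)) -[(_ * _)%g]/(pw [:: (true, false)]).
  have hy := hyp_el cW rep hu i0.+1; have ry := wd_reduced cW i0.+1.
  move: hy ry; rewrite /el !(wd_cons cW) => hy ry.
  apply: (cross_straight rep S (x := (true, false)) (y := W i0.+1)) => //.
    by rewrite (wd_last cW) ei.
  by rewrite /pw /= mulg1 gl_a.
move=> i hi; have b0 := noaa' _ hi; have b2 := noaa _ hi.
split=> [|_]; first by rewrite b0 b2.
apply/eqP/negPn/negP => ne.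
have [m [e [f [ea ae af]]]] := gen_arcs rep tor S true; rewrite gl_a in ea.
have ta : through_a S f e (true, true) (true, false).
  split=> //;   move: (eigV rep ea); rewrite -gl_a -gl_linv /linv /= => -[_ _ hf _].
  by rewrite hf arc_scv // ?invr_neq0 // (eig_neq0 ea).
have la : line_of (rho gen_a) f e by exists m; right.
have [p [q [j [l1 t1 jE]]]] := through_W cW rep hu S hi.
have cj : cross (rho gen_a) (rho (el W n j)).
  move: t1; rewrite /dir_start /dir_end.
  have sd : forall x y, x.1 = false -> y.1 = false -> x != y -> through_a S p q x y ->
      cross (rho gen_a) (rho (el W n j)).
    move=> [[] []] [[] []] // _ _ _ t1.
      by apply: (cross_lines la l1); apply: (dt4_through rep ta t1).
    by apply/crossCE => //; apply: (cross_lines l1 la); apply: (dt4_through rep t1 ta).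
  case: (W i.+1).2; first exact: sd.
  by apply: sd => //; rewrite eq_sym.
have := M (pre W i0.+1) (pre W j); rewrite -!(el_pre cW) => /(_ ci cj) [c pc cE].
have n1 : c = 1%g.
  apply: (@size_conj_a (W i0.+1) (wtail W n i0.+1)) => //.
  - by rewrite -(wd_cons cW); exact: (wd_reduced cW).
  - by rewrite (wd_last cW).
  by rewrite -(wd_cons cW) -[pw _]/(el W n i0.+1) -cE (word_el cW) !size_wd.
have := congr1 word cE; rewrite n1 conjg1 !(word_el cW) jE.
case: (W i.+1).2.
  rewrite (wd_rcons cW i.+1) (wd_rcons cW i0) => /(congr1 (last (true, true))).
  by rewrite !last_rcons => E; move: hi; rewrite E i1.
by rewrite !(wd_cons cW) => -[E _]; move: hi; rewrite E i2.
Qed.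

(** By twists along a the word is made as short as possible, which keeps a and
  the hypotheses. It is then rigid: neither a power of a, nor a word that
  always turns to the same side, can cross the axis of a. *)
Lemma meets_a_basis rho v : isrep rho -> toric rho -> simple_in rho v -> meets rho gen_a v ->
  exists phi k e, [/\ moves phi, phi gen_a = gen_a & v = (phi (gl (false, e)) ^ k)%g].
Proof.
have [N] := ubnP (size (word v)); elim: N rho v => [//|N IH] rho v hN rep tor su mv.
have [hu _ r] := su.
case: (pselect (exists phi k, [/\ moves phi, phi gen_a = gen_a & (size (word (phi v ^ k)%g) < size (word v))%N])).
  move=> [phi [k [m pa lt]]]; have [psi [mq k1 k2]] := moves_inv m.
  have [mp mq'] := (moves_morph m, moves_morph mq).
  have rep' := rep_comp rep mq'.
  have [|||||f [c [e [mf fa E]]]] := IH (rho \o psi) (phi v ^ k)%g.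
  - by apply: leq_trans lt _; rewrite -ltnS.
  - exact: rep'.
  - exact: toric_moves.
  - apply: (simple_inJ _ rep'); exact: simple_in_comp rep mp mq' k1 k2 su.
  - apply: meetsJ; by have := meets_comp mp mq' k1 k2 mv; rewrite pa.
  exists (psi \o f), (psi (c * k^-1)%g), e; split; first exact: moves_comp.
    by rewrite /= fa -{1}pa k1.
  have := congr1 (fun w => psi (w ^ k^-1)%g) E; rewrite /= conjgK k1 => ->.
  by rewrite -conjgM (morphJ _ _ mq').
move=> nmin; have min phi k : moves phi -> phi gen_a = gen_a -> (size (word v) <= size (word (phi v ^ k)%g))%N.
  by move=> m pa; rewrite leqNgt; apply/negP => lt; apply: nmin; exists phi, k.
have mc k : (size (word v) <= size (word (v ^ k)%g))%N by exact: (min id k moves_id).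
have [W [n [cW uE nE]]] := el_of (hyp_neq1 rep hu) mc.
have [ha _] := toric_hyp rep tor; have [S] := toric_schottky rep tor.
rewrite -uE in su mv hu.
have noturn : ~ forall i, W i.+2 = linv (W i).
  move=> turn; have [[h ch] _] := mv; have hv : hyp (rho gen_a) by [].
  apply: (@peripheral_noncross _ rho rep S W n cW turn (gen_a ^ h^-1)%g hu).
    by apply/hypJ.
  by apply: crossC; apply: (proj1 (crossJ rep _ _ h)); rewrite conjgKV.
have fin : (forall i, W i = W 0%N) -> exists phi k e,
    [/\ moves phi, phi gen_a = gen_a & v = (phi (gl (false, e)) ^ k)%g].
  move=> cst; have Ec := el_const n cst; have [_ _ r'] := su.
  rewrite Ec in r'; have n1 := rooted_glX r'; rewrite Ec n1 expg1 in uE.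
  case E : (W 0%N) => [[] e]; last by exists id, 1%g, e; rewrite conjg1 -uE E; split=> //; exact: moves_id.
  have [[h ch] _] := mv; case: (noncross_a rep tor S (k := h)); move: ch.
  rewrite Ec n1 expg1 E; case: e {E} => [|]; last by rewrite gl_a.
  by rewrite -[(true, true)]/(linv (true, false)) gl_linv gl_a conjVg => /(crossVr rep).
have [Ua Ub] : uncrossed W true /\ uncrossed W false.
  by have N' := simple_in_noncross rep su; split; [exact: (uncrossed_a cW rep tor) | exact: (uncrossed_b cW rep tor)].
case: (pselect (exists i, (W i).1 = false /\ (W i.+1).1 = false)) => [[i [i1 i2]]|noBB].
  have Fa := flanked_a rep tor cW su mv i1 i2.
  have Fb := @flanked_other _ _ cW false Fa Ub.
  by have [[]//|//|/noturn] := flanked_rigid cW.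
have T : tight W n.
  apply: tight_of => z z1 k; rewrite uE nE; apply: (min (id \o twl z)).
    exact: (moves_twl z1 moves_id).
  by rewrite /= twl_a.
have I j : (W j).1 = false -> (W j.+1).1 = true.
  by move=> j1; case j2 : ((W j.+1).1) => //; case: noBB; exists j.
by have [/fin|/noturn] := tight_rigid cW T Ua Ub I.
Qed.

(** After transport to u = a, the conjugates of b that cross the axis of a
  differ by powers of a, which fix a. *)
Lemma meets_basis rho u v phi h : isrep rho -> toric rho -> moves phi -> u = phi gen_a ->
  simple_in rho v -> meets rho u v -> cross (rho u) (rho (v ^ h)%g) ->
  exists psi e, [/\ moves psi, psi gen_a = u & psi (gl (false, e)) = (v ^ h)%g].
Proof.
move=> rep tor m uE sv mv ch; have [phi' [m' k1 k2]] := moves_inv m.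
have [mp mp'] := (moves_morph m, moves_morph m').
have rep1 := rep_comp rep mp; have tor1 := toric_moves rep tor m.
have [||f [k [e [mf fa E]]]] := meets_a_basis rep1 tor1 (v := phi' v).
- exact: simple_in_comp rep mp' mp k2 k1 sv.
- by have := meets_comp mp' mp k2 k1 mv; rewrite uE k1.
have [f' [mf' f1 f2]] := moves_inv mf; have mm := moves_morph mf.
pose c := f' (k * phi' h)%g.
have vE : (v ^ h = phi (f (gl (false, e) ^ c)))%g.
  by rewrite (morphJ _ c mm) f2 conjgM -E -(morphJ _ _ mp') k2.
have rep2 := rep_comp rep1 mm; have tor2 := toric_moves rep1 tor1 mf.
have [S] := toric_schottky rep2 tor2.
have [] : exists2 j, pwr gen_a j & (gen_b ^ c = gen_b ^ j)%g.
  apply: (cross_ab rep2 tor2 S); rewrite /= fa -uE.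
  move: ch; rewrite vE; case: (e); last by rewrite gl_b.
  rewrite -[(false, true)]/(linv (false, false)) gl_linv gl_b conjVg.
  by rewrite (morphV _ mm) (morphV _ mp); exact: (proj1 (crossVr rep _ _)).
move=> j pj cE; exists (phi \o f \o (fun g => (g ^ j)%g)), e; split=> /=.
- exact: (moves_conj _ (moves_comp m mf)).
- by rewrite (pwr_conj pj) fa.
rewrite vE; congr (phi (f _)); case: (e); last by rewrite gl_b.
by rewrite -[(false, true)]/(linv (false, false)) gl_linv gl_b !conjVg cE.
Qed.

End Meeting.

(** * Axes and their angle *)

Section Axes.
Variable R : realType.
Implicit Types (X Y P Q g : 'M[R]_2) (e f p q : R * R) (l m n th s : R).

Definition dg m : 'M[R]_2 := mx2 m 0 0 m^-1.
Definition col0 g : R * R := (g 0 0, g 1 0).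
Definition col1 g : R * R := (g 0 1, g 1 1).

Lemma rot_det th : \det (Defs.rot th) = 1.
Proof. by rewrite /Defs.rot det2E !en2 -[RHS](cos2Dsin2 (th / 2)); ring. Qed.

Lemma det_M g g' : \det g = 1 -> \det g' = 1 -> \det (g *m g') = 1.
Proof. by rewrite det_mulmx => -> ->; rewrite mulr1. Qed.

Lemma adj2M X Y : adj2 (X *m Y) = adj2 Y *m adj2 X.
Proof. by apply: mx2P; rewrite /adj2 !en2; ring. Qed.

Lemma translation_dg X g l : translation_along X g l ->
  exists m, [/\ \det g = 1, 1 < m ^+ 2, m = expR (l / 2) \/ m = - expR (l / 2) & X = g *m dg m *m adj2 g].
Proof.
case=> dg1 l0 h; have E1 : 1 < expR (l / 2) by rewrite expR_gt1 divr_gt0.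
have Td : trans l = dg (expR (l / 2)) by rewrite /trans /dg expRN.
rewrite invmx2 // Td in h; case: h => h; [exists (expR (l / 2)) | exists (- expR (l / 2))].
  by split=> //; [nra | left].
split=> //; [nra | by right |].
by rewrite h; apply: mx2P; rewrite /dg /adj2 !en2 invrN; ring.
Qed.

Lemma dg_translation X g m : \det g = 1 -> 1 < m ^+ 2 -> X = g *m dg m *m adj2 g ->
  translation_along X g (2 * ln `|m|).
Proof.
move=> g1 m1 ->; have m0 : m != 0 by apply: contraTneq m1 => ->; rewrite expr0n /= ltr10.
have n1 : 1 < `|m| by rewrite -(@ltr_pXn2r _ 2) ?nnegrE // expr1n real_normK ?num_real.
split=> //; first by rewrite mulr_gt0 // ln_gt0.
rewrite invmx2 // (_ : trans _ = dg `|m|); last first.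
  by rewrite /trans /dg mulrC mulrA mulVf ?mul1r // expRN lnK // posrE normr_gt0.
have [mp|mn] := ltP 0 m; first by left; rewrite gtr0_norm.
by right; rewrite ler0_norm //; apply: mx2P; rewrite /dg /adj2 !en2 invrN; ring.
Qed.

Lemma dg_eig X g m : \det g = 1 -> eig X m (col0 g) (col1 g) -> X = g *m dg m *m adj2 g.
Proof.
move=> g1 [m1]; rewrite /act /scv /col0 /col1 /= => -[h1 h2] [h3 h4] _.
have -> : g *m dg m = X *m g by apply: mx2P; rewrite /dg !en2 ?h1 ?h2 ?h3 ?h4; ring.
by rewrite -mulmxA mul_adj2 // mulmx1.
Qed.

Lemma eig_scale X m a b e f : a != 0 -> b != 0 -> eig X m e f -> eig X m (scv a e) (scv b f).
Proof.
move=> a0 b0 [m1 he hf d]; split=> //; rewrite ?act_scv ?he ?hf ?scvA; try by congr scv; ring.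
by rewrite dt_scl dt_scr !mulf_neq0.
Qed.

Lemma translation_hyp X g l : translation_along X g l -> \det X = 1 /\ hyp X.
Proof.
move=> /translation_dg[m [g1 m1 _ ->]]; have m0 : m != 0 by apply: contraTneq m1 => ->; rewrite expr0n /= ltr10.
split; first by rewrite !det_mulmx det_adj2 g1 /dg det2E !en2 mul1r mulr1 mulr0 subr0 divff.
rewrite /hyp mxtrace_mulC mulmxA adj2_mul // mul1mx /dg tr2E !en2.
have -> : (m + m^-1) ^+ 2 = 4 + (m - m^-1) ^+ 2 by field.
rewrite ltrDl exprn_even_gt0 //= subr_eq0; apply: contraTneq m1 => h.
by rewrite expr2 {2}h divff // ltxx.
Qed.

(** The frame is the one where the two axes cross at the fixed point of the
  rotations. *)
Lemma frame_comm_cs m n c s : m != 0 -> n != 0 ->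
  comm2 (dg m) (mx2 c s (- s) c *m dg n *m adj2 (mx2 c s (- s) c)) =
  (s * c * (m - m^-1) * (n - n^-1)) *: mx2 0 (-1) 1 0.
Proof. by move=> m0 n0; apply: mx2P; rewrite /comm2 /dg /adj2 !en2; ring. Qed.

Lemma frame_comm m n th : m != 0 -> n != 0 -> comm2 (dg m) (Defs.rot th *m dg n *m adj2 (Defs.rot th)) =
  (sin (th / 2) * cos (th / 2) * (m - m^-1) * (n - n^-1)) *: mx2 0 (-1) 1 0.
Proof. exact: frame_comm_cs. Qed.

Lemma comm2_frame g X Y : \det g = 1 ->
  comm2 (g *m X *m adj2 g) (g *m Y *m adj2 g) = g *m comm2 X Y *m adj2 g.
Proof.
move=> g1; have cc A B : g *m A *m adj2 g *m (g *m B *m adj2 g) = g *m (A *m B) *m adj2 g.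
  by rewrite -!mulmxA (mulmxA (adj2 g)) adj2_mul // mul1mx.
by rewrite /comm2 !cc mulmxBr mulmxBl.
Qed.

Lemma angle_frame X Y th : signed_angle X Y th -> exists g m n,
  [/\ [/\ - pi < th < pi & th != 0], [/\ \det g = 1, 1 < m ^+ 2 & 1 < n ^+ 2],
      X = g *m dg m *m adj2 g & Y = g *m (Defs.rot th *m dg n *m adj2 (Defs.rot th)) *m adj2 g].
Proof.
move=> [h1 h2 [g [l [k [/translation_dg[m [g1 m1 _ ->]] /translation_dg[n [_ n1 _ ->]]]]]]].
by exists g, m, n; split=> //; rewrite adj2M !mulmxA.
Qed.

Lemma half_sin th : - pi < th < pi -> th != 0 -> sin (th / 2) * cos (th / 2) != 0.
Proof.
move=> /andP[h1 h2] t0; have p0 := pi_gt0 R.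
have c0 : 0 < cos (th / 2) by apply: cos_gt0_pihalf; apply/andP; split; lra.
apply: mulf_neq0; last by rewrite gt_eqF.
have [tp|tn] := ltP 0 th; first by rewrite gt_eqF // sin_gt0_pihalf //; apply/andP; split; lra.
rewrite -oppr_eq0 -sinN gt_eqF // sin_gt0_pihalf //; apply/andP; split; last lra.
by have : th < 0 by [rewrite lt_neqAle t0]; lra.
Qed.

Lemma eig_gap_neq0 m : 1 < m ^+ 2 -> m - m^-1 != 0.
Proof.
move=> m1; have m0 : m != 0 by apply: contraTneq m1 => ->; rewrite expr0n /= ltr10.
rewrite subr_eq0; apply: contraTneq m1 => h.
by rewrite expr2 {2}h divff // ltxx.
Qed.

Lemma angle_cross X Y th : signed_angle X Y th -> cross X Y.
Proof.
move=> /angle_frame[g [m [n [[h1 h2] [g1 m1 n1] -> ->]]]].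
have m0 : m != 0 by apply: contraTneq m1 => ->; rewrite expr0n /= ltr10.
have n0 : n != 0 by apply: contraTneq n1 => ->; rewrite expr0n /= ltr10.
rewrite /cross comm2_frame // !det_mulmx det_adj2 g1 mul1r mulr1 frame_comm //.
set k := _ * _ * (n - _); have k0 : k != 0.
  by do 2 (apply: mulf_neq0; last exact: eig_gap_neq0); exact: half_sin.
have -> : \det (k *: mx2 0 (-1) 1 0) = k ^+ 2 by rewrite det2E !en2; ring.
by rewrite exprn_even_gt0.
Qed.

(** The angle read off the traces and off one entry of the commutator, whose
  sign is the direction of the rotation from one axis to the other. *)
Definition theta X Y : R :=
  Num.sg (\tr X * \tr Y * comm2 X Y 1 0) *
  (pi / 2 - atan (Num.sg (\tr X * \tr Y) * (2 * \tr (X *m Y) - \tr X * \tr Y) /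
                  (2 * Num.sqrt (\det (comm2 X Y))))).

(** In the frame of the crossing, twice the trace of the product exceeds the
  product of the traces by a multiple of the cosine of the angle, and the
  commutator is a multiple of its sine. *)
Lemma angle_theta X Y th : signed_angle X Y th -> th = theta X Y.
Proof.
move=> /angle_frame[g [m [n [[h1 h2] [g1 m1 n1] -> ->]]]].
have m0 : m != 0 by apply: contraTneq m1 => ->; rewrite expr0n /= ltr10.
have n0 : n != 0 by apply: contraTneq n1 => ->; rewrite expr0n /= ltr10.
set Y' := Defs.rot th *m _ *m _.
have trc A : \tr (g *m A *m adj2 g) = \tr A.
  by rewrite mxtrace_mulC mulmxA adj2_mul // mul1mx.
rewrite /theta comm2_frame // !trc.
have -> : g *m dg m *m adj2 g *m (g *m Y' *m adj2 g) = g *m (dg m *m Y') *m adj2 g.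
  by rewrite -!mulmxA (mulmxA (adj2 g)) adj2_mul // mul1mx.
rewrite trc {}/Y' frame_comm // !det_mulmx det_adj2 g1 mul1r mulr1.
have trY : \tr (Defs.rot th *m dg n *m adj2 (Defs.rot th)) = n + n^-1.
  by rewrite mxtrace_mulC mulmxA adj2_mul ?rot_det // mul1mx /dg tr2E !en2.
set s := sin (th / 2); set c := cos (th / 2); have cs1 : c ^+ 2 + s ^+ 2 = 1 := cos2Dsin2 _.
have trXY : 2 * \tr (dg m *m (Defs.rot th *m dg n *m adj2 (Defs.rot th))) =
    (m + m^-1) * (n + n^-1) + (c ^+ 2 - s ^+ 2) * (m - m^-1) * (n - n^-1).
  rewrite tr2E /dg /Defs.rot /adj2 !en2 -/s -/c.
  rewrite (_ : (m + m^-1) * (n + n^-1) = (c ^+ 2 + s ^+ 2) * (m + m^-1) * (n + n^-1)); last by rewrite cs1 mul1r.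
  by ring.
have thc : cos th = c ^+ 2 - s ^+ 2.
  have -> : th = (th / 2) *+ 2 by rewrite -mulr_natr divfK.
  by rewrite cos_mulr2n -/c; lra.
have ths : sin th = 2 * (s * c).
  have -> : th = (th / 2) *+ 2 by rewrite -mulr_natr divfK.
  by rewrite sin_mulr2n -/c -/s -mulr_natl; ring.
have sc0 : s * c != 0 by exact: half_sin.
have trX : \tr (dg m) = m + m^-1 by rewrite tr2E /dg !en2.
rewrite trY trXY trX.
set p := m - m^-1; set q := n - n^-1; set T := (m + m^-1) * (n + n^-1).
have p0 : p != 0 := eig_gap_neq0 m1; have q0 : q != 0 := eig_gap_neq0 n1.
have Tpq : 0 < T * (p * q).
  have gap (k : R) : 1 < k ^+ 2 -> k != 0 -> 0 < (k + k^-1) * (k - k^-1).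
    move=> k1 k0; have -> : (k + k^-1) * (k - k^-1) = (k ^+ 2 - 1) * (1 + (k^-1) ^+ 2) by field.
    by rewrite mulr_gt0 ?subr_gt0 // ltr_wpDr ?sqr_ge0.
  by have := mulr_gt0 (gap _ m1 m0) (gap _ n1 n0); rewrite /T /p /q; congr (_ < _); ring.
have T0 : T != 0 by apply: contraTneq Tpq => ->; rewrite mul0r ltxx.
have sgT : Num.sg T * (p * q) = `|p * q|.
  apply: (mulfI (x := `|T|)); first by rewrite normr_eq0.
  by rewrite -normrM gtr0_norm // [in RHS](numEsg T); ring.
have -> : T * (g *m ((s * c * p * q) *: mx2 0 (-1) 1 0) *m adj2 g) 1 0 =
    (T * (p * q) * (g 1 0 ^+ 2 + g 1 1 ^+ 2)) * (s * c).
  by rewrite /adj2 !en2; ring.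
have r0 : 0 < g 1 0 ^+ 2 + g 1 1 ^+ 2.
  have d0 := g1; rewrite det2E in d0.
  have [g0|g0] := eqVneq (g 1 0) 0; last by rewrite ltr_pwDl ?sqr_ge0 // exprn_even_gt0.
  rewrite ltr_wpDl ?sqr_ge0 // exprn_even_gt0 //=; apply: contra_eqN g1 => /eqP h.
  by rewrite det2E g0 h !mulr0 subr0 eq_sym oner_eq0.
rewrite sgrM (gtr0_sg (mulr_gt0 Tpq r0)) mul1r.
have -> : \det ((s * c * p * q) *: mx2 0 (-1) 1 0) = (s * c * p * q) ^+ 2.
  by rewrite det2E !en2; ring.
rewrite sqrtr_sqr [T + _]addrC addrK -thc -!(mulrA (s * c)) normrM.
have -> : Num.sg T * (cos th * p * q) = cos th * `|p * q| by rewrite -sgT; ring.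
have np0 : `|p * q| != 0 by rewrite normr_eq0 mulf_neq0.
have -> : cos th * `|p * q| / (2 * (`|s * c| * `|p * q|)) = cos th / `|sin th|.
  have -> : `|sin th| = 2 * `|s * c| by rewrite ths normrM ger0_norm.
  have : `|s * c| != 0 by rewrite normr_eq0.
  by move: `|s * c| `|p * q| np0 => u v v0 u0; field; rewrite u0 v0.
have key (x : R) : 0 < x < pi -> x = pi / 2 - atan (cos x / sin x).
  move=> /andP[x0 xp]; have sx : 0 < sin x by apply: sin_gt0_pi; rewrite x0.
  have -> : cos x / sin x = tan (pi / 2 - x).
    rewrite /tan sinB cosB sin_pihalf cos_pihalf; congr (_ / _); ring.
  by rewrite tanK ?in_itv /=; [ring | apply/andP; split; lra].
have [h3 h4] := andP h1.
have [tp|tn] := ltP 0 th.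
  have sp : 0 < sin th by apply: sin_gt0_pi; rewrite tp.
  have scp : 0 < s * c by rewrite -(pmulr_rgt0 _ (ltr0n R 2)) -ths.
  by rewrite (gtr0_norm sp) (gtr0_sg scp) mul1r; apply: key; rewrite tp.
have {}tn : th < 0 by rewrite lt_neqAle h2.
have tn' : 0 < - th < pi by apply/andP; split; lra.
have sp : 0 < sin (- th) by apply: sin_gt0_pi.
have scp : s * c < 0 by move: sp; rewrite sinN ths; lra.
have := key _ tn'; rewrite cosN (ltr0_sg scp) ltr0_norm; last by move: sp; rewrite sinN; lra.
by rewrite sinN mulN1r => <-; rewrite opprK.
Qed.

End Axes.

(** * Points of the hyperbolic plane *)

Section Points.
Variable R : realType.
Implicit Types (X Y P Q g : 'M[R]_2) (e f p q : R * R) (l m n th s : R) (z : R[i]).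
Local Open Scope complex_scope.

(** The eigenvectors of X are rescaled until those of Y become orthogonal; the
  angle is then that of an orthogonal frame. *)
Lemma cross_angle X Y : \det X = 1 -> \det Y = 1 -> hyp X -> hyp Y -> cross X Y ->
  exists th, signed_angle X Y th.
Proof.
move=> dX dY hX hY hc.
have [m [e [f ee]]] := eig_exists dX hX; have [n [p [q epq]]] := eig_exists dY hY.
move: hc; rewrite (cross_eig ee epq) => hc.
have [m1 _ _ d0] := ee; have [n1 _ _ _] := epq.
have [a aE] : exists a, a = dt p f by exists (dt p f).
have [b bE] : exists b, b = dt e p by exists (dt e p).
have [c cE] : exists c, c = dt q f by exists (dt q f).
have [d dE] : exists d, d = dt e q by exists (dt e q).
have [D DE] : exists D, D = dt e f by exists (dt e f).
have {hc} abcd : a * c * (b * d) < 0.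
  by move: hc; rewrite aE bE cE dE (dtC f p) (dtC f q); congr (_ < _); ring.
have bd0 : b * d != 0 by apply: contraTneq abcd => ->; rewrite mulr0 ltxx.
have [b0 dd0] : b != 0 /\ d != 0 by move: bd0; rewrite mulf_eq0 negb_or => /andP[].
have ac0 : a * c != 0 by apply: contraTneq abcd => ->; rewrite mul0r ltxx.
have [a0 c0] : a != 0 /\ c != 0 by move: ac0; rewrite mulf_eq0 negb_or => /andP[].
(* rescaling e and f until the axis of Y makes right angles at the crossing *)
have D0 : D != 0 by rewrite DE.
pose K := - (a * c) / (b * d * D ^+ 2); have K0 : 0 < K.
  have bb : 0 < (b * d * D) ^+ 2 by rewrite exprn_even_gt0 // mulf_neq0.
  rewrite -(pmulr_lgt0 _ bb); have -> : K * (b * d * D) ^+ 2 = - (a * c * (b * d)).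
    by rewrite /K; field; rewrite ?b0 ?dd0 ?D0.
  by rewrite oppr_gt0.
pose k := Num.sqrt (Num.sqrt K).
have k0 : 0 < k by rewrite !sqrtr_gt0.
have k4 : (k ^+ 2) ^+ 2 = K by rewrite sqr_sqrtr ?sqrtr_ge0 // sqr_sqrtr // ltW.
have kn0 : k != 0 by rewrite gt_eqF.
pose e1 := scv k e; pose f1 := scv (k * D)^-1 f.
have ee1 : eig X m e1 f1 by apply: eig_scale => //; rewrite invr_neq0 // mulf_neq0.
have d1 : dt e1 f1 = 1 by rewrite dt_scl dt_scr -DE mulrA invfM mulrA divff // mul1r mulVf.
pose g := mx2 e1.1 f1.1 e1.2 f1.2.
have g1 : \det g = 1 by rewrite det2E /g !en2 -d1 /dt; ring.
pose u := - (k ^+ 2 * D * b / a); pose th := 2 * atan u.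
have u0 : u != 0 by rewrite oppr_eq0 !mulf_neq0 ?invr_neq0 // expf_neq0.
have uE : u = (k ^+ 2 * D)^-1 * c / d.
  have h : (k ^+ 2) ^+ 2 * (b * d * D ^+ 2) = - (a * c) by rewrite k4 /K divfK // !mulf_neq0 // expf_neq0.
  have kk : k ^+ 2 != 0 by rewrite expf_neq0.
  rewrite /u; move: (k ^+ 2) kk h => k2 k20 h.
  have X0 : a * (k2 * D * d) != 0 by rewrite !mulf_neq0.
  apply: (mulIf X0).
  have -> : - (k2 * D * b / a) * (a * (k2 * D * d)) = - (k2 ^+ 2 * (b * d * D ^+ 2)) by field; rewrite a0.
  by rewrite h opprK; field; rewrite ?k20 ?D0 ?dd0.
have c1 : 0 < cos (th / 2).
  rewrite /th mulrC mulKf ?pnatr_eq0 // cos_gt0_pihalf //.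
  by apply/andP; split; [exact: atan_gtNpi2 | exact: atan_ltpi2].
have s1 : sin (th / 2) = u * cos (th / 2).
  rewrite /th mulrC mulKf ?pnatr_eq0 // -{2}(atanK u) /tan divfK //.
  by move: c1; rewrite /th mulrC mulKf ?pnatr_eq0 // => /gt_eqF ->.
have cn0 : cos (th / 2) != 0 by rewrite gt_eqF.
exists th; split.
- have := atan_gtNpi2 u; have := atan_ltpi2 u; rewrite /th => h1 h2.
  by apply/andP; split; lra.
- rewrite /th mulf_neq0 ?pnatr_eq0 //; apply: contraNneq u0 => h.
  by rewrite -(atanK u) h tan0.
exists g, (2 * ln `|m|), (2 * ln `|n|); split.
  apply: dg_translation => //; apply: dg_eig => //.
  by rewrite /col0 /col1 /g !en2 -!surjective_pairing.
apply: dg_translation => //; first by rewrite det_M ?rot_det.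
apply: dg_eig; first by rewrite det_M ?rot_det.
have pE : p = ((a * e.1 + b * f.1) / D, (a * e.2 + b * f.2) / D).
  rewrite [LHS]surjective_pairing; congr pair; apply: (mulIf D0); rewrite divfK // aE bE DE /dt; ring.
have qE : q = ((c * e.1 + d * f.1) / D, (c * e.2 + d * f.2) / D).
  rewrite [LHS]surjective_pairing; congr pair; apply: (mulIf D0); rewrite divfK // cE dE DE /dt; ring.
have -> : col0 (g *m Defs.rot th) = scv (cos (th / 2) * k * D / a) p.
  rewrite /col0 /g /Defs.rot !en2 s1 /u /e1 /f1 pE /scv /=; congr pair;
  by move: (cos _) => t; field; rewrite ?kn0 ?D0 ?a0 ?dd0.
have -> : col1 (g *m Defs.rot th) = scv (cos (th / 2) / (k * d)) q.
  rewrite /col1 /g /Defs.rot !en2 s1 uE /e1 /f1 qE /scv /=; congr pair;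
  by move: (cos _) => t; field; rewrite ?kn0 ?D0 ?a0 ?dd0.
by apply: eig_scale => //; rewrite ?mulf_neq0 ?invr_neq0 // mulf_neq0.
Qed.

(** Every point of the upper half-plane is the image of i under a matrix of
  determinant 1, in which form denominators do not vanish. *)
Lemma mob_den Q : \det Q = 1 -> (Q 1 0)%:C * 'i + (Q 1 1)%:C != 0 :> R[i].
Proof.
rewrite det2E => d; apply/negP; rewrite eq_complex /= => /andP[/eqP h1 /eqP h2].
have e1 : Q 1 0 = 0 by lra.
have e2 : Q 1 1 = 0 by lra.
by move: d; rewrite e1 e2; lra.
Qed.

Lemma mobM P Q : \det Q = 1 -> mobius P (mobius Q 'i) = mobius (P *m Q) 'i.
Proof.
move=> /mob_den d; rewrite /mobius !en2.
move: d; set N := (Q 0 0)%:C * 'i + _; set D := (Q 1 0)%:C * 'i + _ => d.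
have -> : ((P 0 0 * Q 0 0 + P 0 1 * Q 1 0)%:C * 'i + (P 0 0 * Q 0 1 + P 0 1 * Q 1 1)%:C) =
   (P 0 0)%:C * N + (P 0 1)%:C * D by rewrite /N /D !rmorphD !rmorphM /=; ring.
have -> : ((P 1 0 * Q 0 0 + P 1 1 * Q 1 0)%:C * 'i + (P 1 0 * Q 0 1 + P 1 1 * Q 1 1)%:C) =
   (P 1 0)%:C * N + (P 1 1)%:C * D by rewrite /N /D !rmorphD !rmorphM /=; ring.
have e x y : x * N + y * D = (x * (N / D) + y) * D by rewrite mulrDl -mulrA divfK.
by rewrite !e invfM mulrACA divff // mulr1.
Qed.

Lemma mob1 : mobius 1%:M 'i = 'i :> R[i].
Proof. by rewrite /mobius !en2 !rmorph0 !rmorph1 mul1r addr0 mul0r add0r divr1. Qed.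

Lemma mob_rot th : mobius (Defs.rot th) 'i = 'i :> R[i].
Proof.
have d := mob_den (rot_det th); apply: (mulIf d); rewrite /mobius divfK // /Defs.rot !en2.
by apply/eqP; rewrite eq_complex /=; apply/andP; split; apply/eqP; ring.
Qed.

Lemma mob_fix Q : \det Q = 1 -> mobius Q 'i = 'i -> Q = mx2 (Q 0 0) (Q 0 1) (- Q 0 1) (Q 0 0).
Proof.
move=> d h; have := congr1 (fun z => z * ((Q 1 0)%:C * 'i + (Q 1 1)%:C)) h.
rewrite /mobius divfK; last exact: mob_den.
move/eqP; rewrite eq_complex /= => /andP[/eqP h1 /eqP h2].
by apply: mx2P; rewrite !en2 //; lra.
Qed.

Lemma trans_det s : \det (trans s) = 1 :> R.
Proof. by rewrite /trans det2E !en2 mulr0 subr0 -expRD subrr expR0. Qed.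

Lemma trans0 : trans 0 = 1%:M :> 'M[R]_2.
Proof. by apply: mx2P; rewrite /trans !en2 ?mul0r ?oppr0 ?expR0. Qed.

Lemma translation_conj P X g l : \det P = 1 -> translation_along X g l ->
  translation_along (P *m X *m adj2 P) (P *m g) l.
Proof.
move=> P1 [g1 l0 h]; have Pg := det_M P1 g1; split=> //.
rewrite !invmx2 // in h *; rewrite adj2M.
by case: h => ->; [left | right]; rewrite ?mulmxN ?mulNmx !mulmxA.
Qed.

Lemma axis_conj P X z : \det P = 1 -> axis X z -> axis (P *m X *m adj2 P) (mobius P z).
Proof.
move=> P1 [g [l [s [tr ->]]]]; have [g1 _ _] := tr; exists (P *m g), l, s.
split; first exact: translation_conj.
by rewrite mobM ?mulmxA // det_M // trans_det.
Qed.

Lemma angle_conj P X Y th : \det P = 1 -> signed_angle X Y th ->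
  signed_angle (P *m X *m adj2 P) (P *m Y *m adj2 P) th.
Proof.
move=> P1 [h1 h2 [g [l [m [t1 t2]]]]]; split=> //; exists (P *m g), l, m.
by split; [| rewrite -(mulmxA P g)]; exact: translation_conj.
Qed.

Lemma cross_point X Y : \det X = 1 -> \det Y = 1 -> hyp X -> hyp Y -> cross X Y ->
  exists2 z, axis X z & axis Y z.
Proof.
move=> dX dY hX hY hc; have [th [_ _ [g [l [m [t1 t2]]]]]] := cross_angle dX dY hX hY hc.
exists (mobius g 'i).
  by exists g, l, 0; rewrite trans0 mulmx1.
by exists (g *m Defs.rot th), m, 0; rewrite trans0 mulmx1 -mobM ?rot_det // mob_rot.
Qed.

Lemma axis_frame X z : axis X z -> exists g m,
  [/\ \det g = 1, 1 < m ^+ 2, X = g *m dg m *m adj2 g & z = mobius g 'i].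
Proof.
move=> [g [l [s [/translation_dg[m [g1 m1 _ XE]] zE]]]]; exists (g *m trans s), m.
have m0 : m != 0 by apply: contraTneq m1 => ->; rewrite expr0n /= ltr10.
split=> //; first by rewrite det_M ?trans_det.
rewrite adj2M XE -!mulmxA; congr (g *m _); rewrite !mulmxA; congr (_ *m adj2 g).
apply: mx2P; rewrite /trans /dg /adj2 !en2 ?expRN;
  move: (expR _) (lt0r_neq0 (expR_gt0 (s / 2))) => E E0; by field; rewrite ?m0 ?E0.
Qed.

(** In the frame of one axis at the common point, the other axis is obtained
  by a rotation. *)
Lemma common_point X Y z : axis X z -> axis Y z -> cross X Y \/ X *m Y = Y *m X.
Proof.
move=> /axis_frame[g [m [g1 m1 -> ->]]] /axis_frame[g' [n [g1' n1 -> E]]].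
have m0 : m != 0 by apply: contraTneq m1 => ->; rewrite expr0n /= ltr10.
have n0 : n != 0 by apply: contraTneq n1 => ->; rewrite expr0n /= ltr10.
have gV : \det (adj2 g) = 1 by rewrite det_adj2.
pose Q := adj2 g *m g'; have Q1 : \det Q = 1 by rewrite det_M.
have g'E : g' = g *m Q by rewrite mulmxA mul_adj2 // mul1mx.
have Qi : mobius Q 'i = 'i by rewrite /Q -mobM // -E mobM // adj2_mul // mob1.
have QE := mob_fix Q1 Qi; have := frame_comm_cs (Q 0 0) (Q 0 1) m0 n0; rewrite -QE => fc.
have -> : g' *m dg n *m adj2 g' = g *m (Q *m dg n *m adj2 Q) *m adj2 g by rewrite g'E adj2M !mulmxA.
have cE := comm2_frame (dg m) (Q *m dg n *m adj2 Q) g1.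
have [sc|sc] := eqVneq (Q 0 1 * Q 0 0) 0; [right | left].
  apply/eqP; rewrite -subr_eq0 -/(comm2 _ _) cE fc sc !mul0r scale0r mulmx0 mul0mx //.
rewrite /cross cE !det_mulmx det_adj2 g1 mul1r mulr1 fc.
set k := _ * _ * (n - _); have k0 : k != 0.
  by do 2 (apply: mulf_neq0; last exact: eig_gap_neq0).
have -> : \det (k *: mx2 0 (-1) 1 0) = k ^+ 2 by rewrite det2E !en2; ring.
by rewrite exprn_even_gt0.
Qed.

End Points.

(** * Simple geodesics and their representations *)

Section RepAxes.
Variable R : realType.
Implicit Types (rho : F2 -> 'M[R]_2) (u v h k c : F2) (z : R[i]) (X : 'M[R]_2) (phi psi : F2 -> F2).

Lemma adj2K X : adj2 (adj2 X) = X.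
Proof. by apply: mx2P; rewrite /adj2 !en2 ?opprK. Qed.

Lemma repJV rho u h : isrep rho -> rho (u ^ h)%g = rho h^-1%g *m rho u *m adj2 (rho h^-1%g).
Proof. by move=> rep; rewrite repJ // repV // adj2K. Qed.

Definition inH z := exists2 Q : 'M[R]_2, \det Q = 1 & z = mobius Q 'i.

Lemma axis_inH X z : axis X z -> inH z.
Proof. by case/axis_frame => g [m [g1 _ _ ->]]; exists g. Qed.

Lemma mob_rep rho h k z : isrep rho -> inH z ->
  mobius (rho h) (mobius (rho k) z) = mobius (rho (h * k)%g) z.
Proof.
move=> rep [Q Q1 ->]; have kQ := det_M (rep_det rep k) Q1.
by rewrite (repM rep) (mobM _ Q1) (mobM _ kQ) (mobM _ Q1) mulmxA.
Qed.

Lemma mob_rep1 rho z : isrep rho -> mobius (rho 1%g) z = z.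
Proof. by move=> rep; rewrite rep1 // /mobius !en2 !rmorph0 !rmorph1 mul1r addr0 mul0r add0r divr1. Qed.

Lemma axis_rep rho u h z : isrep rho -> axis (rho u) z -> axis (rho (u ^ h)%g) (mobius (rho h^-1%g) z).
Proof. by move=> rep ax; rewrite repJV //; apply: axis_conj; rewrite ?rep_det. Qed.

Lemma axis_repV rho u h z : isrep rho -> axis (rho (u ^ h)%g) z -> axis (rho u) (mobius (rho h) z).
Proof. by move=> rep /(axis_rep h^-1%g rep); rewrite conjgK invgK. Qed.

Lemma angle_rep rho u v c th : isrep rho -> signed_angle (rho u) (rho v) th ->
  signed_angle (rho (u ^ c)%g) (rho (v ^ c)%g) th.
Proof. by move=> rep; rewrite !repJV //; apply: angle_conj; rewrite rep_det. Qed.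

Lemma axis_hyp rho u : axis (rho u) !=set0 -> hyp (rho u).
Proof. by case=> z [g [l [s [/translation_hyp[]]]]]. Qed.

Definition simple_axis rho u :=
  forall h z, axis (rho u) z -> axis (rho u) (mobius (rho h) z) -> pwr u h.

(** If the axis of u crossed its translate by h, or if u commuted with h, then h
  would map a point of the axis to a point of the axis. *)
Lemma simple_axis_in rho u : isrep rho -> axis (rho u) !=set0 -> simple_axis rho u -> simple_in rho u.
Proof.
move=> rep ne su; have hu := axis_hyp ne; split=> //.
  move=> h hc; have [|z z1 z2] := cross_point (rep_det rep _) (rep_det rep _) hu _ hc.
    by apply/hypJ.
  have ph := su h z z1 (axis_repV rep z2).
  by move: hc; rewrite (pwr_conj ph); exact: not_cross_self.
move=> k ck; have [z hz] := ne; apply: (su k z hz).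
have := axis_rep k^-1%g rep hz; rewrite invgK (_ : (u ^ k^-1 = u)%g) //.
by apply/conjg_fixP/commgP/commuteV.
Qed.

(** A common point determines the lifts up to the stabilizers of the two axes,
  which are the cyclic groups of u and v. *)
Lemma meets_unique rho u v z0 : isrep rho -> simple_axis rho u -> simple_axis rho v ->
  hyp (rho u) -> hyp (rho v) ->
  (forall x, (exists h, axis (rho (u ^ h)%g) x) -> (exists h, axis (rho (v ^ h)%g) x) ->
     exists k, x = mobius (rho k) z0) -> inH z0 ->
  forall h h', cross (rho u) (rho (v ^ h)%g) -> cross (rho u) (rho (v ^ h')%g) ->
    exists2 m, pwr u m & (v ^ h' = (v ^ h) ^ m)%g.
Proof.
move=> rep su sv hu hv U z0H h h' c1 c2.
have pt k : cross (rho u) (rho (v ^ k)%g) -> exists x q, [/\ axis (rho u) x, axis (rho (v ^ k)%g) x & x = mobius (rho q) z0].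
  move=> hc; have [|x x1 x2] := cross_point (rep_det rep _) (rep_det rep _) hu _ hc; first by apply/hypJ.
  have [||q xq] := U x; [by exists 1%g; rewrite conjg1 | by exists k | by exists x, q].
have [x [q [x1 x2 xE]]] := pt _ c1; have [y [q' [y1 y2 yE]]] := pt _ c2.
pose k := (q' * q^-1)%g.
have xy : y = mobius (rho k) x by rewrite xE yE mob_rep // /k mulgVK.
have pk : pwr u k by apply: (su k x) => //; rewrite -xy.
exists k^-1%g; first exact: pwr_inv.
have yH := axis_inH y1.
have a1 : axis (rho ((v ^ h) ^ k^-1)%g) y by rewrite xy -{2}(invgK k); exact: axis_rep.
rewrite -conjgM in a1 *; set g := (h * k^-1)%g in a1 *.
have pv : pwr v (h' * g^-1)%g.
  apply: (sv _ _ (axis_repV rep a1)); rewrite mob_rep // mulgVK.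
  exact: axis_repV.
by rewrite -{1}(mulgVK g h') conjgM (pwr_conj pv).
Qed.

(** A common point of two translates of the axis is a crossing, which is
  excluded, or makes them equal. *)
Lemma simple_axis_moves rho phi : isrep rho -> toric rho -> moves phi -> simple_axis rho (phi gen_a).
Proof.
move=> rep tor m h z z1 z2; have [psi [mq k1 k2]] := moves_inv m.
have mp := moves_morph m; have rep' := rep_comp rep mp; have tor' := toric_moves rep tor m.
have [S] := toric_schottky rep' tor'.
have z3 : axis (rho (phi gen_a ^ h^-1)%g) (mobius (rho h) z) by rewrite -{2}(invgK h); exact: axis_rep.
have hE : (phi gen_a ^ h^-1 = phi (gen_a ^ psi h^-1))%g by rewrite (morphJ _ _ mp) k2.
have [hc|hc] := common_point z2 z3; rewrite hE in hc.
  by case: (noncross_a rep' tor' S hc).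
have := pwr_inv (morph_pwr mp (commute_a rep' tor' S hc)).
by rewrite k2 invgK.
Qed.

End RepAxes.

Section TeichPoint.
Variables (R : realType) (l : R).
Implicit Types (X : teich l) (u v h c : F2) (phi : F2 -> F2).

Lemma teich_rep X : isrep X. Proof. by split; [exact: hol_det | exact: holM]. Qed.

(** 2 + 2 cosh (l / 2), the value of 2 - tr [A, B] for the boundary length l.
  *)
Definition bconst : R := 2 + expR (l / 2) + expR (- (l / 2)).

Lemma det_comm_bdry (rho : F2 -> 'M[R]_2) : isrep rho ->
  \det (comm2 (rho gen_a) (rho gen_b)) = 2 - \tr (rho bdry).
Proof.
move=> rep; have -> : rho bdry = adj2 (rho gen_a) *m (adj2 (rho gen_b) *m (rho gen_a *m rho gen_b)).
  by rewrite /bdry commgEl conjgE !repM // !repV.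
by rewrite tr_comm ?rep_det //; ring.
Qed.

(** The boundary length determines the trace up to sign, and the crossing of
  the axes of a and b determines the sign. *)
Lemma teich_comm X : 4 < bconst /\ \det (comm2 (X gen_a) (X gen_b)) = bconst.
Proof.
have rep := teich_rep X; have E := det_comm_bdry rep.
have [th _ /angle_cross] := hol_marking X; rewrite /cross E => c0.
have [g tg] := hol_bdry X; have [_ l0 _] := tg.
have [m [g1 m1 mE bE]] := translation_dg tg.
have tE : \tr (X bdry) = m + m^-1.
  by rewrite bE mxtrace_mulC mulmxA adj2_mul // mul1mx /dg tr2E !en2.
have E1 : 1 < expR (l / 2) by rewrite expR_gt1 divr_gt0.
have E2 : 2 < expR (l / 2) + expR (- (l / 2)).
  rewrite expRN; have e0 := lt0r_neq0 (expR_gt0 (l / 2)).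
  rewrite -subr_gt0; have -> : expR (l / 2) + (expR (l / 2))^-1 - 2 = (expR (l / 2) - 1) ^+ 2 / expR (l / 2).
    by move: (expR _) e0 => x x0; field.
  by rewrite divr_gt0 ?expR_gt0 // exprn_even_gt0 //= subr_eq0 gt_eqF.
split; first by rewrite /bconst; lra.
rewrite tE in c0 *; case: mE => mE; rewrite mE ?invrN -expRN in c0 *; rewrite /bconst; lra.
Qed.

Lemma teich_toric X : toric X.
Proof. by have [h1 h2] := teich_comm X; rewrite /toric h2. Qed.

Lemma bconst_morph X phi c : morph phi -> phi bdry = (bdry ^ c)%g ->
  \det (comm2 (X (phi gen_a)) (X (phi gen_b))) = bconst.
Proof.
move=> mp E; have rep := teich_rep X; have [_ <-] := teich_comm X.
by rewrite (det_comm_bdry rep) (det_comm_bdry (rep_comp rep mp)) /= E tr_repJ.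
Qed.

Lemma simple_geodesic_in X u : simple_geodesic X u -> simple_axis X u /\ simple_in X u.
Proof. by move=> [ne su]; split=> //; apply: simple_axis_in ne su; exact: teich_rep. Qed.

Lemma meet_once_meets X u v h : simple_axis X u -> simple_axis X v -> hyp (X u) -> hyp (X v) ->
  meet_once X u v -> cross (X u) (X (v ^ h)%g) -> meets X u v.
Proof.
move=> su sv hu hv [z E] hc; split; first by exists h.
have rep := teich_rep X.
apply: (meets_unique rep su sv hu hv (z0 := z)).
  move=> x [g1 x1] [g2 x2].
  have : (lifts X u `&` lifts X v) x by split; [exists g1 | exists g2].
  by rewrite E => -[k _ <-]; exists k.
have : (lifts X u `&` lifts X v) z by rewrite E; exists 1%g => //; exact: mob_rep1.
by case=> [[k _ /axis_inH]].
Qed.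

(** All pairs of crossing lifts are conjugate, so their angles agree. *)
Lemma vee_theta X u v h : hyp (X u) -> hyp (X v) -> meets X u v -> cross (X u) (X (v ^ h)%g) ->
  vee u v X = theta (X u) (X (v ^ h)%g).
Proof.
move=> hu hv [_ M] hc; have rep := teich_rep X.
have [|th hth] := cross_angle (rep_det rep _) (rep_det rep _) hu _ hc; first by apply/hypJ.
have : [set th | exists h, signed_angle (X u) (X (v ^ h)%g) th] (vee u v X).
  by apply: (xgetPex 0); exists th, h.
move=> [h' ha]; have [m pm E] := M _ _ hc (angle_cross ha).
have := angle_rep m^-1%g rep ha; rewrite E conjgK (pwr_conj (pwr_inv pm)).
exact: angle_theta.
Qed.

Lemma vee_pos_cross X u v : 0 < vee u v X -> exists h, cross (X u) (X (v ^ h)%g).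
Proof.
move=> v0; case: (pselect (exists th h, signed_angle (X u) (X (v ^ h)%g) th)).
  by move=> [th [h /angle_cross hc]]; exists h.
move=> N; move: v0; rewrite /vee xgetPN ?ltxx // => th [h hh]; by apply: N; exists th, h.
Qed.

Lemma vee_conj X u v c : vee (u ^ c)%g (v ^ c)%g X = vee u v X.
Proof.
have rep := teich_rep X; rewrite /vee; congr (xget 0 _); apply/seteqP; split=> th /= [h hh].
  have := angle_rep c^-1%g rep hh; rewrite conjgK -!conjgM => h'; by exists (c * (h * c^-1))%g.
exists (c^-1 * (h * c))%g; rewrite -conjgM mulVKg conjgM; exact: angle_rep.
Qed.

End TeichPoint.

(** * Automorphisms preserving the boundary *)

Section Automorphisms.
Variable R : realType.
Implicit Types (rho : F2 -> 'M[R]_2) (u v h k c : F2) (phi psi f g : F2 -> F2).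

Lemma toric_cross rho : toric rho -> cross (rho gen_a) (rho gen_b).
Proof. by rewrite /toric /cross; apply: lt_trans; rewrite ltr0n. Qed.

Lemma pwr_mulV u j k : pwr u j -> pwr u k -> pwr u (j^-1 * k)%g.
Proof.
move=> pj pk; have mull n m : pwr u m -> pwr u (u ^+ n * m)%g.
  by move=> pm; elim: n => [|n IH]; rewrite ?expg0 ?mul1g // expgS -mulgA; exact: pwr_mull.
have mulV n m : pwr u m -> pwr u (u ^- n * m)%g.
  move=> pm; rewrite -expVgn; elim: n => [|n IH]; rewrite ?expg0 ?mul1g // expgS -mulgA.
  exact: pwr_mullV.
by case: pj => n [->|->]; rewrite ?invgK; [exact: mulV | exact: mull].
Qed.

Lemma simple_in_a rho : isrep rho -> toric rho -> simple_in rho gen_a.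
Proof.
move=> rep tor; have [S] := toric_schottky rep tor; split.
- by have [] := toric_hyp rep tor.
- by move=> h; exact: (noncross_a rep tor S).
move=> k ck; apply: (commute_a rep tor S).
by have -> : (gen_a ^ k = gen_a)%g by apply/conjg_fixP/commgP.
Qed.

Lemma simple_in_b rho : isrep rho -> toric rho -> simple_in rho gen_b.
Proof.
move=> rep tor; have mq := quarter_morph.
have q3 : morph (quarter \o quarter \o quarter) by do 2 apply: morph_comp => //.
have k1 : cancel quarter (quarter \o quarter \o quarter) by move=> u; exact: quarter4.
have k2 : cancel (quarter \o quarter \o quarter) quarter by move=> u; exact: quarter4.
have := simple_in_comp (rep_comp rep mq) mq q3 k1 k2 (simple_in_a (rep_comp rep mq) (toric_quarter rep tor)).
have -> : quarter gen_a = gen_b by apply/val_inj.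
by congr simple_in; apply/funext => u /=; rewrite quarter4.
Qed.

Lemma meets_ab rho : isrep rho -> toric rho -> meets rho gen_a gen_b.
Proof.
move=> rep tor; have [S] := toric_schottky rep tor; split.
  by exists 1%g; rewrite conjg1; exact: toric_cross.
move=> h h' /(cross_ab rep tor S)[j pj ->] /(cross_ab rep tor S)[j' pj' ->].
by exists (j^-1 * j')%g; [exact: pwr_mulV | rewrite -conjgM mulVKg].
Qed.

Lemma cross_not_peripheral rho u v : isrep rho -> toric rho -> hyp (rho u) -> hyp (rho v) ->
  cross (rho u) (rho v) -> ~ peripheral u.
Proof.
move=> rep tor hu hv hc [phi [W [n [m cW tW uE]]]]; have mp := moves_morph m.
have [psi [mq k1 k2]] := moves_inv m.
have rep' := rep_comp rep mp; have [S] := toric_schottky rep' (toric_moves rep tor m).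
apply: (peripheral_noncross rep' S cW tW (v := psi v)) => /=; rewrite -?uE ?k2 //.
Qed.

(** A curve that crosses another one is not peripheral. *)
Lemma basis_of_pair rho u v h : isrep rho -> toric rho -> simple_in rho u -> simple_in rho v ->
  meets rho u v -> cross (rho u) (rho (v ^ h)%g) ->
  exists psi e, [/\ moves psi, psi gen_a = u & psi (gl (false, e)) = (v ^ h)%g].
Proof.
move=> rep tor su sv mv hc; have [hu _ _] := su; have [hv _ _] := sv.
have [[phi m uE]|pu] := simple_classification rep tor su; first exact: (meets_basis rep tor m uE sv mv hc).
have hv' : hyp (rho (v ^ h)%g) by apply/hypJ.
by case: (cross_not_peripheral rep tor hu hv' hc pu).
Qed.

Lemma can_morph f g : morph f -> cancel f g -> cancel g f -> morph g.
Proof. by move=> mf k1 k2 u v; apply: (can_inj k1); rewrite mf !k2. Qed.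

(** The images of a and b are simple and meet once in rho, because a and b do
  in the structure composed with f. *)
Lemma mcg_aut_moves rho f : isrep rho -> toric rho -> mcg_aut f ->
  exists psi e, [/\ moves psi, f gen_a = psi gen_a & f gen_b = psi (gl (false, e))].
Proof.
move=> rep tor [mf [g k1 k2] [c fc]]; have mg := can_morph mf k1 k2.
have rep' := rep_comp rep mf; have tor' := toric_morph rep tor mf fc.
have E : (rho \o f) \o g = rho by apply/funext => u /=; rewrite k2.
have := simple_in_comp rep' mf mg k1 k2 (simple_in_a rep' tor').
have := simple_in_comp rep' mf mg k1 k2 (simple_in_b rep' tor').
have := meets_comp mf mg k1 k2 (meets_ab rep' tor'); rewrite E => mv sv su.
have [|psi [e [m E1 E2]]] := basis_of_pair rep tor su sv mv (h := 1%g).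
  by rewrite conjg1; exact: toric_cross tor'.
by exists psi, e; rewrite E1 E2 conjg1.
Qed.

End Automorphisms.

(** * Normal form of mapping classes *)

Section NormalForm.
Implicit Types (u v c : F2) (z : letter) (phi psi : F2 -> F2) (s : seq bool).

(** (a, b) -> (a, a b) and (a, b) -> (a b, b), whose matrices generate the
  monoid SL_2(N). *)
Definition ptwist (d : bool) : F2 -> F2 := subst (fun x => if x.1 == d then gl x else
  if x.2 then (if d then gl x * gl (true, true) else gl (false, true) * gl x)%g
  else (if d then gl (true, false) * gl x else gl x * gl (false, false))%g).

Definition ntwist (d : bool) : F2 -> F2 := subst (fun x => if x.1 == d then gl x else
  if x.2 then (if d then gl x * gl (true, false) else gl (false, false) * gl x)%g
  else (if d then gl (true, true) * gl x else gl x * gl (false, true))%g).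

Lemma ptwist_morph d : morph (ptwist d).
Proof. by apply: subst_morph => -[[] []]; case: d => /=; (apply/val_inj; reflexivity). Qed.
Lemma ntwist_morph d : morph (ntwist d).
Proof. by apply: subst_morph => -[[] []]; case: d => /=; (apply/val_inj; reflexivity). Qed.

Fixpoint ptwists s : F2 -> F2 := if s is d :: s' then ptwists s' \o ptwist d else id.

Lemma ptwists_morph s : morph (ptwists s).
Proof. by elim: s => [//|d s IH]; exact: morph_comp IH (ptwist_morph d). Qed.

Lemma iter_quarter_morph i : morph (iter i quarter).
Proof. by elim: i => [//|i IH] u v; rewrite !iterS IH quarter_morph. Qed.

Lemma iter_quarter_mod i u : iter i quarter u = iter (i %% 4)%N quarter u.
Proof.
rewrite {1}(divn_eq i 4) iterD; elim: (i %/ 4)%N => [//|k IH].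
by rewrite mulSn iterD IH /= quarter4.
Qed.

(** The rotations of order four account for what the monoid of positive twists
  misses in SL_2(Z). *)
Definition normal_map c i s j u := (iter i quarter (ptwists s (iter j quarter u)) ^ c)%g.
Definition normalizable phi := exists c i s j, phi =1 normal_map c i s j.

Lemma normal_map_morph c i s j : morph (normal_map c i s j).
Proof.
move=> u v; rewrite /normal_map iter_quarter_morph ptwists_morph iter_quarter_morph.
exact: conjMg.
Qed.

Lemma normalizable_eq phi psi : phi =1 psi -> normalizable psi -> normalizable phi.
Proof. by move=> E [c [i [s [j H]]]]; exists c, i, s, j => u; rewrite E. Qed.

Lemma normalizable_conjl phi c : normalizable phi -> normalizable (fun u => (phi u ^ c)%g).
Proof. by move=> [c' [i [s [j H]]]]; exists (c' * c)%g, i, s, j => u; rewrite H /normal_map conjgM. Qed.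

Lemma normalizable_conj phi c : normalizable phi -> normalizable (phi \o (fun u => (u ^ c)%g)).
Proof.
move=> [c' [i [s [j H]]]]; exists (c' * (normal_map c' i s j c))%g, i, s, j => u /=.
rewrite H (morphJ _ _ (normal_map_morph _ _ _ _)); set d := normal_map c' i s j c.
by rewrite /normal_map (conjgM _ c' d).
Qed.

Lemma normalizable_quarter phi : normalizable phi -> normalizable (phi \o quarter).
Proof. by move=> [c [i [s [j H]]]]; exists c, i, s, j.+1 => u /=; rewrite H /normal_map iterSr. Qed.

Lemma ptwistK d : ptwist d \o ntwist d =1 id.
Proof.
apply: (morph_ext (morph_comp (ptwist_morph d) (ntwist_morph d)) (psi := id)) => //.
  by case: d; (apply/val_inj; reflexivity).
by case: d; (apply/val_inj; reflexivity).
Qed.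

(** The rotation of order four conjugates each twist to the inverse of the
  other one. *)
Lemma ntwist_quarter d : ntwist d =1 iter (if d then 3 else 1)%N quarter \o ptwist (~~ d) \o
  iter (if d then 1 else 3)%N quarter.
Proof.
apply: morph_ext; [exact: ntwist_morph | |..]; last 2 first.
- by case: d; (apply/val_inj; reflexivity).
- by case: d; (apply/val_inj; reflexivity).
by do 2 (apply: morph_comp; last exact: iter_quarter_morph || exact: ptwist_morph); exact: iter_quarter_morph.
Qed.

(** A lift of the braid relation, written R L^-1 = L S in SL_2(Z). *)
Lemma ptwist_ntwist d : ptwist (~~ d) \o ntwist d =1
  (fun u => (ptwist d (iter (if d then 1 else 3)%N quarter u) ^ (if d then gen_a * gen_b else (gen_a * gen_b)^-1))%g).
Proof.
apply: morph_ext; [exact: morph_comp (ptwist_morph _) (ntwist_morph _) | |..]; last 2 first.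
- by case: d; (apply/val_inj; reflexivity).
- by case: d; (apply/val_inj; reflexivity).
by move=> u v; rewrite iter_quarter_morph ptwist_morph conjMg.
Qed.

Lemma twl_ptwist z : z.1 -> twl z =1 if z.2 then ntwist true else ptwist true.
Proof.
case: z => [[] []] // _; apply: morph_ext; try exact: twl_morph; try exact: ptwist_morph;
  try exact: ntwist_morph; by (apply/val_inj; reflexivity).
Qed.

Lemma quarter_twl z : z.1 -> quarter \o twl z =1
  (if z.2 then ptwist false \o quarter else ntwist false \o quarter).
Proof.
move=> z1; case: z z1 => [[] []] // _; apply: morph_ext; try exact: morph_comp quarter_morph (twl_morph _);
  try exact: morph_comp (ptwist_morph _) quarter_morph; try exact: morph_comp (ntwist_morph _) quarter_morph;
  by (apply/val_inj; reflexivity).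
Qed.

(** The square of the rotation of order four, the elliptic involution, is
  central up to inner automorphisms. *)
Lemma quarter2_twl z : z.1 -> quarter \o quarter \o twl z =1
  (fun u => (twl z (quarter (quarter u)) ^ gl z)%g).
Proof.
move=> z1; apply: morph_ext; last 2 first.
- by case: z z1 => [[] []] // _; (apply/val_inj; reflexivity).
- by case: z z1 => [[] []] // _; (apply/val_inj; reflexivity).
- by do 2 (apply: morph_comp; last exact: twl_morph || exact: quarter_morph); exact: quarter_morph.
by move=> u v; rewrite !quarter_morph twl_morph conjMg.
Qed.

Lemma normalizable_ptwist c i s d : normalizable (normal_map c i s 0 \o ptwist d).
Proof. by exists c, i, (d :: s), 0%N. Qed.

(** An inverse twist cancels the last positive twist, or turns it into the
  other one followed by a rotation. *)
Lemma normalizable_ntwist c i s d : normalizable (normal_map c i s 0 \o ntwist d).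
Proof.
case: s => [|d' s].
  exists c, (i + if d then 3 else 1)%N, [:: ~~ d], (if d then 1 else 3)%N => u.
  by rewrite /normal_map /= ntwist_quarter iterD.
case: (eqVneq d' d) => [->|dd].
  exists c, i, s, 0%N => u; rewrite /normal_map /=.
  by rewrite -[ptwist d (ntwist d u)]/((ptwist d \o ntwist d) u) ptwistK.
have -> : d' = ~~ d by case: d d' dd => [] [].
apply: (normalizable_eq (psi := fun u => (normal_map c i (d :: s) (if d then 1 else 3)%N u ^
    normal_map c i s 0 (if d then gen_a * gen_b else (gen_a * gen_b)^-1)%g)%g)).
  move=> u; rewrite [LHS](_ : _ = normal_map c i s 0 (ptwist (~~ d) (ntwist d u))) //.
  rewrite -[ptwist _ _]/((ptwist (~~ d) \o ntwist d) u) ptwist_ntwist.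
  exact: morphJ (normal_map_morph c i s 0).
by apply: normalizable_conjl; exists c, i, (d :: s), (if d then 1 else 3)%N.
Qed.

Lemma normalizable_twl phi z : z.1 -> normalizable phi -> normalizable (phi \o twl z).
Proof.
move=> z1 [c [i [s [j H]]]]; apply: (normalizable_eq (psi := normal_map c i s j \o twl z)).
  by move=> u /=; rewrite H.
have [n] := ubnP j; elim: n j {H} => [//|n IH] [|[|j]] hj.
- apply: (normalizable_eq (psi := normal_map c i s 0 \o (if z.2 then ntwist true else ptwist true))).
    by move=> u /=; rewrite (twl_ptwist z1 u).
  by case: (z.2); [exact: normalizable_ntwist | exact: normalizable_ptwist].
- apply: (normalizable_eq (psi := (normal_map c i s 0 \o (if z.2 then ptwist false else ntwist false)) \o quarter)).
    move=> u; rewrite /normal_map /=; have := quarter_twl z1 u; case: (z.2) => /= -> //.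
  apply: normalizable_quarter; case: (z.2); [exact: normalizable_ptwist | exact: normalizable_ntwist].
apply: (normalizable_eq (psi := fun u =>
    ((normal_map c i s j \o twl z \o quarter \o quarter) u ^ normal_map c i s j (gl z))%g)).
  move=> u; have E : normal_map c i s j.+2 (twl z u) = normal_map c i s j ((quarter \o quarter \o twl z) u).
    by rewrite /normal_map !iterSr.
  by rewrite [LHS]E (quarter2_twl z1); exact: morphJ (normal_map_morph c i s j).
apply: normalizable_conjl; do 2 apply: normalizable_quarter.
by apply: IH; rewrite -ltnS; apply: ltnW.
Qed.

Lemma moves_normalizable phi : moves phi -> normalizable phi.
Proof.
elim=> {phi} [|phi _ N|phi z z1 _ N|phi c _ N].
- by exists 1%g, 0%N, [::], 0%N => u; rewrite /normal_map conjg1.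
- exact: normalizable_quarter.
- exact: normalizable_twl.
exact: normalizable_conj.
Qed.

(** Spellings of the images of a (true) and b (false) by a product of positive
  twists. *)
Fixpoint pwords s : seq bool * seq bool := if s is d :: s' then
  let: (wa, wb) := pwords s' in if d then (wa, wa ++ wb) else (wa ++ wb, wb)
  else ([:: true], [:: false]).

Definition posw (w : seq bool) : F2 := pw (map (fun t => (t, false)) w).

Lemma posw_cat w w' : posw (w ++ w') = (posw w * posw w')%g.
Proof. by rewrite /posw map_cat pw_cat. Qed.

Lemma ptwists_pwords s : ptwists s gen_a = posw (pwords s).1 /\ ptwists s gen_b = posw (pwords s).2.
Proof.
elim: s => [|d s [IHa IHb]] /=; first by split; apply/val_inj.
have ab : ptwists s (gen_a * gen_b)%g = (posw (pwords s).1 * posw (pwords s).2)%g.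
  by rewrite ptwists_morph IHa IHb.
case: d.
  have -> : ptwist true gen_a = gen_a by (apply/val_inj; reflexivity).
  have -> : ptwist true gen_b = (gen_a * gen_b)%g by (apply/val_inj; reflexivity).
  by rewrite ab IHa; case: (pwords s) => wa wb /=; rewrite posw_cat.
have -> : ptwist false gen_a = (gen_a * gen_b)%g by (apply/val_inj; reflexivity).
have -> : ptwist false gen_b = gen_b by (apply/val_inj; reflexivity).
by rewrite ab IHb; case: (pwords s) => wa wb /=; rewrite posw_cat.
Qed.

Lemma pwords_gt0 s : (0 < size (pwords s).1)%N /\ (0 < size (pwords s).2)%N.
Proof.
elim: s => [//|d s]; rewrite /=; case: (pwords s) => wa wb /= [h1 h2].
by case: d => /=; rewrite size_cat; split; lia.
Qed.

(** As in the tree of Calkin and Wilf: the larger length tells which twist was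
  applied last, and subtracting the smaller one undoes it. *)
Lemma pwords_inj s s' : size (pwords s).1 = size (pwords s').1 ->
  size (pwords s).2 = size (pwords s').2 -> s = s'.
Proof.
elim: s s' => [|d s IH] [|d' s'] //=.
- by have := pwords_gt0 s'; case: (pwords s') => wa wb /=; case: d' => /=; rewrite size_cat; lia.
- by have := pwords_gt0 s; case: (pwords s) => wa wb /=; case: d => /=; rewrite size_cat; lia.
have := pwords_gt0 s; have := pwords_gt0 s'; have := IH s'.
case: (pwords s) => wa wb; case: (pwords s') => wa' wb' /=.
by case: d; case: d' => /=; rewrite ?size_cat => H; try lia; move=> _ _ h1 h2; congr cons; apply: H; lia.
Qed.

End NormalForm.

(** * Derivative of the angle *)

Section Derivatives.
Variable R : realType.
Implicit Types (f g : R -> R) (P Q A B : R -> 'M[R]_2) (X Y : 'M[R]_2).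

Definition hd f (c : R) := is_derive (0 : R) (1 : R) f c.

Lemma hdD f g c d : hd f c -> hd g d -> hd (fun t => f t + g t) (c + d).
Proof. by move=> hf hg; exact: (is_deriveD (f := f) (g := g)). Qed.

Lemma hdM f g c d : hd f c -> hd g d -> hd (fun t => f t * g t) (c * g 0 + f 0 * d).
Proof.
move=> hf hg; apply: (is_derive_eq (is_deriveM (f := f) (g := g) hf hg)).
by rewrite /GRing.scale /=; ring.
Qed.

Lemma hdc (c : R) : hd (fun=> c) 0. Proof. exact: is_derive_cst. Qed.

Lemma hdN f c : hd f c -> hd (fun t => - f t) (- c).
Proof. by move=> hf; exact: (is_deriveN (f := f)). Qed.

Lemma hd_eq f c d : hd f c -> c = d -> hd f d. Proof. by move=> h <-. Qed.

Definition mder P X := forall i j, hd (fun t => P t i j) (X i j).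

Lemma mderM P Q X Y : mder P X -> mder Q Y -> mder (fun t => P t *m Q t) (X *m Q 0 + P 0 *m Y).
Proof.
move=> hP hQ i j.
have -> : (fun t => (P t *m Q t) i j) = (fun t => P t i 0 * Q t 0 j + P t i 1 * Q t 1 j).
  by apply/funext => t; rewrite mul2E.
apply: (hd_eq (hdD (hdM (hP i 0) (hQ 0 j)) (hdM (hP i 1) (hQ 1 j)))).
by rewrite !en2; ring.
Qed.

Lemma mder_tr P X : mder P X -> hd (fun t => \tr (P t)) (\tr X).
Proof.
move=> h; have -> : (fun t => \tr (P t)) = (fun t => P t 0 0 + P t 1 1).
  by apply/funext => t; rewrite tr2E.
by rewrite tr2E; exact: hdD.
Qed.

Lemma mderc X : mder (fun=> X) 0.
Proof. by move=> i j; rewrite mxE; exact: hdc. Qed.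

Lemma mder_adj P X : mder P X -> mder (fun t => adj2 (P t)) (adj2 X).
Proof.
move=> h i j; rewrite /adj2; case: (ord2P i) => ->; case: (ord2P j) => ->.
- have -> : (fun t => mx2 (P t 1 1) (- P t 0 1) (- P t 1 0) (P t 0 0) 0 0) = (fun t => P t 1 1).
    by apply/funext => t; rewrite !en2.
  by rewrite !en2.
- have -> : (fun t => mx2 (P t 1 1) (- P t 0 1) (- P t 1 0) (P t 0 0) 0 1) = (fun t => - P t 0 1).
    by apply/funext => t; rewrite !en2.
  by rewrite !en2; exact: hdN.
- have -> : (fun t => mx2 (P t 1 1) (- P t 0 1) (- P t 1 0) (P t 0 0) 1 0) = (fun t => - P t 1 0).
    by apply/funext => t; rewrite !en2.
  by rewrite !en2; exact: hdN.
have -> : (fun t => mx2 (P t 1 1) (- P t 0 1) (- P t 1 0) (P t 0 0) 1 1) = (fun t => P t 0 0).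
  by apply/funext => t; rewrite !en2.
by rewrite !en2.
Qed.

Lemma mder_trans : exists X, mder (fun t : R => trans (- t)) X.
Proof.
have e (s : R) : hd (fun t => expR (s * t)) s.
  have h : hd (fun t => s * t) s.
    apply: (hd_eq (hdM (hdc s) (is_derive_id (0 : R) (1 : R)))); ring.
  apply: (hd_eq (@is_derive1_comp _ (expR : R -> R) (fun t => s * t) 0 _ _ (is_derive_expR _) h)).
  by rewrite mulr0 expR0 ?mulr1 ?mul1r.
exists (mx2 (- 2^-1) 0 0 2^-1) => i j; rewrite /trans.
case: (ord2P i) => ->; case: (ord2P j) => ->; rewrite !en2.
- have -> : (fun t : R => mx2 (expR (- t / 2)) 0 0 (expR (- (- t / 2))) 0 0) = (fun t : R => expR (- 2^-1 * t)).
    by apply/funext => t; rewrite !en2; congr expR; field.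
  exact: e.
- have -> : (fun t : R => mx2 (expR (- t / 2)) 0 0 (expR (- (- t / 2))) 0 1) = (fun=> 0).
    by apply/funext => t; rewrite !en2.
  exact: hdc.
- have -> : (fun t : R => mx2 (expR (- t / 2)) 0 0 (expR (- (- t / 2))) 1 0) = (fun=> 0).
    by apply/funext => t; rewrite !en2.
  exact: hdc.
have -> : (fun t : R => mx2 (expR (- t / 2)) 0 0 (expR (- (- t / 2))) 1 1) = (fun t : R => expR (2^-1 * t)).
  by apply/funext => t; rewrite !en2; congr expR; field.
exact: e.
Qed.

Lemma mder_rep (rho : R -> F2 -> 'M[R]_2) : (forall t, isrep (rho t)) ->
  (exists X, mder (fun t => rho t gen_a) X) -> (exists X, mder (fun t => rho t gen_b) X) ->
  forall u, exists X, mder (fun t => rho t u) X.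
Proof.
move=> rep [A hA] [B hB] u; rewrite -(pwK u); elim: (word u) => [|x s [X IH]].
  exists 0; have -> : (fun t => rho t (pw [::])) = (fun=> 1%:M).
    by apply/funext => t; exact: rep1.
  exact: mderc.
have [Y hY] : exists Y, mder (fun t => rho t (gl x)) Y.
  case: x => [[] []].
  - exists (adj2 A); have -> : (fun t => rho t (gl (true, true))) = (fun t => adj2 (rho t gen_a)).
      by apply/funext => t; rewrite -[(true, true)]/(linv (true, false)) gl_linv gl_a repV.
    exact: mder_adj.
  - by exists A; rewrite gl_a.
  - exists (adj2 B); have -> : (fun t => rho t (gl (false, true))) = (fun t => adj2 (rho t gen_b)).
      by apply/funext => t; rewrite -[(false, true)]/(linv (false, false)) gl_linv gl_b repV.
    exact: mder_adj.
  by exists B; rewrite gl_b.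
eexists; have -> : (fun t => rho t (pw (x :: s))) = (fun t => rho t (gl x) *m rho t (pw s)).
  by apply/funext => t; rewrite pw_cons repM.
exact: mderM hY IH.
Qed.

(** The derivative of the angle, by the identity
  4 D + (2 z - x y)^2 = (x^2 - 4) (y^2 - 4) for D = 4 - x^2 - y^2 - z^2 + x y z. *)
Definition dangle X Y X' Y' : R :=
  - (Num.sg (comm2 X Y 1 0) * (2 * Num.sqrt (\det (comm2 X Y))) *
     (2 * \tr (X' *m Y + X *m Y') - \tr X' * \tr Y - \tr X * \tr Y')) /
  (((\tr X) ^+ 2 - 4) * ((\tr Y) ^+ 2 - 4)).

Lemma hd_continuous f c : hd f c -> {for 0, continuous f}.
Proof. by move=> [d _]; exact/differentiable_continuous/derivable1_diffP. Qed.

Lemma near_sg f c : hd f c -> f 0 != 0 -> \forall t \near (0 : R), Num.sg (f t) = Num.sg (f 0).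
Proof.
move=> hf f0; have cf := hd_continuous hf.
have [fp|fn] := ltP 0 (f 0).
  have : \forall t \near (0 : R), 0 < f t by apply: (cf [set x | 0 < x]); exact: open_nbhs_nbhs (conj (@open_gt _ 0) fp).
  by apply: filterS => t ft; rewrite !gtr0_sg.
have {}fn : f 0 < 0 by rewrite lt_neqAle f0.
have : \forall t \near (0 : R), f t < 0 by apply: (cf [set x | x < 0]); exact: open_nbhs_nbhs (conj (@open_lt _ 0) fn).
by apply: filterS => t ft; rewrite !ltr0_sg.
Qed.

(** The signs are locally constant, and the determinant D of the commutator is
  constant along the path, so only the quantity 2 z - x y inside the
  arctangent varies. *)
Lemma theta_derive A B X Y D : mder A X -> mder B Y -> (forall t, \det (A t) = 1) ->
  (forall t, \det (B t) = 1) -> 4 < D -> (forall t, \det (comm2 (A t) (B t)) = D) ->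
  hd (fun t => theta (A t) (B t)) (dangle (A 0) (B 0) X Y).
Proof.
move=> hA hB dA dB D4 dD.
have hx := mder_tr hA; have hy := mder_tr hB; have hz := mder_tr (mderM hA hB).
have hN : hd (fun t => comm2 (A t) (B t) 1 0) (comm2 X (B 0) 1 0 + comm2 (A 0) Y 1 0).
  have := hdD (mderM hA hB 1 0) (hdN (mderM hB hA 1 0)).
  have -> : (fun t => (A t *m B t) 1 0 + - (B t *m A t) 1 0) = (fun t => comm2 (A t) (B t) 1 0).
    by apply/funext => t; rewrite /comm2 !mxE.
  by move/hd_eq; apply; rewrite /comm2 !en2; ring.
have D0 : 0 < D by apply: lt_trans D4.
have N0 : comm2 (A 0) (B 0) 1 0 != 0.
  apply: contraTneq D0 => N0; rewrite -(dD 0) det2E N0 mulr0 subr0.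
  have -> : comm2 (A 0) (B 0) 1 1 = - comm2 (A 0) (B 0) 0 0 by rewrite /comm2 !en2; ring.
  by rewrite -leNgt mulrN oppr_le0 -expr2 sqr_ge0.
have := dD 0; rewrite det_comm2 ?dA ?dB //.
set x := \tr (A 0); set y := \tr (B 0); set z := \tr (A 0 *m B 0) => xyz.
have [x4 y4] : 4 < x ^+ 2 /\ 4 < y ^+ 2 by apply: comm_hyp; rewrite ?dA ?dB ?dD.
have x0 : x != 0 by apply: contraTneq x4 => ->; rewrite expr0n /= -leNgt.
have y0 : y != 0 by apply: contraTneq y4 => ->; rewrite expr0n /= -leNgt.
have hxy := hdM hx hy; rewrite -/x -/y in hxy.
have hxyN := hdM hxy hN; rewrite -/x -/y in hxyN.
have s1 := near_sg hxyN (mulf_neq0 (mulf_neq0 x0 y0) N0).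
have s2 := near_sg hxy (mulf_neq0 x0 y0).
pose sg := Num.sg (x * y * comm2 (A 0) (B 0) 1 0); pose tau := Num.sg (x * y).
pose w t := 2 * \tr (A t *m B t) - \tr (A t) * \tr (B t).
have [q [q0 qq qE]] : exists q, [/\ 0 < q, q ^+ 2 = 4 * D & q = 2 * Num.sqrt D].
  exists (2 * Num.sqrt D); split=> //; first by rewrite mulr_gt0 // sqrtr_gt0.
  by rewrite exprMn sqr_sqrtr; [ring | exact: ltW].
have hw : hd w (2 * \tr (X *m B 0 + A 0 *m Y) - (\tr X * y + x * \tr Y)).
  apply: (hd_eq (hdD (hdM (hdc 2) hz) (hdN hxy))); ring.
have ha : hd (fun t => atan (tau * q^-1 * w t)) ((1 + (tau * q^-1 * w 0) ^+ 2)^-1 *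
    (tau * q^-1 * (2 * \tr (X *m B 0 + A 0 *m Y) - (\tr X * y + x * \tr Y)))).
  have h := hdM (hdc (tau * q^-1)) hw; rewrite mul0r add0r in h.
  exact: (@is_derive1_comp _ (atan : R -> R) (fun t => tau * q^-1 * w t) 0 _ _ (is_derive1_atan _) h).
have ht := hdM (hdc sg) (hdD (hdc (pi / 2)) (hdN ha)).
rewrite mul0r !add0r in ht.
apply: (hd_eq (near_eq_is_derive _ ht)).
  near=> t; rewrite /theta dD -qE -/(w t).
  rewrite (near s1 t) // (near s2 t) // -/sg -/tau.
  by congr (_ * (_ - atan _)); rewrite mulrAC.
rewrite /dangle dD -/x -/y -qE.
set T := \tr (X *m B 0 + A 0 *m Y); set x' := \tr X; set y' := \tr Y.
have tt : tau ^+ 2 = 1 by rewrite sqr_sg mulf_neq0.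
have st : sg * tau = Num.sg (comm2 (A 0) (B 0) 1 0).
  by rewrite /sg sgrM mulrAC -expr2 -/tau tt mul1r.
have E : 1 + (tau * q^-1 * w 0) ^+ 2 = (x ^+ 2 - 4) * (y ^+ 2 - 4) / q ^+ 2.
  rewrite !exprMn tt mul1r exprVn qq /w -/x -/y -/z.
  have h : (x ^+ 2 - 4) * (y ^+ 2 - 4) = 4 * D + (2 * z - x * y) ^+ 2 by rewrite -xyz; ring.
  by rewrite h; field; rewrite gt_eqF.
rewrite E -st invf_div.
have x1 : x ^+ 2 - 4 != 0 by rewrite gt_eqF // subr_gt0.
have y1 : y ^+ 2 - 4 != 0 by rewrite gt_eqF // subr_gt0.
by move: (lt0r_neq0 q0) => q1; field; rewrite x1 y1 q1.
Unshelve. all: by end_near.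
Qed.

End Derivatives.

(** * Growth of positive words *)

Section Words.
Variable R : realType.
Implicit Types (A B X Y Z G U V : 'M[R]_2) (w : seq bool).

Fixpoint wm A B w : 'M[R]_2 := if w is t :: w' then (if t then A else B) *m wm A B w' else 1%:M.

(** The derivative of the product when A and B have derivatives X and Y. *)
Fixpoint wmd A B X Y w : 'M[R]_2 := if w is t :: w' then
  (if t then X else Y) *m wm A B w' + (if t then A else B) *m wmd A B X Y w' else 0.

Lemma wm_cat A B w w' : wm A B (w ++ w') = wm A B w *m wm A B w'.
Proof. by elim: w => [|t w IH] /=; rewrite ?mul1mx // IH mulmxA. Qed.

Lemma wm_rep (rho : F2 -> 'M[R]_2) w : isrep rho -> rho (posw w) = wm (rho gen_a) (rho gen_b) w.
Proof.
move=> rep; elim: w => [|t w IH]; first exact: rep1.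
have -> : posw (t :: w) = (gl (t, false) * posw w)%g by exact: pw_cons.
by rewrite (repM rep) IH /=; case: t; rewrite ?gl_a ?gl_b.
Qed.

Lemma mder_wm (A B : R -> 'M[R]_2) X Y w : mder A X -> mder B Y ->
  mder (fun t => wm (A t) (B t) w) (wmd (A 0) (B 0) X Y w).
Proof.
move=> hA hB; elim: w => [|b w IH]; first exact: mderc.
by case: b; exact: mderM.
Qed.

Lemma det_wm A B w : \det A = 1 -> \det B = 1 -> \det (wm A B w) = 1.
Proof. by move=> dA dB; elim: w => [|t w IH] /=; rewrite ?det1 // det_M //; case: t. Qed.

Lemma comm_pwords A B s : \det A = 1 -> \det B = 1 ->
  \det (comm2 (wm A B (pwords s).1) (wm A B (pwords s).2)) = \det (comm2 A B).
Proof.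
move=> dA dB; elim: s => [|d s] /=; first by rewrite !mulmx1.
case: (pwords s) => wa wb /= <-; have da := det_wm wa dA dB; have db := det_wm wb dA dB.
case: d; rewrite /= wm_cat; set U := wm A B wa in da *; set V := wm A B wb in db *.
  have -> : comm2 U (U *m V) = U *m comm2 U V by rewrite /comm2 mulmxBr !mulmxA.
  by rewrite det_mulmx da mul1r.
have -> : comm2 (U *m V) V = comm2 U V *m V by rewrite /comm2 mulmxBl !mulmxA.
by rewrite det_mulmx db mulr1.
Qed.

(** The factor of the derivative of the angle that varies from one mapping
  class to another. *)
Definition dquot U V U' V' : R :=
  `|2 * \tr (U' *m V + U *m V') - \tr U' * \tr V - \tr U * \tr V'| /
  (((\tr U) ^+ 2 - 4) * ((\tr V) ^+ 2 - 4)).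

Definition mle X Y := forall i j, `|X i j| <= Y i j.

Lemma mleM X X' Y Y' : mle X Y -> mle X' Y' -> mle (X *m X') (Y *m Y').
Proof.
move=> h h' i j; rewrite !mul2E; apply: le_trans (ler_normD _ _) _.
by rewrite !normrM; apply: lerD; apply: ler_pM.
Qed.

Lemma mle_tr X Y : mle X Y -> `|\tr X| <= \tr Y.
Proof. by move=> h; rewrite !tr2E; apply: le_trans (ler_normD _ _) _; apply: lerD. Qed.

Section Positive.
Variables (A B X Y : 'M[R]_2) (K : R).
Hypotheses (pA : forall i j, 0 < A i j) (pB : forall i j, 0 < B i j).
Hypotheses (dA : \det A = 1) (dB : \det B = 1).
Hypotheses (hX : mle X (K *: A)) (hY : mle Y (K *: B)) (K0 : 0 <= K).

Lemma wm_ge0 w : forall i j, 0 <= wm A B w i j.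
Proof.
elim: w => [|t w IH] i j /=; first by rewrite mxE ler0n.
by rewrite mul2E; case: t; rewrite addr_ge0 // mulr_ge0 // ltW.
Qed.

Lemma wm_mle w : mle (wm A B w) (wm A B w).
Proof. by move=> i j; rewrite ger0_norm ?wm_ge0. Qed.

Lemma wmd_mle w : mle (wmd A B X Y w) ((K * (size w)%:R) *: wm A B w).
Proof.
elim: w => [|t w IH] /=.
  by move=> i j; rewrite mxE normr0 mulr0 scale2E mul0r.
move=> i j; rewrite mxE; apply: le_trans (ler_normD _ _) _.
have h1 : mle (if t then X else Y) (K *: (if t then A else B)) by case: t.
have h2 : mle (if t then A else B) (if t then A else B).
  by clear h1; case: t => i' j'; rewrite ger0_norm // ltW.
have := lerD (mleM h1 (wm_mle w) i j) (mleM h2 IH i j).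
move/le_trans; apply; rewrite -scalemxAl -scalemxAr !scale2E -mulrDl -nat1r mulrDr mulr1.
by [].
Qed.

(** With p and q the products of the off-diagonal entries of T and W, two of
  the four terms of the product for T W already give q (1 + 2 p) + p, by the
  determinants. *)
Lemma wm_off w kap : 0 < kap -> kap <= A 0 1 * A 1 0 -> kap <= B 0 1 * B 1 0 ->
  w != [::] -> kap * (1 + 2 * kap) ^+ (size w).-1 <= wm A B w 0 1 * wm A B w 1 0.
Proof.
move=> k0 kA kB; elim: w => [//|t w IH] _ /=.
have [T [-> kT dT pT]] : exists T, [/\ (if t then A else B) = T, kap <= T 0 1 * T 1 0,
    \det T = 1 & forall i j, 0 < T i j] by case: t; [exists A | exists B].
have dW := det_wm w dA dB; have pW := wm_ge0 w; rewrite !mul2E.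
have q0 : 0 <= wm A B w 0 1 * wm A B w 1 0 by rewrite mulr_ge0.
have main : (wm A B w 0 1 * wm A B w 1 0) * (1 + 2 * kap) + kap <=
  (T 0 0 * wm A B w 0 1 + T 0 1 * wm A B w 1 1) * (T 1 0 * wm A B w 0 0 + T 1 1 * wm A B w 1 0).
  move: dT dW kT q0 (pT 0 0) (pT 0 1) (pT 1 0) (pT 1 1) (pW 0 0) (pW 0 1) (pW 1 0) (pW 1 1).
  rewrite !det2E.
  move: (T 0 0) (T 0 1) (T 1 0) (T 1 1) (wm A B w 0 0) (wm A B w 0 1) (wm A B w 1 0) (wm A B w 1 1).
  move=> a b c d x y z v h1 h2 h3 h4 a0 b0 c0 d0 x0 y0 z0 v0.
  have e1 : 0 <= a * y * (c * x) by rewrite !mulr_ge0 // ltW.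
  have e2 : 0 <= b * v * (d * z) by rewrite !mulr_ge0 // ltW.
  have e3 : a * d * (y * z) + b * c * (x * v) = y * z + (b * c) * (1 + 2 * (y * z)).
    have -> : a * d = 1 + b * c by rewrite -h1; ring.
    have -> : x * v = 1 + y * z by rewrite -h2; ring.
    by ring.
  have e4 : kap * (1 + 2 * (y * z)) <= b * c * (1 + 2 * (y * z)).
    by rewrite ler_wpM2r // addr_ge0 // mulr_ge0.
  have e5 : (a * y + b * v) * (c * x + d * z) = a * d * (y * z) + b * c * (x * v) + a * y * (c * x) + b * v * (d * z) by ring.
  by rewrite e5 e3; move: e1 e2 e4; lra.
apply: le_trans main; case: w IH {dW pW} q0 => [|t' w] IH q0.
  by rewrite /= expr0 mulr1 lerDr mulr_ge0 // addr_ge0 // mulr_ge0 // ltW.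
have {}IH := IH isT; rewrite [size _]/= exprSr mulrA.
rewrite -[leLHS]addr0; apply: lerD; last exact: ltW.
by rewrite ler_wpM2r // addr_ge0 // mulr_ge0 // ltW.
Qed.

Definition growth_cst (kap : R) : R := (1 + 2 / kap) / 2 * ((1 + kap / 5) ^+ 2 / (kap / 5)).

(** For k = 1 + kap / 5 one has k^4 <= 1 + 2 kap, so the trace grows at least
  like k^(2 n), and n <= k^n / (k - 1) absorbs the factor n = size w. *)
Lemma trace_quot w kap : 0 < kap -> kap <= 1 -> kap <= A 0 1 * A 1 0 -> kap <= B 0 1 * B 1 0 ->
  w != [::] -> [/\ 0 < \tr (wm A B w), 0 < (\tr (wm A B w)) ^+ 2 - 4 &
    \tr (wm A B w) * (size w)%:R / ((\tr (wm A B w)) ^+ 2 - 4) <=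
      growth_cst kap * ((1 + kap / 5)^-1) ^+ size w].
Proof.
move=> k0 k1 kA kB w0; have := wm_off k0 kA kB w0; have dW := det_wm w dA dB; have pW := wm_ge0 w.
set k := 1 + kap / 5; have kk : 1 < k by rewrite ltrDl divr_gt0.
have kp : 0 < k by apply: lt_trans kk.
have k4 : (k ^+ 2) ^+ 2 <= 1 + 2 * kap.
  have h : k ^+ 2 <= 1 + 11 / 25 * kap by rewrite /k; nra.
  have h0 : 0 <= k ^+ 2 by rewrite sqr_ge0.
  by nra.
have [n nE] : exists n, size w = n.+1 by case: w w0 {dW pW} => // t w _; exists (size w).
rewrite nE /=; set H := (k ^+ 2) ^+ n => hoff.
have H1 : 1 <= H by rewrite exprn_ege1 // exprn_ege1 // ltW.
have {}hoff : kap * H ^+ 2 <= wm A B w 0 1 * wm A B w 1 0.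
  apply: le_trans hoff; rewrite ler_wpM2l //; first exact: ltW.
  by rewrite -exprM mulnC exprM lerXn2r ?nnegrE // ?addr_ge0 ?mulr_ge0 ?sqr_ge0 // ltW.
move: hoff dW (pW 0 0) (pW 1 1); rewrite det2E tr2E.
move: (wm A B w 0 0) (wm A B w 0 1) (wm A B w 1 0) (wm A B w 1 1) => a b c d hoff dW a0 d0.
pose v := (a + d) ^+ 2 - 4.
have vE : v = (a - d) ^+ 2 + 4 * (b * c).
  have e : a * d = 1 + b * c by lra.
  have -> : v = (a - d) ^+ 2 + 4 * (a * d) - 4 by rewrite /v; ring.
  by rewrite e; ring.
have kH : kap <= kap * H ^+ 2 by rewrite ler_peMr ?exprn_ege1 // ltW.
have v4 : 4 * (kap * H ^+ 2) <= v by rewrite vE; have := sqr_ge0 (a - d); lra.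
have v0 : 0 < v by lra.
have x0 : 0 < a + d.
  by rewrite lt_neqAle addr_ge0 // andbT; apply: contraTneq v0 => h; rewrite /v -h expr0n /= -leNgt; lra.
split=> //; rewrite -/v ler_pdivrMr //.
have bern m : m%:R * (k - 1) <= k ^+ m.
  elim: m => [|m IH]; first by rewrite mul0r expr0.
  have hm : 1 <= k ^+ m by rewrite exprn_ege1 // ltW.
  by rewrite -nat1r exprS; nra.
have xH : (a + d) * H <= (1 + 2 / kap) / 2 * v.
  have e1 : (a + d) * H <= ((a + d) ^+ 2 + H ^+ 2) / 2 by have := sqr_ge0 (a + d - H); lra.
  have e2 : H ^+ 2 <= v / kap / 4 by rewrite !ler_pdivlMr //; lra.
  have e3 : 4 <= v / kap by rewrite ler_pdivlMr //; lra.
  apply: le_trans e1 _; have -> : (1 + 2 / kap) / 2 * v = (v + 2 * (v / kap)) / 2 by ring.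
  by rewrite /v in e2 e3 *; lra.
have kn0 : k ^+ n.+1 != 0 by rewrite expf_neq0 // gt_eqF.
have k10 : 0 < k - 1 by rewrite subr_gt0.
have -> : growth_cst kap * k^-1 ^+ n.+1 * v = (1 + 2 / kap) / 2 * v * (k ^+ 2 / (k - 1)) / k ^+ n.+1.
  have -> : k - 1 = kap / 5 by rewrite /k; ring.
  by rewrite /growth_cst -/k exprVn; move: (k ^+ n.+1) (k ^+ 2 / _) => u u'; rewrite -!mulrA; congr (_ * (_ * _)); ring.
rewrite ler_pdivlMr ?exprn_gt0 //.
have c0 : 0 <= k ^+ 2 / (k - 1) by rewrite divr_ge0 ?sqr_ge0 // ltW.
apply: le_trans (ler_wpM2r c0 xH); rewrite mulrA ler_pdivlMr //.
have -> : (a + d) * H * k ^+ 2 = (a + d) * (k ^+ n.+1 * k ^+ n.+1).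
  by rewrite /H -mulrA -exprSr -exprM -exprD addnn -mul2n.
have -> : (a + d) * n.+1%:R * k ^+ n.+1 * (k - 1) = (a + d) * (k ^+ n.+1 * (n.+1%:R * (k - 1))) by ring.
by rewrite ler_pM2l // ler_wpM2l ?exprn_ge0 // ltW.
Qed.

(** The derivative of the trace of a positive word is at most K times its
  length times its trace; moreover z <= x y, since the commutator has a
  positive determinant. *)
Lemma dquot_bound s kap : 0 < kap -> kap <= 1 -> kap <= A 0 1 * A 1 0 -> kap <= B 0 1 * B 1 0 ->
  4 < \det (comm2 A B) ->
  dquot (wm A B (pwords s).1) (wm A B (pwords s).2) (wmd A B X Y (pwords s).1) (wmd A B X Y (pwords s).2) <=
  6 * K * growth_cst kap ^+ 2 * ((1 + kap / 5)^-1) ^+ size (pwords s).1 * ((1 + kap / 5)^-1) ^+ size (pwords s).2.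
Proof.
move=> k0 k1 kA kB cAB; have [p0 q0] := pwords_gt0 s; have := comm_pwords s dA dB.
case: (pwords s) p0 q0 => wa wb /= p0 q0 cE.
have na : wa != [::] by apply: contraTneq p0 => ->.
have nb : wb != [::] by apply: contraTneq q0 => ->.
have [x0 vx hx] := trace_quot k0 k1 kA kB na; have [y0 vy hy] := trace_quot k0 k1 kA kB nb.
have da := det_wm wa dA dB; have db := det_wm wb dA dB; rewrite det_comm2 // in cE.
have mz := mle_tr (mleM (wm_mle wa) (wm_mle wb)).
have mx' := mle_tr (wmd_mle wa); have my' := mle_tr (wmd_mle wb).
have mz1 := mle_tr (mleM (wmd_mle wa) (wm_mle wb)); have mz2 := mle_tr (mleM (wm_mle wa) (wmd_mle wb)).
rewrite -?scalemxAl -?scalemxAr !mxtraceZ in mx' my' mz1 mz2.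
rewrite /dquot mxtraceD.
move: x0 vx hx y0 vy hy cE mz mx' my' mz1 mz2 da db.
set x := \tr (wm A B wa); set y := \tr (wm A B wb); set z := \tr (wm A B wa *m wm A B wb).
set x' := \tr (wmd _ _ _ _ wa); set y' := \tr (wmd _ _ _ _ wb).
set z1 := \tr (wmd _ _ _ _ wa *m _); set z2 := \tr (_ *m wmd _ _ _ _ wb).
set p : R := (size wa)%:R; set q : R := (size wb)%:R.
set vx := x ^+ 2 - 4; set vy := y ^+ 2 - 4.
move=> x0 vx0 hx y0 vy0 hy cE mz mx' my' mz1 mz2 _ _.
have z0 : 0 <= z by apply: le_trans mz; exact: normr_ge0.
have zxy : z <= x * y.
  have : z ^+ 2 <= x * y * z by move: vx0 vy0 cAB; rewrite -cE /vx /vy; lra.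
  have [->|zn] := eqVneq z 0; first by rewrite mulr_ge0 // ltW.
  have zp : 0 < z by rewrite lt_neqAle eq_sym zn.
  by rewrite expr2 ler_pM2r.
have p1 : 1 <= p by rewrite /p ler1n.
have q1 : 1 <= q by rewrite /q ler1n.
have num : `|2 * (z1 + z2) - x' * y - x * y'| <= 6 * K * (x * p) * (y * q).
  have n1 : `|x' * y| <= K * p * (x * y) by rewrite normrM (gtr0_norm y0) mulrA ler_wpM2r // ltW.
  have n2 : `|x * y'| <= K * q * (x * y).
    by rewrite normrM (gtr0_norm x0) mulrCA ler_wpM2l // ltW.
  have n3 : `|2 * (z1 + z2)| <= 2 * (K * p * (x * y) + K * q * (x * y)).
    rewrite normrM ger0_norm // ler_wpM2l //; apply: le_trans (ler_normD _ _) _.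
    by apply: lerD; [apply: le_trans mz1 _ | apply: le_trans mz2 _]; rewrite ler_wpM2l // mulr_ge0 // ler0n.
  have n4 : `|2 * (z1 + z2) - x' * y - x * y'| <= 3 * (K * (x * y)) * (p + q).
    apply: le_trans (ler_normB _ _) _; apply: le_trans (lerD (ler_normB _ _) (lexx _)) _.
    by move: n1 n2 n3; lra.
  apply: le_trans n4 _.
  have -> : 6 * K * (x * p) * (y * q) = 3 * (K * (x * y)) * (2 * (p * q)) by ring.
  apply: ler_wpM2l; first by rewrite !mulr_ge0 // ltW.
  have := mulr_ge0 (_ : 0 <= p - 1) (_ : 0 <= q - 1); rewrite !subr_ge0 => /(_ p1 q1).
  by move: p1 q1; lra.
apply: le_trans (ler_wpM2r _ num) _; first by rewrite invr_ge0 mulr_ge0 // ltW.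
have -> : 6 * K * (x * p) * (y * q) / (vx * vy) = 6 * K * ((x * p / vx) * (y * q / vy)).
  by rewrite invfM; ring.
set r := (1 + kap / 5)^-1 in hx hy *; set g := growth_cst kap in hx hy *.
have -> : 6 * K * g ^+ 2 * r ^+ size wa * r ^+ size wb = 6 * K * ((g * r ^+ size wa) * (g * r ^+ size wb)).
  by ring.
apply: ler_wpM2l; first by rewrite mulr_ge0.
by apply: ler_pM => //; rewrite divr_ge0 // ?mulr_ge0 // ltW.
Qed.

End Positive.
End Words.

(** * Exponential decay of the derivative *)

Section Decay.
Variable R : realType.
Implicit Types (A B X Y Z G U V : 'M[R]_2) (w : seq bool).

Lemma tr_scale a U : \tr (a *: U) = a * \tr U. Proof. by rewrite linearZ. Qed.

Section Conjugation.
Variables (G : 'M[R]_2) (sg tau : R).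
Hypotheses (uG : G \in unitmx) (sg1 : sg ^+ 2 = 1) (tau1 : tau ^+ 2 = 1).

Definition cj Z := G *m Z *m invmx G.

Lemma cjM Z U : cj Z *m cj U = cj (Z *m U).
Proof. by rewrite /cj -!mulmxA (mulmxA (invmx G)) mulVmx // mul1mx. Qed.

Lemma cj_tr Z : \tr (cj Z) = \tr Z.
Proof. by rewrite /cj mxtrace_mulC mulmxA mulVmx // mul1mx. Qed.

Lemma cj_det Z : \det (cj Z) = \det Z.
Proof. by rewrite /cj !det_mulmx mulrAC -det_mulmx mulmxV // det1 mul1r. Qed.

Lemma cjD Z U : cj (Z + U) = cj Z + cj U. Proof. by rewrite /cj mulmxDr mulmxDl. Qed.
Lemma cjZ a Z : cj (a *: Z) = a *: cj Z. Proof. by rewrite /cj -scalemxAr -scalemxAl. Qed.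

Definition wsign w : R := foldr (fun t x => (if t then sg else tau) * x) 1 w.

Lemma wsign2 w : wsign w ^+ 2 = 1.
Proof. by elim: w => [|t w IH]; rewrite ?expr1n //= exprMn IH mulr1; case: t. Qed.

Lemma wm_cj A B w : wm (sg *: cj A) (tau *: cj B) w = wsign w *: cj (wm A B w).
Proof.
elim: w => [|t w IH] /=; first by rewrite scale1r /cj mulmx1 mulmxV.
have -> : (if t then sg *: cj A else tau *: cj B) = (if t then sg else tau) *: cj (if t then A else B) by case: t.
by rewrite IH -scalemxAl -scalemxAr scalerA cjM.
Qed.

Lemma wmd_cj A B X Y w : wmd (sg *: cj A) (tau *: cj B) (sg *: cj X) (tau *: cj Y) w =
  wsign w *: cj (wmd A B X Y w).
Proof.
elim: w => [|t w IH] /=; first by rewrite scale1r /cj mulmx0 mul0mx.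
have E Z U : (if t then sg *: cj Z else tau *: cj U) = (if t then sg else tau) *: cj (if t then Z else U) by case: t.
by rewrite !E IH wm_cj -!scalemxAl -!scalemxAr !scalerA !cjM -scalerDr -cjD.
Qed.

Lemma dquot_cj a b U V U' V' : a ^+ 2 = 1 -> b ^+ 2 = 1 ->
  dquot (a *: cj U) (b *: cj V) (a *: cj U') (b *: cj V') = dquot U V U' V'.
Proof.
move=> a1 b1; rewrite /dquot -!scalemxAl -!scalemxAr !scalerA !cjM -scalerDr -cjD !tr_scale !cj_tr.
rewrite !exprMn a1 b1 !mul1r; congr (_ / _).
have ab : `|a * b| = 1.
  by apply/eqP; rewrite -(@eqrXn2 _ 2) ?nnegrE // real_normK ?num_real // exprMn a1 b1 mulr1 expr1n.
rewrite -[RHS]mul1r -ab -normrM; congr `| _ |; ring.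
Qed.
End Conjugation.

Lemma dangle_dquot U V U' V' : 4 < (\tr U) ^+ 2 -> 4 < (\tr V) ^+ 2 ->
  `|dangle U V U' V'| <= 2 * Num.sqrt (\det (comm2 U V)) * dquot U V U' V'.
Proof.
move=> hU hV; rewrite /dangle /dquot.
have d0 : 0 < (\tr U ^+ 2 - 4) * (\tr V ^+ 2 - 4) by rewrite mulr_gt0 // subr_gt0.
move: d0 (sqrtr_ge0 (\det (comm2 U V))); set den := _ * _; set q := Num.sqrt _; set N := _ - \tr U * _ => d0 q0.
have -> : - (Num.sg (comm2 U V 1 0) * (2 * q) * N) / den = - Num.sg (comm2 U V 1 0) * (2 * q * (N / den)) by ring.
rewrite normrM normrN (normrM (2 * q)) (normrM N) normfV (gtr0_norm d0) (ger0_norm (_ : 0 <= 2 * q)) ?mulr_ge0 //.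
rewrite -[leRHS]mul1r ler_wpM2r //; first by rewrite !mulr_ge0 // invr_ge0 ltW.
by case: sgrP; rewrite ?normr0 ?normrN ?normr1.
Qed.

(** The derivative of the angle decays exponentially with the lengths of the
  two words, because the two generators are conjugate, up to sign, to matrices
  with positive entries. *)
Lemma dangle_decay A B X Y : \det A = 1 -> \det B = 1 -> 4 < \det (comm2 A B) ->
  exists C r : R, [/\ 0 <= C, 0 < r < 1 & forall s,
    `|dangle (wm A B (pwords s).1) (wm A B (pwords s).2)
             (wmd A B X Y (pwords s).1) (wmd A B X Y (pwords s).2)| <=
    C * (r ^+ size (pwords s).1 * r ^+ size (pwords s).2)].
Proof.
move=> dA dB h; have [G [sg [tau [A' [B' [dG sg1 tau1 pAB [eA eB]]]]]]] := positive_basis dA dB h.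
have uG : G \in unitmx by rewrite unitmxE unitfE.
have AE : A = sg *: cj G A' by rewrite /cj scalemxAl -eA mulmxK.
have BE : B = tau *: cj G B' by rewrite /cj scalemxAl -eB mulmxK.
have inv Z (c : R) : c ^+ 2 = 1 -> Z = c *: cj G (c *: (invmx G *m Z *m G)).
  move=> c1; rewrite cjZ scalerA -expr2 c1 scale1r /cj !mulmxA mulmxV // mul1mx mulmxK //.
have XE := inv X _ sg1; have YE := inv Y _ tau1.
set X' := sg *: (_ *m X *m _) in XE; set Y' := tau *: (_ *m Y *m _) in YE.
have det1' (c : R) Z : c ^+ 2 = 1 -> \det (c *: cj G Z) = \det Z.
  by move=> c1; rewrite detZ c1 mul1r cj_det.
have dA' : \det A' = 1 by rewrite -(det1' _ _ sg1) -AE.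
have dB' : \det B' = 1 by rewrite -(det1' _ _ tau1) -BE.
have cAB : comm2 A B = (sg * tau) *: cj G (comm2 A' B').
  rewrite /comm2 AE BE -!scalemxAl -!scalemxAr !scalerA !cjM // (mulrC tau sg) -scalerBr.
  by rewrite /cj mulmxBr mulmxBl.
have h' : 4 < \det (comm2 A' B').
  by rewrite -(det1' (sg * tau)) -?cAB // exprMn sg1 tau1 mulr1.
have pA i j : 0 < A' i j by case: (pAB i j).
have pB i j : 0 < B' i j by case: (pAB i j).
pose K := \sum_i \sum_j (`|X' i j| / A' i j + `|Y' i j| / B' i j).
have t0 i j : 0 <= `|X' i j| / A' i j + `|Y' i j| / B' i j by rewrite addr_ge0 // divr_ge0 // ltW.
have K0 : 0 <= K by do 2 (apply: sumr_ge0 => ? _).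
have KE i j : `|X' i j| / A' i j + `|Y' i j| / B' i j <= K.
  rewrite /K (bigD1 i) //= (bigD1 j) //= -addrA lerDl addr_ge0 //; first by apply: sumr_ge0.
  by apply: sumr_ge0 => ? _; apply: sumr_ge0.
have hX : mle X' (K *: A').
  move=> i j; rewrite (scale2E K) -ler_pdivrMr //; apply: le_trans (KE i j).
  by rewrite lerDl divr_ge0 // ltW.
have hY : mle Y' (K *: B').
  move=> i j; rewrite (scale2E K) -ler_pdivrMr //; apply: le_trans (KE i j).
  by rewrite lerDr divr_ge0 // ltW.
pose kap := Num.min 1 (Num.min (A' 0 1 * A' 1 0) (B' 0 1 * B' 1 0)).
have kap0 : 0 < kap by rewrite !lt_min ltr01 !mulr_gt0.
have kap1 : kap <= 1 by rewrite ge_min lexx.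
have kA : kap <= A' 0 1 * A' 1 0 by rewrite !ge_min lexx !orbT.
have kB : kap <= B' 0 1 * B' 1 0 by rewrite !ge_min lexx !orbT.
exists (2 * Num.sqrt (\det (comm2 A B)) * (6 * K * growth_cst kap ^+ 2)), (1 + kap / 5)^-1.
have k1 : 1 < 1 + kap / 5 by rewrite ltrDl divr_gt0.
split.
- by move: (growth_cst kap ^+ 2) (sqr_ge0 (growth_cst kap)) => g g0; rewrite !mulr_ge0 ?sqrtr_ge0.
- by rewrite invr_gt0 invf_lt1 ?k1 ?(lt_trans _ k1).
move=> s; have cE := comm_pwords s dA dB.
have [u4 v4] := comm_hyp (det_wm (pwords s).1 dA dB) (det_wm (pwords s).2 dA dB) (eq_ind_r (fun x => 4 < x) h cE).
apply: le_trans (dangle_dquot _ _ u4 v4) _; rewrite cE -[leRHS]mulrA ler_wpM2l ?mulr_ge0 ?sqrtr_ge0 //.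
have := dquot_bound pA pB dA' dB' hX hY K0 s kap0 kap1 kA kB h'.
rewrite -[X in _ <= X]mulrA; apply: le_trans.

rewrite AE BE XE YE !wm_cj // !wmd_cj // dquot_cj //; exact: wsign2.
Qed.

End Decay.

(** * Sums of exponentially decaying terms *)

Section SumBound.
Variable R : realType.

Lemma geometric_bound (r : R) N : 0 < r < 1 -> \sum_(p < N) r ^+ p <= (1 - r)^-1.
Proof.
move=> /andP[r0 r1]; have d0 : 0 < 1 - r by rewrite subr_gt0.
rewrite -[leRHS]mul1r ler_pdivlMr // mulrC.
have -> : (1 - r) * (\sum_(p < N) r ^+ p) = 1 - r ^+ N.
  by have := subrX1 r N; rewrite -[1 - r]opprB -[1 - r ^+ N]opprB mulNr => <-.
by rewrite gerBl exprn_ge0 // ltW.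
Qed.

(** The bound summed over O x nat x nat is a product of two geometric series.
  *)
Lemma decay_sum (T : choiceType) (O : finType) (t : T -> R) (o : T -> O) (p q : T -> nat) (C r : R) :
  0 <= C -> 0 < r < 1 -> (forall x, t x <= C * (r ^+ p x * r ^+ q x)) ->
  (forall x y, o x = o y -> p x = p y -> q x = q y -> x = y) ->
  forall s : seq T, uniq s -> \sum_(x <- s) t x <= #|O|%:R * C * ((1 - r)^-1 * (1 - r)^-1).
Proof.
move=> C0 hr ht inj s us; have [r0 r1] := andP hr.
pose N := (\max_(x <- s) maxn (p x) (q x)).+1.
have hN x : x \in s -> (p x < N)%N /\ (q x < N)%N.
  move=> xs; have h : (maxn (p x) (q x) <= \max_(x <- s) maxn (p x) (q x))%N.
    by rewrite (big_rem x) //= leq_maxl.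
  by split; rewrite ltnS; apply: leq_trans h; rewrite ?leq_maxl ?leq_maxr.
pose k x : O * ('I_N * 'I_N) := (o x, (inord (p x), inord (q x))).
pose b (y : O * ('I_N * 'I_N)) := C * (r ^+ y.2.1 * r ^+ y.2.2).
have kI : {in s &, injective k}.
  move=> x y /hN[h1 h2] /hN[h3 h4] [e1 /(congr1 val) e2 /(congr1 val) e3].
  by move: e2 e3; rewrite /= !inordK // => e2 e3; exact: inj.
have b0 y : 0 <= b y by rewrite !mulr_ge0 // exprn_ge0 // ltW.
apply: (@le_trans _ _ (\sum_(x <- s) b (k x))).
  rewrite big_seq [leRHS]big_seq; apply: ler_sum => x /hN[h1 h2].
  by apply: le_trans (ht x) _; rewrite /b /k /= !inordK.
have -> : \sum_(x <- s) b (k x) = \sum_(y <- map k s) b y by rewrite big_map.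
rewrite big_uniq ?map_inj_in_uniq //=.
apply: (@le_trans _ _ (\sum_y b y)).
  by rewrite [leRHS](bigID (mem (map k s))) /= lerDl sumr_ge0.
rewrite -(pair_bigA _ (fun i j => b (i, j))) /=.
have E (i : O) : \sum_(j : 'I_N * 'I_N) b (i, j) = C * ((\sum_(n < N) r ^+ n) * (\sum_(n < N) r ^+ n)).
  rewrite -(pair_bigA _ (fun n m => b (i, (n, m)))) /b /= mulr_suml mulr_sumr.
  by apply: eq_bigr => n _; rewrite mulr_sumr mulr_sumr.
rewrite (eq_bigr _ (fun i _ => E i)) sumr_const cardT -cardE -[leLHS]mulr_natl.
rewrite -mulrA ler_wpM2l // ler_wpM2l //.
by apply: ler_pM; rewrite ?geometric_bound // sumr_ge0 // => i _; rewrite exprn_ge0 // ltW.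
Qed.

End SumBound.

(** * Angles along a twist deformation *)

Section Aut.
Variables (R : realType) (l : R).
Implicit Types (X Y : teich l) (u v h c : F2) (f phi psi : F2 -> F2).

Lemma mcg_aut_comp f phi : mcg_aut f -> mcg_aut phi -> mcg_aut (f \o phi).
Proof.
move=> [mf bf [c fc]] [mp bp [d pd]]; split; [exact: morph_comp | exact: bij_comp |].
by exists (c * f d)%g; rewrite /= pd (morphJ _ _ mf) fc conjgM.
Qed.

Lemma moves_mcg_aut phi : moves phi -> mcg_aut phi.
Proof. by move=> m; split; [exact: moves_morph | exact: moves_bij | exact: moves_bdry]. Qed.

Lemma glb e : gl (false, e) = if e then gen_b^-1%g else gen_b.
Proof. by case: e; rewrite ?gl_b // -[(false, true)]/(linv (false, false)) gl_linv gl_b. Qed.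

Lemma aut_rep X phi : mcg_aut phi -> isrep (X \o phi) /\ toric (X \o phi).
Proof.
move=> [mp _ [c E]]; have rep := teich_rep X.
by split; [exact: rep_comp | exact: toric_morph rep (teich_toric X) mp E].
Qed.

Lemma aut_comm X phi e : mcg_aut phi ->
  \det (comm2 (X (phi gen_a)) (X (phi (gl (false, e))))) = bconst l.
Proof.
move=> [mp _ [c E]]; rewrite -(bconst_morph X mp E) glb; case: e => //.
rewrite (morphV _ mp) (repV (teich_rep X)).
by rewrite /comm2 /adj2 !det2E !en2; ring.
Qed.

(** In the structure composed with phi the two curves are a and b or b^-1,
  which cross once. *)
Lemma vee_aut X phi e u v h : mcg_aut phi -> u = phi gen_a -> (v ^ h)%g = phi (gl (false, e)) ->
  vee u v X = theta (X (phi gen_a)) (X (phi (gl (false, e)))).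
Proof.
move=> ap uE vE; have [rep' tor'] := aut_rep X ap; have rep := teich_rep X.
have [mp [psi k1 k2] _] := ap; have mq := can_morph mp k1 k2.
have [ha hb] := toric_hyp rep' tor'.
have hE : hyp (X (phi (gl (false, e)))).
  rewrite glb; case: e {vE} => //; rewrite (morphV _ mp) /hyp (repV rep).
  by rewrite (_ : \tr _ = \tr (X (phi gen_b))) // /adj2 !tr2E !en2 addrC.
have hc : cross (X (phi gen_a)) (X (phi (gl (false, e)))).
  by rewrite /cross aut_comm //; apply: lt_trans (proj1 (teich_comm X)).
have me : meets (X \o phi) gen_a (gl (false, e)).
  have mab := meets_ab rep' tor'; rewrite glb; case: e {vE hE hc} => //.
  have [[h1 c1] U] := mab.
  split; first by exists h1; rewrite conjVg; apply/(crossVr rep').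
  move=> g g'; rewrite !conjVg => /(crossVr rep') c2 /(crossVr rep') c3.
  by have [m pm E] := U _ _ c2 c3; exists m => //; rewrite E conjVg.
have mv : meets X u v.
  have := meets_comp mp mq k1 k2 me; rewrite -uE -vE => /(meetsJ h^-1%g); rewrite conjgK.
  by have -> : (X \o phi) \o psi = X by apply/funext => w /=; rewrite k2.
have hU : hyp (X u) by rewrite uE.
have hV : hyp (X v) by apply: (proj1 (hypJ rep v h)); rewrite vE.
by rewrite -vE -uE in hc *; exact: vee_theta.
Qed.

Lemma mder_invl (rho : R -> F2 -> 'M[R]_2) e : (forall t, isrep (rho t)) ->
  (exists Z, mder (fun t => rho t (gl (false, e))) Z) -> exists Z, mder (fun t => rho t gen_b) Z.
Proof.
move=> rep [Z hZ]; rewrite glb in hZ; case: e hZ => hZ; last by exists Z.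
exists (adj2 Z); have -> : (fun t => rho t gen_b) = (fun t => adj2 (rho t gen_b^-1%g)).
  by apply/funext => t; rewrite -repV ?invgK.
exact: mder_adj.
Qed.

(** The curve mu and the curve crossing it once generate the group, and their
  images are explicit along the deformation. *)
Lemma twist_mder (M X : teich l) mu sigma : simple_geodesic M mu -> twist_path X mu sigma ->
  forall u, exists Z, mder (fun t => sigma t u : 'M[R]_2) Z.
Proof.
move=> sM [_ [[_ cst] u|[nu [g [m [snu me [th _ hth] _ tw]]]]]].
  exists 0; have -> : (fun t => sigma t u : 'M[R]_2) = (fun=> (X u : 'M[R]_2)) by apply/funext => t; exact: cst.
  exact: mderc.
have rX := teich_rep X; have tX := teich_toric X.
have [anu inu] := simple_geodesic_in snu; have [hnu _ _] := inu.
have hc := angle_cross hth; have [_ iM] := simple_geodesic_in sM.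
have hmu : hyp (X mu).
  by have [_ _ [g' [l1 [m1 [/translation_hyp[_ h] _]]]]] := hth.
have [phi mphi muE] : exists2 phi, moves phi & mu = phi gen_a.
  have [//|pm] := simple_classification (teich_rep M) (teich_toric M) iM.
  by case: (cross_not_peripheral rX tX hmu hnu hc pm).
have amu : simple_axis X mu by rewrite muE; exact: simple_axis_moves.
have imu : simple_in X mu.
  apply: simple_axis_in => //; have [z z1 _] := cross_point (hol_det X _) (hol_det X _) hmu hnu hc.
  by exists z.
have mv : meets X mu nu by apply: (meet_once_meets (h := 1%g)) => //; rewrite conjg1.
have [|psi [e [mpsi pa pb]]] := basis_of_pair rX tX imu inu mv (h := 1%g); first by rewrite conjg1.
have [psi' [mpsi' k1 k2]] := moves_inv mpsi.
have rep t : isrep (sigma t \o psi) by exact: rep_comp (teich_rep _) (moves_morph mpsi).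
have H : forall u, exists Z, mder (fun t => (sigma t \o psi) u) Z.
  apply: (@mder_rep _ (fun t => sigma t \o psi)) => //.
    exists 0; have -> : (fun t => (sigma t \o psi) gen_a) = (fun=> (X mu : 'M[R]_2)).
      by apply/funext => t; rewrite /= pa; have [] := tw t.
    exact: mderc.
  apply: (@mder_invl (fun t => sigma t \o psi) e) => //; have [E hE] := mder_trans R.
  eexists; have -> : (fun t => (sigma t \o psi) (gl (false, e))) =
      (fun t => X nu *m (g *m trans (- t) *m invmx g)).
    by apply/funext => t; rewrite /= pb conjg1; have [] := tw t.
  exact: mderM (mderc (X nu)) (mderM (mderM (mderc g) hE) (mderc (invmx g))).
by move=> u; have := H (psi' u); rewrite /= k2.
Qed.

Section Path.
Variables (sigma : R -> teich l).
Hypothesis dsigma : forall u, exists Z, mder (fun t => sigma t u : 'M[R]_2) Z.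

Definition trace_of u (t : R) : R := \tr (sigma t u).
Definition dtrace u : R := 'D_1 (trace_of u) 0.

Lemma hd_trace u : hd (trace_of u) (dtrace u).
Proof. by have [Z /mder_tr[h _]] := dsigma u; exact: derivableP. Qed.

Lemma hd_unique (k : R -> R) (c d : R) : hd k c -> hd k d -> c = d.
Proof. by move=> [_ <-] [_ <-]. Qed.

Lemma dtrace_eq u (k : R -> R) (c : R) : trace_of u =1 k -> hd k c -> dtrace u = c.
Proof. by move=> /funext E h; apply: hd_unique (hd_trace u) _; rewrite E. Qed.

Lemma trace_conj u c : trace_of (u ^ c)%g =1 trace_of u.
Proof. by move=> t; exact: tr_repJ (teich_rep _). Qed.

Lemma trace_inv u : trace_of u^-1%g =1 trace_of u.
Proof.
by move=> t; rewrite /trace_of (repV (teich_rep _)) /adj2 !tr2E !en2 addrC.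
Qed.

Lemma trace_mulV u v t : trace_of (u * v^-1)%g t = trace_of u t * trace_of v t - trace_of (u * v)%g t.
Proof.
rewrite /trace_of !(repM (teich_rep _)) (repV (teich_rep _)) /adj2 !tr2E !en2; ring.
Qed.

Lemma trace_mulC u v : trace_of (u * v)%g =1 trace_of (v * u)%g.
Proof. by move=> t; rewrite /trace_of !(repM (teich_rep _)) mxtrace_mulC. Qed.

(** The absolute value of the derivative of the angle, written with the traces
  of u, v and u v only: it is therefore invariant under conjugation and under
  the rotation of order four. *)
Definition speed u v : R := 2 * Num.sqrt (bconst l) *
  `|2 * dtrace (u * v)%g - dtrace u * trace_of v 0 - trace_of u 0 * dtrace v| /
  (((trace_of u 0) ^+ 2 - 4) * ((trace_of v 0) ^+ 2 - 4)).

Lemma speed_conj u v c : speed (u ^ c)%g (v ^ c)%g = speed u v.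
Proof.
have E w : dtrace (w ^ c)%g = dtrace w by exact: dtrace_eq (trace_conj w c) (hd_trace w).
by rewrite /speed -conjMg !E !trace_conj.
Qed.

Lemma dtrace_inv u : dtrace u^-1%g = dtrace u.
Proof. exact: dtrace_eq (trace_inv u) (hd_trace u). Qed.

Lemma speed_invr u v : speed u v^-1%g = speed u v.
Proof.
have E : dtrace (u * v^-1)%g = dtrace u * trace_of v 0 + trace_of u 0 * dtrace v - dtrace (u * v)%g.
  exact: dtrace_eq (trace_mulV u v) (hdD (hdM (hd_trace u) (hd_trace v)) (hdN (hd_trace _))).
rewrite /speed E dtrace_inv !trace_inv; congr (_ * _ / _); rewrite -normrN; congr `| _ |; ring.
Qed.

Lemma speed_sym u v : speed v u = speed u v.
Proof.
have E : dtrace (v * u)%g = dtrace (u * v)%g by exact: dtrace_eq (trace_mulC v u) (hd_trace _).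
rewrite /speed E [X in _ / X]mulrC; congr (_ * `| _ | / _); ring.
Qed.

(** The new traces are y, x and x y - z. *)
Lemma speed_quarter phi j : morph phi ->
  speed (phi (iter j quarter gen_a)) (phi (iter j quarter gen_b)) = speed (phi gen_a) (phi gen_b).
Proof.
elim: j phi => [//|j IH] phi m.
rewrite !iterSr; have -> : quarter gen_a = gen_b by apply/val_inj.
have -> : quarter gen_b = gen_a^-1%g by apply/val_inj.
by rewrite (morphV _ (iter_quarter_morph j)) (morphV _ m) speed_invr speed_sym IH.
Qed.

Lemma dangle_speed u v U V : mder (fun t => sigma t u : 'M[R]_2) U -> mder (fun t => sigma t v : 'M[R]_2) V ->
  \det (comm2 (sigma 0 u) (sigma 0 v)) = bconst l ->
  `|dangle (sigma 0 u) (sigma 0 v) U V| = speed u v.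
Proof.
move=> hU hV hD; have [D4 _] := teich_comm (sigma 0).
have dU : dtrace u = \tr U by exact: dtrace_eq (fun=> erefl) (mder_tr hU).
have dV : dtrace v = \tr V by exact: dtrace_eq (fun=> erefl) (mder_tr hV).
have dUV : dtrace (u * v)%g = \tr (U *m sigma 0 v + sigma 0 u *m V).
  by apply: dtrace_eq (mder_tr (mderM hU hV)) => t; rewrite /trace_of (repM (teich_rep _)).
have [hu hv] := comm_hyp (hol_det (sigma 0) u) (hol_det (sigma 0) v) (eq_ind_r (fun x => 4 < x) D4 hD).
rewrite /speed dU dV dUV /dangle hD /trace_of.
move: (\tr U) (\tr V) (\tr (_ + _)) => x' y' z'.
have N0 : comm2 (sigma 0 u) (sigma 0 v) 1 0 != 0.
  apply: contraTneq (lt_trans (ltr0n R 4) D4) => N0; rewrite -hD det2E N0 mulr0 subr0.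
  have -> : comm2 (sigma 0 u) (sigma 0 v) 1 1 = - comm2 (sigma 0 u) (sigma 0 v) 0 0 by rewrite /comm2 !en2; ring.
  by rewrite -leNgt mulrN oppr_le0 -expr2 sqr_ge0.
move: hu hv N0; rewrite /hyp; move: (comm2 _ _ 1 0) (\tr (sigma 0 u)) (\tr (sigma 0 v)) => N x y hu hv N0.
have d0 : 0 < (x ^+ 2 - 4) * (y ^+ 2 - 4) by rewrite mulr_gt0 // subr_gt0.
have q0 : 0 <= 2 * Num.sqrt (bconst l) by rewrite mulr_ge0 ?sqrtr_ge0.
move: (_ * Num.sqrt _) q0 => q q0.
rewrite normrM normfV (gtr0_norm d0) normrN (normrM (_ * q)) (normrM (Num.sg N)) (ger0_norm q0).
by rewrite normr_sg N0 mul1r.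
Qed.

Lemma speed_decay i : exists C r : R, [/\ 0 <= C, 0 < r < 1 & forall s,
  speed (iter i quarter (ptwists s gen_a)) (iter i quarter (ptwists s gen_b)) <=
  C * (r ^+ size (pwords s).1 * r ^+ size (pwords s).2)].
Proof.
have mi := iter_quarter_morph i; have ai : mcg_aut (iter i quarter).
  by elim: i {mi} => [|i IH]; [exact: moves_mcg_aut moves_id | exact: mcg_aut_comp (moves_mcg_aut (moves_quarter moves_id)) IH].
have rep t : isrep (sigma t \o iter i quarter) by exact: rep_comp (teich_rep _) mi.
have [Z hZ] := dsigma (iter i quarter gen_a); have [W hW] := dsigma (iter i quarter gen_b).
have [D4 _] := teich_comm (sigma 0).
have D0 : \det (comm2 (sigma 0 (iter i quarter gen_a)) (sigma 0 (iter i quarter gen_b))) = bconst l.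
  by have := aut_comm (sigma 0) false ai; rewrite glb.
have [||| C [r [C0 r01 H]]] := @dangle_decay _ (sigma 0 (iter i quarter gen_a)) (sigma 0 (iter i quarter gen_b)) Z W.
- exact: hol_det.
- exact: hol_det.
- by rewrite D0.
exists C, r; split=> // s; apply: le_trans (H s).
have hw w : mder (fun t => sigma t (iter i quarter (posw w)) : 'M[R]_2)
    (wmd (sigma 0 (iter i quarter gen_a)) (sigma 0 (iter i quarter gen_b)) Z W w).
  have := mder_wm w hZ hW; congr mder; apply/funext => t.
  by have := wm_rep w (rep t).
have wE w : wm (sigma 0 (iter i quarter gen_a)) (sigma 0 (iter i quarter gen_b)) w = sigma 0 (iter i quarter (posw w)).
  by have := wm_rep w (rep 0).
have [pa pb] := ptwists_pwords s; rewrite pa pb -(dangle_speed (hw _) (hw _)) ?wE //.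
by rewrite -!wE comm_pwords ?hol_det.
Qed.

End Path.

End Aut.

(** * Mapping classes *)

Section Classes.
Implicit Types (f : F2 -> F2) (g : MCG).

Lemma mcg_aut_repr g : mcg_aut (val (repr g)). Proof. exact/asboolP/(valP (repr g)). Qed.

Lemma mcg_eq g g' c : (forall x, val (repr g') x = (val (repr g) x ^ c)%g) -> g = g'.
Proof.
move=> h; rewrite -[g]reprK -[g']reprK; apply/eqmodP; apply/asboolP.
by exists c.
Qed.

Definition mcg_class f (af : mcg_aut f) : MCG :=
  (\pi_({eq_quot outer_equiv}%qT) (exist (fun f => `[< mcg_aut f >]) f (asboolT af)))%qT.

Lemma mcg_class_repr f (af : mcg_aut f) : exists c, forall x, f x = (val (repr (mcg_class af)) x ^ c)%g.
Proof.
have : (repr (mcg_class af) = exist (fun f => `[< mcg_aut f >]) f (asboolT af) %[mod {eq_quot outer_equiv}])%qT.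
  by rewrite reprK.
by move/eqmodP => /asboolP[c h]; exists c.
Qed.

Definition mcg_shift f (af : mcg_aut f) g : MCG := mcg_class (mcg_aut_comp (mcg_aut_repr g) af).

Lemma mcg_shift_repr f (af : mcg_aut f) g :
  exists c, forall x, val (repr g) (f x) = (val (repr (mcg_shift af g)) x ^ c)%g.
Proof. exact: mcg_class_repr. Qed.

Lemma mcg_aut_inv f : mcg_aut f -> exists f', [/\ mcg_aut f', cancel f f' & cancel f' f].
Proof.
move=> [mf [f' k1 k2] [c fc]]; have mf' := can_morph mf k1 k2.
exists f'; split=> //; split=> //; first by exists f.
exists (f' c)^-1%g; have := k1 bdry; rewrite fc (morphJ _ _ mf') => h.
exact: (canRL (conjgK (f' c)) h).
Qed.

Lemma mcg_shift_bij f (af : mcg_aut f) : set_bij setT setT (mcg_shift af).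
Proof.
have [f' [af' k1 k2]] := mcg_aut_inv af; split=> //.
  move=> g g' _ _ E; have [c h] := mcg_shift_repr af g; have [c' h'] := mcg_shift_repr af g'.
  apply: (@mcg_eq _ _ (c^-1 * c')%g) => x.
  by rewrite -(k2 x) h' h -E conjgM conjgK.
move=> g _; exists (mcg_shift af' g) => //.
have [c h] := mcg_shift_repr af' g; have [c' h'] := mcg_shift_repr af (mcg_shift af' g).
apply: (@mcg_eq _ _ (c' * c)%g) => x.
by rewrite conjgM -h' -h k1.
Qed.

End Classes.

Section Assembly.
Variables (R : realType) (l : R).

(** The rotation of order four maps the pair of traces x, y and the trace z of
  the product to y, x and x y - z, which changes the sign of the derivative of
  2 z - x y. *)
Lemma dangle_swap (A B Y Z : 'M[R]_2) : dangle B (adj2 A) Z (adj2 Y) = - dangle A B Y Z.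
Proof.
rewrite /dangle.
have -> : comm2 B (adj2 A) = comm2 A B by apply: mx2P; rewrite /comm2 /adj2 !en2; ring.
have -> : \tr (Z *m adj2 A + B *m adj2 Y) =
    \tr Z * \tr A + \tr B * \tr Y - \tr (Y *m B + A *m Z).
  by rewrite /adj2 !tr2E !en2; ring.
have tA (U : 'M[R]_2) : \tr (adj2 U) = \tr U by rewrite /adj2 !tr2E !en2 addrC.
by rewrite !tA (mulrC (\tr B ^+ 2 - 4)); ring.
Qed.

(** The rates for the four rotations are replaced by the largest one. *)
Lemma speed_decay_unif (sigma : R -> teich l) :
  (forall u, exists Z, mder (fun t => sigma t u : 'M[R]_2) Z) ->
  exists C r : R, [/\ 0 <= C, 0 < r < 1 & forall i s, (i < 4)%N ->
  speed sigma (iter i quarter (ptwists s gen_a)) (iter i quarter (ptwists s gen_b)) <=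
  C * (r ^+ size (pwords s).1 * r ^+ size (pwords s).2)].
Proof.
move=> ds; elim: (4%N) => [|n [C [r [C0 /andP[r0 r1] H]]]].
  by exists 0, 2^-1; split=> //; apply/andP; split; lra.
have [C' [r' [C0' /andP[r0' r1'] H']]] := speed_decay ds n.
exists (C + C'), (Num.max r r'); split; first exact: addr_ge0.
  by rewrite lt_max r0 gt_max r1.
have pw k : r ^+ k <= Num.max r r' ^+ k by rewrite lerXn2r ?nnegrE ?le_max ?lexx // ?(ltW r0).
have pw' k : r' ^+ k <= Num.max r r' ^+ k.
  by rewrite lerXn2r ?nnegrE ?le_max ?lexx ?orbT // ?(ltW r0) ?(ltW r0').
have p0 k : 0 <= r ^+ k by rewrite exprn_ge0 // ltW.
have p0' k : 0 <= r' ^+ k by rewrite exprn_ge0 // ltW.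
move=> i s; rewrite ltnS leq_eqVlt => /predU1P[->|hi].
  apply: le_trans (H' s) _; apply: ler_pM; rewrite ?mulr_ge0 //; first by rewrite lerDr.
  by apply: ler_pM.
apply: le_trans (H i s hi) _; apply: ler_pM; rewrite ?mulr_ge0 //; first by rewrite lerDl.
by apply: ler_pM.
Qed.

(** The rotation on the right and the orientation do not change the speed. *)
Lemma mcg_coordinates (X : teich l) (sigma : R -> teich l) phi e0 :
  (forall u, exists Z, mder (fun t => sigma t u : 'M[R]_2) Z) -> mcg_aut phi ->
  exists k : ('I_4 * 'I_4 * bool) * seq bool,
   speed sigma (phi gen_a) (phi (gl (false, e0))) =
     speed sigma (iter k.1.1.1 quarter (ptwists k.2 gen_a)) (iter k.1.1.1 quarter (ptwists k.2 gen_b)) /\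
   exists c, phi gen_a = normal_map c k.1.1.1 k.2 k.1.1.2 gen_a /\
             phi gen_b = normal_map c k.1.1.1 k.2 k.1.1.2 (gl (false, k.1.2)).
Proof.
move=> ds ap; have [mp _ _] := ap.
have [psi [e [m Ea Eb]]] := mcg_aut_moves (teich_rep X) (teich_toric X) ap.
have [c [i [s [j N]]]] := moves_normalizable m; have mq := moves_morph m.
have i4 : (i %% 4 < 4)%N by rewrite ltn_mod.
have j4 : (j %% 4 < 4)%N by rewrite ltn_mod.
have NE u : normal_map c i s j u = normal_map c (i %% 4) s (j %% 4) u.
  by rewrite /normal_map (iter_quarter_mod i) (iter_quarter_mod j).
exists ((Ordinal i4, Ordinal j4, e), s); split; last by exists c; rewrite /= -!NE -!N.
have -> : speed sigma (phi gen_a) (phi (gl (false, e0))) = speed sigma (phi gen_a) (phi gen_b).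
  by rewrite glb; case: e0; rewrite ?(morphV _ mp) ?(speed_invr ds).
rewrite Ea Eb /=; have -> : speed sigma (psi gen_a) (psi (gl (false, e))) = speed sigma (psi gen_a) (psi gen_b).
  by rewrite glb; case: (e); rewrite ?(morphV _ mq) ?(speed_invr ds).
rewrite !N !NE /normal_map (speed_conj ds).
have mi := morph_comp (iter_quarter_morph (i %% 4)) (ptwists_morph s).
exact: (speed_quarter ds (j %% 4) mi).
Qed.

End Assembly.

(** * The vanishing of the sum *)

Section Esum.
Variables (R : realType) (T : choiceType) (V : T -> R).

Lemma bounded_summable (B : R) : (forall s : seq T, uniq s -> \sum_(x <- s) `|V x| <= B) ->
  summable [set: T] (fun x => (V x)%:E).
Proof.
move=> hB; apply: (@le_lt_trans _ _ B%:E); last exact: ltry.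
apply: ub_ereal_sup => _ [F [finF _] <-].
rewrite fsbig_finite //= sumEFin lee_fin; exact: hB (finmap.fset_uniq _).
Qed.

(** The symmetry exchanges the positive and the negative parts, whose sums are
  finite. *)
Lemma antisymmetric_sum (h : T -> T) : set_bij setT setT h -> (forall x, V (h x) = - V x) ->
  summable [set: T] (fun x => (V x)%:E) ->
  (esum [set: T] (fun x => (V x)%:E)^\+ - esum [set: T] (fun x => (V x)%:E)^\- = 0)%E.
Proof.
move=> bh hV sV; have sp := summable_funepos sV.
have -> : esum [set: T] (fun x => (V x)%:E)^\-%E = esum [set: T] (fun x => (V x)%:E)^\+%E.
  rewrite [RHS](reindex_esum _ _ _ _ bh); apply: eq_esum => x _.
  by rewrite funenegE funeposE hV EFinN.
apply: subee; move: sp; rewrite summableE.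
by congr (_ \is a fin_num); apply: eq_esum => x _; rewrite gee0_abs // funepos_ge0.
Qed.

End Esum.

Theorem theorem3 (R : realType) (l : R) (hl : 0 < l)
    (M : teich l) (alpha beta mu : F2)
    (halpha : simple_geodesic M alpha) (hbeta : simple_geodesic M beta)
    (hmeet : meet_once M alpha beta) (hpos : 0 < vee alpha beta M)
    (hmu : simple_geodesic M mu)
    (X : teich l) (sigma : R -> teich l) (hsigma : twist_path X mu sigma) :
  let angle (g : MCG) (t : R) : R :=
    vee (mcg_act g alpha) (mcg_act g beta) (sigma t) in
  let term (g : MCG) : \bar R := (derive1 (angle g) 0)%:E in
  [/\ forall g, derivable (angle g) 0 1,
      summable [set: MCG] term &
      (esum [set: MCG] term^\+ - esum [set: MCG] term^\- = 0)%E].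
Proof.
move=> angle term.
have [aa ia] := simple_geodesic_in halpha; have [ab ib] := simple_geodesic_in hbeta.
have [ha _ _] := ia; have [hb _ _] := ib.
have [h0 hc] := vee_pos_cross hpos.
have mab := meet_once_meets aa ab ha hb hmeet hc.
have [psi [e0 [mpsi pa pb]]] := basis_of_pair (teich_rep M) (teich_toric M) ia ib mab hc.
have [psi' [mpsi' k1 k2]] := moves_inv mpsi; have mp := moves_morph mpsi.
have ds := twist_mder hmu hsigma; have [dX hX] := choice ds.
pose F (g : MCG) : F2 -> F2 := val (repr g) \o psi.
have aF g : mcg_aut (F g) := mcg_aut_comp (mcg_aut_repr g) (moves_mcg_aut mpsi).
have mF g : morph (F g) by have [] := aF g.
pose A g := F g gen_a; pose B g := F g (gl (false, e0)).
pose V g := dangle (sigma 0 (A g)) (sigma 0 (B g)) (dX (A g)) (dX (B g)).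
have comm g t : \det (comm2 (sigma t (A g)) (sigma t (B g))) = bconst l by exact: aut_comm.
have D4 := (teich_comm X).1.
have hV g : hd (angle g) (V g).
  have -> : angle g = fun t => theta (sigma t (A g)) (sigma t (B g)).
    apply/funext => t; have [mf _ _] := mcg_aut_repr g.
    apply: (vee_aut (sigma t) (h := val (repr g) h0) (aF g)); first by rewrite /F /= pa.
    by rewrite /F /= pb (morphJ _ _ mf).
  by apply: (theta_derive (hX _) (hX _) _ _ D4 (comm g)) => t; exact: hol_det.
have dV g : derive1 (angle g) 0 = V g by rewrite derive1E; have [_ ->] := hV g.
have -> : term = fun g => (V g)%:E by apply/funext => g; rewrite /term dV.
have sV : summable [set: MCG] (fun g => (V g)%:E).
  have [C [r [C0 r01 H]]] := speed_decay_unif ds.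
  have [k hk] := choice (fun g => mcg_coordinates X (phi := F g) e0 ds (aF g)).
  apply: (@bounded_summable _ _ _ (#|{: 'I_4 * 'I_4 * bool}|%:R * C * ((1 - r)^-1 * (1 - r)^-1))).
  apply: (decay_sum (o := fun g => (k g).1) (p := fun g => size (pwords (k g).2).1)
    (q := fun g => size (pwords (k g).2).2)) => //.
    move=> g; rewrite (dangle_speed ds (hX _) (hX _) (comm g 0)) (hk g).1.
    exact: H.
  move=> g g' o1 /[swap] q1 /pwords_inj => /(_ q1) s1.
  have [_ [c [ga gb]]] := hk g; have [_ [c' [ga' gb']]] := hk g'.
  rewrite -o1 -s1 in ga' gb'.
  have E : F g' =1 (fun u => (F g u ^ (c^-1 * c'))%g).
    apply: (morph_ext (mF g')); first by move=> u v; rewrite mF conjMg.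
      by rewrite ga' ga /normal_map (conjgM _ c^-1%g) conjgK.
    by rewrite gb' gb /normal_map (conjgM _ c^-1%g) conjgK.
  apply: (@mcg_eq _ _ (c^-1 * c')%g) => u; rewrite -(k2 u); exact: E.
split=> [g||]; [by have [] := hV g | exact: sV |].
(* A lift of the quarter turn about the intersection point of alpha and beta:
   the inverse of [quarter] in the basis a, b when beta is the image of b^-1. *)
pose q := iter (if e0 then 3 else 1)%N quarter.
have aq : mcg_aut q.
  by rewrite /q; elim: (if e0 then _ else _) => [|n IH];
    [exact: moves_mcg_aut moves_id | exact: mcg_aut_comp (moves_mcg_aut (moves_quarter moves_id)) IH].
have qa : q gen_a = gl (false, e0) by rewrite /q; case: (e0); apply/val_inj; reflexivity.
have qb : q (gl (false, e0)) = gen_a^-1%g by rewrite /q; case: (e0); apply/val_inj; reflexivity.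
have as_ : mcg_aut (psi \o q \o psi').
  exact: mcg_aut_comp (mcg_aut_comp (moves_mcg_aut mpsi) aq) (moves_mcg_aut mpsi').
apply: (antisymmetric_sum (mcg_shift_bij as_)) => // g.
apply: hd_unique (hV _) _; rewrite -dangle_swap.
have -> : angle (mcg_shift as_ g) = fun t => theta (sigma t (B g)) (adj2 (sigma t (A g))).
  apply/funext => t; have [c hs] := mcg_shift_repr as_ g; have [mf _ _] := mcg_aut_repr g.
  rewrite /angle -(vee_conj _ _ _ c) /mcg_act -!hs /=.
  have aFq := mcg_aut_comp (aF g) aq.
  rewrite (vee_aut (sigma t) (phi := F g \o q) (e := e0) (h := val (repr g) (psi (q (psi' h0))))) //=.
  - by rewrite qa qb (morphV _ (mF g)) (repV (teich_rep _)).
  - by rewrite /F /= -pa k1.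
  rewrite -(morphJ _ _ mf) -(morphJ _ _ mp) /F /=; have [mq _ _] := aq.
  by rewrite -(morphJ _ _ mq) -(morphJ _ _ (moves_morph mpsi')) -pb k1.
apply: (theta_derive (hX _) (mder_adj (hX _)) _ _ D4) => t; rewrite ?det_adj2; try exact: hol_det.
rewrite -(comm g t); congr (\det _).
by apply: mx2P; rewrite /comm2 /adj2 !en2; ring.
Qed.
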